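(* Let $G=(V,E,\omega)$ be an undirected $n$-vertex graph with edge weights in $[1,W]$, and let $k,f\ge1$ be integers. There exists a randomized $f$-sensitive compact routing scheme in the forbidden-set setting such that, given a message $M$ at the source vertex $s$, the label of the destination $t$, and the labels of a set $F$ of at most $f$ forbidden edges (known to $s$), it routes $M$ from $s$ to $t$ in a distributed manner over a path of length at most $(8k-2)(|F|+1)\cdot \mathrm{dist}_{G\setminus F}(s,t)$ (with high probability, whenever $s,t$ are connected in $G\setminus F$). The routing table of each vertex has $\widetilde{O}(n^{1/k}\log(nW))$ bits, the message header has $\widetilde{O}(f)$ bits, and the labels of vertices and edges have $\widetilde{O}(n^{1/k}\log(nW))$ bits.
   Context: A routing scheme assigns each vertex $u$ a label and a routing table $R(u)$ (and here also labels to edges); the routing algorithm at a vertex $u$ holding the message determines, from the header, the destination's label and $R(u)$, the port of the next edge, and may edit the header. In the forbidden-set setting the labels of the forbidden (failed) edges $F$ are given to the source in advance, and routing must be in $G\setminus F$. The stretch is the ratio between the weighted length of the traversed route and $\mathrm{dist}_{G\setminus F}(s,t)$. $\widetilde{O}$ hides polylogarithmic factors in $n$; ''with high probability'' means with probability at least $1-1/n^c$ for a desired constant $c$, for each fixed query. *)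

(* Defs.v *)
From HB Require Import structures.
From mathcomp Require Import all_boot all_order all_algebra.
From mathcomp Require Import all_classical all_reals all_analysis.

Set Implicit Arguments.
Unset Strict Implicit.
Unset Printing Implicit Defensive.

Import Order.TTheory GRing.Theory Num.Theory.

Local Open Scope ring_scope.

(* A finite simple undirected graph with edge weights. The edge between u and v
   is the unordered pair [set u; v], so weights and edge labels carry no
   orientation; values of [weight] outside [edges] are irrelevant. *)
Record wgraph (R : realType) (V : finType) := WGraph {
  adj : rel V;
  adj_sym : symmetric adj;
  adj_irr : irreflexive adj;
  weight : {set V} -> R
}.

Section Graph.
Variables (R : realType) (V : finType) (G : wgraph R V).

Definition edges : {set {set V}} :=
  [set e | [exists u, exists v, adj G u v && (e == [set u; v])]].

Definition weights_in (W : R) : Prop :=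
  forall e, e \in edges -> 1 <= weight G e <= W.

Definition adj_minus (F : {set {set V}}) : rel V :=
  [rel u v | adj G u v && ([set u; v] \notin F)].

(* The walk with vertex sequence u :: p, edges counted with multiplicity. *)
Fixpoint walk_length (u : V) (p : seq V) : R :=
  if p is v :: p' then weight G [set u; v] + walk_length v p' else 0.

(* Meaningful only when t is reachable from s: [inf] of the empty set is 0. *)
Definition dist_minus (F : {set {set V}}) (s t : V) : R :=
  inf [set x | exists p, [/\ path (adj_minus F) s p, last s p = t
                           & x = walk_length s p]]%classic.

(* [port u] lists the neighbours of u: its i-th entry is the vertex reached
   from u through port i, with 0 <= i < deg u. *)
Definition port_numbering (port : V -> seq V) : Prop :=
  forall u, uniq (port u) /\ (forall v, (v \in port u) = adj G u v).

End Graph.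

Definition bits := seq bool.

(* [alg_init] takes the labels of the forbidden edges, the label of t and R(s),
   and returns the initial header. [alg_step] takes the current header, the
   label of t and the table of the current vertex, and returns the outgoing port
   together with the edited header, or [None] to stop and deliver the message at
   the current vertex. *)
Record routing_algorithm := RoutingAlgorithm {
  alg_init : seq bits -> bits -> bits -> bits;
  alg_step : bits -> bits -> bits -> option (nat * bits)
}.

Record routing_data (V : finType) := RoutingData {
  vlabel : V -> bits;
  elabel : {set V} -> bits;
  table : V -> bits
}.

Section Routing.
Variables (A : routing_algorithm) (V : finType) (port : V -> seq V).
Variables (S : routing_data V) (s t : V) (Fs : seq {set V}).

Definition initial_header : bits :=
  alg_init A [seq elabel S e | e <- Fs] (vlabel S t) (table S s).

(* [message_at p u h]: after the message left s and visited successively the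
   vertices of p, it is at u with header h. *)
Inductive message_at : seq V -> V -> bits -> Prop :=
| message_start : message_at [::] s initial_header
| message_hop p u h i h' v :
    message_at p u h ->
    alg_step A h (vlabel S t) (table S u) = Some (i, h') ->
    onth (port u) i = Some v ->
    message_at (rcons p v) v h'.

Definition delivered_along (p : seq V) : Prop :=
  exists h, message_at p t h /\ alg_step A h (vlabel S t) (table S t) = None.

End Routing.

(* The message is delivered along a walk in G minus F of length at most [len]. *)
Definition routes_within (A : routing_algorithm) (R : realType) (V : finType)
    (G : wgraph R V) (port : V -> seq V) (S : routing_data V) (s t : V)
    (F : {set {set V}}) (Fs : seq {set V}) (len : R) : Prop :=
  exists p, [/\ delivered_along A port S s t Fs p,
                path (adj_minus G F) s p
              & walk_length G s p <= len].

(* Probability of an event under r independent fair coins. *)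
Definition coin_prob (R : realType) (r : nat) (P : r.-tuple bool -> Prop) : R :=
  #|[set x | `[< P x >]]|%:R / 2 ^+ r.

(* A bound in O~(g), with hidden factor C (1 + ln n)^D. The summand 1 only
   matters at n = 1, where ln n vanishes. *)
Definition soft_O (R : realType) (C : R) (D n : nat) (g : R) : R :=
  C * g * (1 + ln n%:R) ^+ D.

(* Main.v *)
Require Import Defs.
From Stdlib Require Import PArith.
From HB Require Import structures.
From mathcomp Require Import all_boot all_order all_algebra.
From mathcomp Require Import all_classical all_reals all_analysis.
From mathcomp Require Import finfield zify ring lra.

Set Implicit Arguments.
Unset Strict Implicit.
Unset Printing Implicit Defensive.

Import Order.TTheory GRing.Theory Num.Theory.

(** For every relevant scale [rho = 2^i], an Awerbuch-Peleg sparse cover gives clusters in which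
    every vertex occurs [O(n^(1/k) log n)] times; each cluster is spanned by a shortest-path tree of
    depth [(2k-1) rho], and every ball of radius [rho] lies in some cluster. Only scales within a
    factor [n] of some edge weight matter, so a cluster index has [O(log n)] bits even when [W] is
    huge.

    In a cluster, preorder numbers turn subtrees into intervals. Each edge of the cluster is
    sampled at geometric rates, and a set of sampled edges is summarised by the sum of the powers
    [a^(name e)] of a random element [a] of a field of characteristic 2. In such a sum over the
    vertices of a set, inner edges cancel and only the cut remains; moreover the sum over a union of
    components of [T - F] is determined by the prefix sums stored in the labels of the edges of
    [F]. A one-edge cut sample reveals the name of the edge, so [O(log n)] Boruvka rounds with fresh
    randomness reconnect the components of [T - F], each round being independent of the partition
    it is applied to.

    The source picks the first cluster in which it succeeds. It reaches [t] through at most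
    [|F| + 1] tree segments of length at most [2 (2k-1) rho], joined by at most [|F|] edges of weight
    at most [rho], where [rho <= 2 dist], hence the stretch [(8k-2)(|F|+1)]. *)

(** * Prefix-free codes *)

(** The source sees labels, not the graph, so all it evaluates must depend on preorder positions
    alone. The indicator of a union of components of [T - F] changes only at ends of the intervals
    of forbidden tree edges; summation by parts then turns the prefix sums at these ends into a sum
    over a cut. That cut still contains forbidden edges: in characteristic 2 they are removed by
    adding them once more, so an edge label also holds the edge's number and sample values. The
    source may succeed in another cluster than the one known to contain the ball around [s]. Hence
    the coins must be good in all clusters at once, so that every edge found is a genuine surviving
    edge. With [b = lg n] there are at most [2^(4b)] clusters and [b <= 2^b] rounds, so each round
    may fail with probability at most [2^(-(c+5)b)]. In every round the union bound runs over the
    cuts of the current classes only. This is legitimate because the state depends on earlier rounds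
    and on [F], which is fixed before the coins. The header bound is demanded for all coins, good or
    bad, so the algorithm itself drops a header that is too long. *)

Class code (T : Type) := Code {
  enc : T -> bits;
  enc_prefix_free : forall x y r r', enc x ++ r = enc y ++ r' -> x = y /\ r = r'
}.

Lemma enc_inj (T : Type) (cT : code T) : injective (enc (T := T)).
Proof.
by move=> x y e; have [|//] := @enc_prefix_free T cT x y [::] [::]; rewrite e.
Qed.

(** A routing algorithm is just a function on bit strings, so decoding and the search at the source
    are made by classical choice, with a default when there is nothing to choose. *)
Definition choose_or (T : Type) (d : T) (P : T -> Prop) : T :=
  if pselect (exists x, P x) is left h then projT1 (cid h) else d.

Lemma choose_orP (T : Type) (d : T) (P : T -> Prop) : (exists x, P x) -> P (choose_or d P).
Proof. by rewrite /choose_or; case: pselect => // h _; case: (cid h). Qed.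

Definition dec (T : Type) (cT : code T) (d : T) (b : bits) : T :=
  choose_or d (fun x => enc x = b).

Lemma encK (T : Type) (cT : code T) (d x : T) : dec cT d (enc x) = x.
Proof.
by apply: (@enc_inj _ cT); apply: (choose_orP d (P := fun y => enc y = enc x)); exists x.
Qed.

#[export] Instance code_bool : code bool.
Proof. by exists (fun x => [:: x]) => x y r r' [-> ->]. Defined.

Section CodePair.
Context (T U : Type) (cT : code T) (cU : code U).

Definition enc_pair (x : T * U) : bits := enc x.1 ++ enc x.2.

Lemma enc_pair_prefix_free x y r r' :
  enc_pair x ++ r = enc_pair y ++ r' -> x = y /\ r = r'.
Proof.
case: x y => [x1 x2] [y1 y2]; rewrite /enc_pair /= -!catA.
by move=> /(@enc_prefix_free _ cT) [-> /(@enc_prefix_free _ cU) [-> ->]].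
Qed.

#[export] Instance code_pair : code (T * U) := Code enc_pair_prefix_free.
End CodePair.

Section CodeSeq.
Context (T : Type) (cT : code T).

Fixpoint enc_seq (s : seq T) : bits :=
  if s is x :: s' then true :: enc x ++ enc_seq s' else [:: false].

Lemma enc_seq_prefix_free x y r r' :
  enc_seq x ++ r = enc_seq y ++ r' -> x = y /\ r = r'.
Proof.
elim: x y => [|a x IH] [|b y] //= [] //.
by rewrite -!catA => /(@enc_prefix_free _ cT) [-> /IH [-> ->]].
Qed.

#[export] Instance code_seq : code (seq T) := Code enc_seq_prefix_free.
End CodeSeq.

Fixpoint pos_bits (p : positive) : bits :=
  match p with
  | BinNums.xH => [::]
  | BinNums.xO q => false :: pos_bits q
  | BinNums.xI q => true :: pos_bits q
  end.

Fixpoint bits_pos (s : bits) : positive :=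
  match s with
  | [::] => BinNums.xH
  | b :: s' => if b then BinNums.xI (bits_pos s') else BinNums.xO (bits_pos s')
  end.

Lemma bits_posK : cancel bits_pos pos_bits.
Proof. by elim=> [|[] s IH] //=; rewrite IH. Qed.

Lemma pos_bitsK : cancel pos_bits bits_pos.
Proof. by elim=> [p IH|p IH|] //=; rewrite IH. Qed.


Lemma pos_nat_xO p : Pos.to_nat (BinNums.xO p) = (Pos.to_nat p).*2.
Proof. by rewrite Pnat.Pos2Nat.inj_xO -mul2n. Qed.

Lemma pos_nat_xI p : Pos.to_nat (BinNums.xI p) = (Pos.to_nat p).*2.+1.
Proof. by rewrite Pnat.Pos2Nat.inj_xI -mul2n. Qed.

Lemma pos_bits_size p : 2 ^ size (pos_bits p) <= Pos.to_nat p < 2 ^ (size (pos_bits p)).+1.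
Proof.
elim: p => [p IH|p IH|] //=; rewrite ?pos_nat_xI ?pos_nat_xO !expnS !mul2n.
  move/andP: IH => [h1 h2]; rewrite leqW ?leq_double //=.
  by rewrite ltn_Sdouble -mul2n -expnS.
by rewrite leq_double ltn_double -mul2n -expnS.
Qed.

(** Dropping the leading one of [m + 1] gives a bijection with bit strings; the flag that [code_seq]
    adds to every bit makes the code self-delimiting, at two bits per digit. *)
Definition enc_nat (m : nat) : bits := enc (pos_bits (Pos.of_succ_nat m)).

Lemma enc_nat_prefix_free x y r r' :
  enc_nat x ++ r = enc_nat y ++ r' -> x = y /\ r = r'.
Proof.
move=> /(@enc_prefix_free (seq bool) _) [/(can_inj pos_bitsK) e ->]; split=> //.
exact: SuccNat2Pos.inj e.
Qed.

#[export] Instance code_nat : code nat := Code enc_nat_prefix_free.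

Lemma size_enc_pair (T U : Type) (cT : code T) (cU : code U) (x : T * U) :
  size (enc x) = (size (enc x.1) + size (enc x.2))%N.
Proof. by rewrite /= /enc_pair size_cat. Qed.

Lemma size_enc_seq_le (T : eqType) (cT : code T) (s : seq T) m :
  (forall x, x \in s -> size (enc x) <= m) -> size (enc s) <= (size s * m.+1).+1.
Proof.
elim: s => [//|a s IH] h.
have h2 : size (enc s) <= (size s * m.+1).+1.
  by apply: IH => x xs; apply: h; rewrite inE xs orbT.
have ha := h a (mem_head _ _); move: h2 => /=; rewrite size_cat mulSn; lia.
Qed.

Lemma size_enc_bits (s : bits) : size (enc s) = (size s).*2.+1.
Proof. by elim: s => //= a s ->; rewrite doubleS. Qed.

Lemma size_enc_nat m l : m < 2 ^ l -> size (enc m) <= l.*2.+1.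
Proof.
move=> h; rewrite [enc m]/= /enc_nat size_enc_bits ltnS leq_double.
have /andP [h1 _] := pos_bits_size (Pos.of_succ_nat m).
move: h1; rewrite SuccNat2Pos.id_succ => h1.
by rewrite -(leq_exp2l (m := 2)) // (leq_trans h1).
Qed.

(** The top bit one that [bits_pos] adds separates strings of different lengths. This number turns
    the code of an edge into an exponent. *)
Definition bits_nat (s : bits) : nat := Pos.to_nat (bits_pos s).

Lemma bits_nat_inj : injective bits_nat.
Proof. by move=> s t /Pos2Nat.inj /(can_inj bits_posK). Qed.

Lemma bits_nat_lt s : bits_nat s < 2 ^ (size s).+1.
Proof.
by have /andP [_] := pos_bits_size (bits_pos s); rewrite bits_posK.
Qed.

(** * Counting lemmas for finite uniform probability *)

Lemma card_set_sum (T : finType) (P : pred T) : #|[set x | P x]| = \sum_x (P x : nat).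
Proof. by rewrite -sum1_card big_mkcond; apply: eq_bigr => x _; rewrite inE; case: (P x). Qed.

(** Here and below, [#|A| * M <= #|T|] says in integers that a uniform point of [T] lies in [A] with
    probability at most [1/M]. The bound for each fixed second coordinate is averaged. *)
Lemma card_pair_le (T U : finType) (P : T -> U -> bool) M :
  (forall u, #|[set t | P t u]| * M <= #|T|) ->
  #|[set p : T * U | P p.1 p.2]| * M <= #|{: T * U}|.
Proof.
move=> h; rewrite card_set_sum -(pair_bigA _ (fun t u => P t u : nat)) //=.
rewrite exchange_big /= big_distrl /= card_prod mulnC -sum_nat_const.
by apply: leq_sum => u _; rewrite -card_set_sum.
Qed.

Section Adaptive.
Variables (Y : finType) (St : Type) (step : St -> Y -> St) (bad : St -> Y -> bool).

Fixpoint ever_bad (st : St) (ys : seq Y) : bool :=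
  if ys is y :: ys' then bad st y || ever_bad (step st y) ys' else false.

(** The state is determined by earlier samples while the next sample is fresh, so the bound for
    every fixed state applies conditionally; a union bound over the steps gives [L/M]. *)
Lemma card_ever_bad M (h : forall st, #|[set y | bad st y]| * M <= #|Y|) L st :
  #|[set t : L.-tuple Y | ever_bad st t]| * M <= L * #|Y| ^ L.
Proof.
elim: L st => [|L IH] st.
  by rewrite leqn0 muln_eq0 cards_eq0; apply/orP; left; apply/eqP/setP => t; rewrite !inE tuple0.
pose c (p : Y * L.-tuple Y) : L.+1.-tuple Y := [tuple of p.1 :: p.2].
have cb : bijective c.
  exists (fun t : L.+1.-tuple Y => (thead t, [tuple of behead t])).
    by case=> y t; rewrite /c theadE /=; congr pair; apply: val_inj.
  by move=> t; rewrite /c /= [RHS]tuple_eta; apply: val_inj.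
rewrite card_set_sum (reindex c) /=; last exact: onW_bij.
rewrite -(pair_bigA _ (fun y (t : L.-tuple Y) => (bad st y || ever_bad (step st y) t) : nat)) //=.
apply: (@leq_trans ((\sum_y (bad st y * #|Y| ^ L + \sum_(t : L.-tuple Y) ever_bad (step st y) t)) * M)).
  rewrite leq_mul2r; apply/orP; right; apply: leq_sum => y _.
  case: (bad st y) => /=; last by rewrite mul0n.
  by rewrite mul1n sum_nat_const muln1 card_tuple leq_addr.
rewrite big_split /= mulnDl mulSn leq_add //.
  rewrite -big_distrl /= mulnAC expnS leq_mul2r; apply/orP; right.
  by rewrite -card_set_sum.
rewrite big_distrl /= expnS mulnCA -sum_nat_const; apply: leq_sum => y _.
by rewrite -card_set_sum.
Qed.
End Adaptive.

Lemma card_ffun_forall (Z : finType) K (B : pred Z) :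
  #|[set y : {ffun 'I_K -> Z} | [forall j, B (y j)]]| = #|[set z | B z]| ^ K.
Proof.
rewrite -[K in RHS]card_ord -card_ffun_on; apply: eq_card => y; rewrite !inE.
by apply/forallP/ffun_onP => h j; have := h j; rewrite inE.
Qed.

Lemma card_ffun_exists (Z : finType) K (B : pred Z) M :
  #|[set z | B z]| * M <= #|Z| ->
  #|[set y : {ffun 'I_K -> Z} | [exists j, B (y j)]]| * M <= K * #|Z| ^ K.
Proof.
move=> h.
have h1 (j : 'I_K) : #|[set y : {ffun 'I_K -> Z} | B (y j)]| * M <= #|Z| ^ K.
  pose fam (i : 'I_K) : pred Z := [pred z | (i == j) ==> B z].
  have -> : #|[set y : {ffun 'I_K -> Z} | B (y j)]| = #|family fam|.
    apply: eq_card => y; rewrite !inE; apply/idP/familyP => [hy i|/(_ j)]; rewrite !inE ?eqxx //.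
    by apply/implyP => /eqP ->.
  rewrite card_family foldrE big_map big_enum /= (bigD1 j) //= -mulnAC.
  have -> : \prod_(i | i != j) #|fam i| = #|Z| ^ K.-1.
    rewrite (eq_bigr (fun=> #|Z|)) => [|i /negPf hi].
      by rewrite prod_nat_const; congr (_ ^ _); rewrite cardC1 card_ord.
    by apply: eq_card => z; rewrite !inE hi.
  have -> : #|fam j| = #|[set z | B z]| by apply: eq_card => z; rewrite !inE eqxx.
  by case: K j fam => [[]//|K'] j fam /=; rewrite expnS leq_mul2r h orbT.
apply: (@leq_trans ((\sum_(j < K) #|[set y : {ffun 'I_K -> Z} | B (y j)]|) * M)).
  rewrite leq_mul2r; apply/orP; right.
  rewrite -sum1_card; apply: (@leq_trans (\sum_(y : {ffun 'I_K -> Z}) \sum_(j < K) B (y j))).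
    rewrite big_mkcond; apply: leq_sum => y _; rewrite inE; case: existsP => // -[j hj].
    by rewrite (bigD1 j) //= hj.
  by rewrite exchange_big; apply: leq_sum => j _; rewrite -card_set_sum.
rewrite big_distrl /= -[X in _ <= X * _]card_ord -sum_nat_const.
by apply: leq_sum => j _.
Qed.

Lemma cards_bigcup_le (T I : finType) (A : I -> {set T}) M N :
  (forall i, #|A i| * M <= N) -> #|\bigcup_i A i| * M <= #|I| * N.
Proof.
move=> h; apply: (@leq_trans ((\sum_i #|A i|) * M)).
  rewrite leq_mul2r; apply/orP; right.
  apply: (big_ind2 (fun (x : {set T}) y => #|x| <= y)); rewrite ?cards0 // => a b c d h1 h2.
  by rewrite (leq_trans (leq_card_setU _ _)) // leq_add.
by rewrite big_distrl /= -sum_nat_const; apply: leq_sum.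
Qed.

(** * Isolating one edge of a cut by random sampling *)

Section Isolation.
Variables (E : finType) (La : nat).

(** A single uniform number per edge serves all levels: for [l <= La] it is below the threshold with
    probability [2^-l]. Only this number has to be stored with the edge. *)
Definition sampled (g : {ffun E -> 'I_(2 ^ La)}) (l : nat) (e : E) : bool :=
  g e < 2 ^ (La - l).

Definition sample (g : {ffun E -> 'I_(2 ^ La)}) (l : nat) (D : {set E}) : {set E} :=
  [set e in D | sampled g l e].

(** Bernoulli's inequality [(1 - S/N)^j >= 1 - j S/N], multiplied by [N^(j+1)]. *)
Lemma bernoulli_nat N S j : S <= N -> N ^ j.+1 <= (N - S) ^ j * N + j * S * N ^ j.
Proof.
move=> SN; elim: j => [|j IH]; first by rewrite !mul0n addn0 expn1 mul1n.
have {}IH := leq_mul (leqnn N) IH.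
rewrite [N ^ j.+2]expnS (leq_trans IH) // mulnDr.
have h : N * ((N - S) ^ j * N) <= (N - S) ^ j.+1 * N + S * N ^ j.+1.
  rewrite [(N - S) ^ j.+1]expnS [N ^ j.+1]expnS.
  have h1 : (N - S) ^ j <= N ^ j by case: (j) => // j1; rewrite leq_exp2r // leq_subr.
  have h2 : S * (N * (N - S) ^ j) <= S * (N * N ^ j) by rewrite !leq_mul.
  have h3 : N * ((N - S) ^ j * N) = (N - S + S) * ((N - S) ^ j * N) by rewrite subnK.
  rewrite h3; lia.
apply: leq_trans (leq_add h (leqnn _)) _.
rewrite -addnA leq_add2l [N ^ j.+1]expnS; lia.
Qed.

(** With [p = 2^-l] and [m = #|D|], this level puts [m p] between 1/4 and 1/2. Exactly one edge is
    sampled with probability [m p (1 - p)^(m-1) >= m p (1 - m p) >= 1/8]. *)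
Lemma card_isolated (D : {set E}) (l := (trunc_log 2 #|D|).+2) :
  D != finset.set0 -> l <= La ->
  #|[set g : {ffun E -> 'I_(2 ^ La)} | #|sample g l D| != 1]| * 8
    <= 7 * #|{ffun E -> 'I_(2 ^ La)}|.
Proof.
rewrite -card_gt0 => D0 lLa.
set N := 2 ^ La; set S := 2 ^ (La - l); set m := #|D|.
have SN : S * 2 ^ l = N by rewrite /S /N -expnD subnK.
have /andP [ml mu] := trunc_log_bounds (isT : 1 < 2) D0.
have m4 : N <= 4 * (m * S).
  by rewrite -SN /l !expnS !mulnA [S * _]mulnC mulnC -/m; move: ml; rewrite -/m; nia.
have m2 : 2 * (m * S) <= N.
  by rewrite -SN /l !expnS; move: mu; rewrite expnS -/m; nia.
have N0 : 0 < N by rewrite expn_gt0.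
(* The functions in [family (fam e)] are those that sample [e] and no other edge of [D]. These
   product sets are disjoint for distinct [e], so their sizes add up. *)
pose fam e (e' : E) : pred 'I_N :=
  [pred z : 'I_N | if e' == e then z < S else if e' \in D then S <= z else true].
have cS : #|[pred z : 'I_N | z < S]| = S.
  have SleN : S <= N by rewrite -SN leq_pmulr // expn_gt0.
  rewrite -sum1_card big_mkcond /= (eq_bigr (fun i : 'I_N => ((i : nat) < S) : nat)); last first.
    by move=> i _; rewrite inE; case: ltnP.
  rewrite -(big_mkord xpredT (fun i => (i < S) : nat)) (big_cat_nat (n := S)) //=.
  rewrite [X in X + _]big_nat (eq_bigr (fun=> 1)); last by move=> i /andP [_ ->].
  rewrite -big_nat sum_nat_const_nat subn0 muln1 big_nat big1 ?addn0 // => i /andP [h _].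
  by rewrite ltnNge h.
have cSC : #|[pred z : 'I_N | S <= z]| = N - S.
  have := cardC [pred z : 'I_N | z < S]; rewrite cS card_ord => hN.
  rewrite -[N in RHS]hN addKn.
  by apply: eq_card => z; rewrite !inE -leqNgt.
have cfam e : e \in D -> #|family (fam e)| = S * (N - S) ^ m.-1 * N ^ (#|E| - m).
  move=> eD; rewrite card_family foldrE big_map big_enum /=.
  rewrite (bigID (mem D)) /= (bigD1 e) //=.
  rewrite (eq_bigr (fun=> N - S)); last first.
    move=> i /andP [iD /negPf ie]; rewrite -cSC; apply: eq_card => z; rewrite !inE ie.
    by rewrite [i \in D]iD.
  rewrite [X in _ * X](eq_bigr (fun=> N)); last first.
    move=> i /negPf iD; rewrite -[RHS]card_ord; apply: eq_card => z; rewrite !inE.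
    by case: eqP => [ie|]; rewrite ?iD //; move: iD; rewrite ie eD.
  have -> : #|fam e e| = S by rewrite -[RHS]cS; apply: eq_card => z; rewrite !inE eqxx.
  rewrite !prod_nat_const; congr (_ * _ ^ _ * _ ^ _).
    by rewrite /m (cardsD1 e) eD /=; apply: eq_card => i; rewrite !inE andbC.
  by rewrite /m -[D in RHS]finset.setCK -cardsCs; apply: eq_card => i; rewrite !inE.
have iso : m * (S * (N - S) ^ m.-1 * N ^ (#|E| - m)) <=
    #|[set g : {ffun E -> 'I_N} | #|sample g l D| == 1]|.
  rewrite -sum_nat_const -(eq_bigr _ cfam).
  rewrite (eq_bigr (fun e => \sum_(g : {ffun E -> 'I_N}) (g \in family (fam e)))); last first.
    by move=> e _; rewrite -card_set_sum; apply: eq_card => g; rewrite !inE.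
  rewrite exchange_big /= card_set_sum; apply: leq_sum => g _.
  have famP e : e \in D -> g \in family (fam e) -> sample g l D = [set e].
    move=> eD /familyP h; apply/setP => e'; rewrite !inE /sampled.
    have := h e'; rewrite !inE; case: (eqVneq e' e) => [->|ne]; first by rewrite eD => ->.
    by case: (e' \in D) => //; rewrite leqNgt => /negbTE.
  have [/existsP [e /andP [eD he]]|/existsPn h] :=
    boolP [exists e, (e \in D) && (g \in family (fam e))]; last first.
    by rewrite big1 // => e eD; have := h e; rewrite eD /= => /negbTE ->.
  rewrite (famP _ eD he) cards1 eqxx (bigD1 e) //= he big1 // => e' /andP [e'D ne].
  apply/eqP; rewrite eqb0; apply/negP => he'.
  have := famP _ e'D he'; rewrite (famP _ eD he) => /setP /(_ e'); rewrite !inE eqxx.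
  by rewrite (negbTE ne).
have tot : #|{ffun E -> 'I_N}| = N ^ #|E| by rewrite card_ffun card_ord.
have cpl : #|[set g : {ffun E -> 'I_N} | #|sample g l D| != 1]| =
   N ^ #|E| - #|[set g : {ffun E -> 'I_N} | #|sample g l D| == 1]|.
  by rewrite -tot [LHS]cardsCs; congr (_ - _); apply: eq_card => g; rewrite !inE negbK.
rewrite tot cpl; set c := #|_| in iso *.
suff : N ^ #|E| <= 8 * c by lia.
apply: leq_trans (leq_mul (leqnn 8) iso).
have -> : N ^ #|E| = N ^ m * N ^ (#|E| - m) by rewrite -expnD subnKC // max_card.
rewrite !mulnA leq_mul2r; apply/orP; right.
have [j mj] : exists j, m = j.+1 by exists m.-1; rewrite prednK.
have SleN : S <= N by rewrite -SN leq_pmulr // expn_gt0.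
have B := @bernoulli_nat N S j SleN.
rewrite mj /= -(leq_pmul2r N0); move: m4 m2; rewrite mj => m4 m2.
have e1 : N ^ j * N = N ^ j.+1 by rewrite expnSr.
move: B; rewrite -e1; move: (N ^ j) ((N - S) ^ j) => A A' B.
nia.
Qed.
End Isolation.

(** * Fingerprints in finite fields *)

Section Fingerprint.
Variables (F : finFieldType) (E : finType) (num : E -> nat) (X : nat).

(** A false match with [x] makes [a] a root of the sum of the ['X^(num e)] minus ['X^x]. Distinct
    names give distinct monomials, so this polynomial is nonzero unless the sample is the single
    edge named [x]; it has fewer than [X] roots, and there are [X] candidates [x]. *)
Lemma card_collision (D : {set E}) (num_lt : {in D, forall e, num e < X})
    (num_inj : {in D &, injective num}) :
  #|[set a : F | [exists x : 'I_X, (a ^+ x == \sum_(e in D) a ^+ num e)%R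
                   && ~~ [exists e, (D == [set e]) && (num e == x)]]]| <= X * X.
Proof.
have h (x : 'I_X) : #|[set a : F | (a ^+ x == \sum_(e in D) a ^+ num e)%R
                   && ~~ [exists e, (D == [set e]) && (num e == x)]]| * 1 <= X.
  rewrite muln1.
  have [_|/existsPn ng] := boolP [exists e, (D == [set e]) && (num e == x)].
    by rewrite (_ : [set _ | _] = finset.set0) ?cards0 //; apply/setP => a; rewrite !inE andbF.
  pose p : {poly F} := (\sum_(e in D) 'X^(num e) - 'X^x)%R.
  have p0 : p != 0%R.
    have [D0|[e0 e0D]] := set_0Vmem D.
      rewrite /p D0 big_set0 sub0r oppr_eq0; apply/eqP => /(congr1 (fun q : {poly F} => q`_x)%R).
      by rewrite coefXn eqxx coef0 => /eqP; rewrite oner_eq0.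
    have [e eD ex] : exists2 e, e \in D & num e != x.
      have [/existsP [e /andP [eD ne]]|/existsPn h] := boolP [exists e, (e \in D) && (num e != x)].
        by exists e.
      have hD e : e \in D -> num e = x.
        by move=> eD; have := h e; rewrite eD /= negbK => /eqP.
      have := ng e0; rewrite (hD _ e0D) eqxx andbT; case/eqP; apply/setP => e; rewrite !inE.
      apply/idP/eqP => [eD|-> //]; apply: num_inj => //; by rewrite !hD.
    apply/eqP => /(congr1 (fun q : {poly F} => q`_(num e))%R).
    rewrite coefB coef_sum coefXn (negbTE ex) subr0 coef0 (bigD1 e) //= coefXn eqxx big1.
      by rewrite addr0 => /eqP; rewrite oner_eq0.
    move=> e' /andP [e'D ne]; rewrite coefXn; case: eqP => // /(num_inj _ _ eD e'D) he.
    by rewrite he eqxx in ne.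
  have szp : size p <= X.
    rewrite (leq_trans (size_polyD _ _)) // geq_max size_polyN size_polyXn ltn_ord andbT.
    by rewrite (leq_trans (size_sum _ _ _)) //; apply/bigmax_leqP => e eD; rewrite size_polyXn num_lt.
  rewrite cardE; apply: ltnW; apply: leq_trans szp.
  apply: max_poly_roots => //; last exact: enum_uniq.
  apply/allP => a; rewrite mem_enum inE andbT => /eqP ha.
  rewrite /root /p hornerD hornerN hornerXn horner_sum ha subr_eq0.
  by apply/eqP/eq_bigr => e _; rewrite hornerXn.
have := cards_bigcup_le h; rewrite muln1 card_ord; apply: leq_trans.
apply: subset_leq_card; apply/fintype.subsetP => a; rewrite inE => /existsP [x hx].
by apply/bigcupP; exists x; rewrite ?inE.
Qed.
End Fingerprint.

(** * Walks and shortest-path trees *)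

Section Walks.
Variables (R : realType) (V : finType) (G : wgraph R V).
Local Notation len := (walk_length G).
Local Notation w u v := (weight G [set u; v]).

Lemma walk_length_cat u p q : (len u (p ++ q) = len u p + len (last u p) q)%R.
Proof. by elim: p u => [|v p IH] u /=; rewrite ?add0r // IH addrA. Qed.

Lemma walk_length_rev u p : len (last u p) (rev (belast u p)) = len u p.
Proof.
elim: p u => [//|v p IH] u; rewrite [LHS]/= rev_cons -cats1 walk_length_cat IH /=.
by case: p {IH} => [|x p] /=; rewrite ?rev_cons ?last_rcons addr0 addrC finset.setUC.
Qed.

Definition heavy_enough (e : rel V) : Prop :=
  forall u v, e u v -> (1 <= w u v)%R.

Section Relation.
Variables (e : rel V) (e_sym : symmetric e) (e_ge1 : heavy_enough e).

Lemma walk_length_ge0 u p : path e u p -> (0 <= len u p)%R.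
Proof.
elim: p u => [//|v p IH] u /= /andP [uv /IH]; have := e_ge1 uv; lra.
Qed.

Lemma walk_rev u p : path e u p ->
  exists q, [/\ path e (last u p) q, last (last u p) q = u, len (last u p) q = len u p
              & (last u p :: q) =i (u :: p)].
Proof.
move=> up; exists (rev (belast u p)); split.
- by rewrite rev_path; rewrite (eq_path (e' := e)) // => x y; rewrite e_sym.
- by case: p {up} => [//|v p] /=; rewrite rev_cons last_rcons.
- exact: walk_length_rev.
- by move=> x; rewrite -rev_rcons -lastI mem_rev.
Qed.

Lemma walk_shorten u p : path e u p ->
  exists q, [/\ path e u q, last u q = last u p, uniq (u :: q) & (len u q <= len u p)%R].
Proof.
elim: p u => [|v p IH] u; first by exists [::].
move=> /= /andP [uv /IH [q [vq <- Uq lq]]]; have w1 := e_ge1 uv.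
have [|nuq] := boolP (u \in v :: q); last first.
  by exists (v :: q); rewrite /= uv vq; split=> //; [apply/andP|lra].
move=> hu; case/splitPl: hu vq Uq lq => a b lab; rewrite cat_path last_cat -cat_cons cat_uniq.
rewrite lab walk_length_cat lab => /andP [va ub] /and3P [_ hab Ub] lq.
exists b; split=> //; last by have := walk_length_ge0 va; lra.
rewrite /= Ub andbT; apply: contra hab => hub; apply/hasP; exists u => //.
by rewrite -lab /= mem_last.
Qed.

(** Walks are infinitely many, but shortening to simple ones leaves a finite type of bounded
    sequences in which a minimum exists. *)
Lemma min_walk u v : connect e u v ->
  exists p, [/\ path e u p, last u p = v &
     forall q, path e u q -> last u q = v -> (len u p <= len u q)%R].
Proof.
move=> /connectP [p0 up0 ->].
have [p1 [up1 l1 U1 _]] := walk_shorten up0.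
have bs q : uniq (u :: q) -> size q <= #|V|.
  by move=> /card_uniqP /= h; apply: ltnW; rewrite -h max_card.
pose P (s : {bseq #|V| of V}) := path e u s && (last u s == last u p0).
have P1 : P (Bseq (bs _ U1)) by rewrite /P /= up1 l1 eqxx.
have [s /andP [us /eqP ls] hs] := Order.TotalTheory.arg_minP (fun s : {bseq #|V| of V} => len u s) P1.
exists s; split=> // q uq lq.
have [q' [uq' lq' Uq' /(le_trans _)]] := walk_shorten uq; apply.
by apply: (hs (Bseq (bs _ Uq'))); rewrite /P /= uq' lq' lq eqxx.
Qed.

(** The parent is the second vertex of a chosen minimal walk to [r]. The walks chosen at different
    vertices need not agree: minimality at the parent already gives the inequality for [D]. *)
Lemma shortest_path_tree r :
  exists (par : V -> V) (D : V -> R), forall v, connect e v r ->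
   [/\ (0 <= D v)%R,
       v != r -> [/\ e v (par v), connect e (par v) r & (w v (par v) + D (par v) <= D v)%R]
     & forall p, path e v p -> last v p = r -> (D v <= len v p)%R].
Proof.
have /choice [mw hmw] : forall v, exists p, connect e v r -> [/\ path e v p, last v p = r &
     forall q, path e v q -> last v q = r -> (len v p <= len v q)%R].
  move=> v; have [/min_walk [p hp]|h] := boolP (connect e v r); first by exists p.
  by exists [::].
exists (fun v => head v (mw v)), (fun v => len v (mw v)) => v cvr.
have [pv lv minv] := hmw v cvr; split=> //; first exact: walk_length_ge0.
move=> vr; case: (mw v) pv lv minv => [_ /= vr'|x p /= /andP [vx xp] lx minv].
  by rewrite vr' eqxx in vr.
have cxr : connect e x r by apply/connectP; exists p.
have [px lx' minx] := hmw x cxr.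
by split=> //; rewrite lerD2l; apply: minx.
Qed.

End Relation.

(** * Sparse covers by trees *)

Definition tcluster : Type := ({set V} * V * {ffun V -> V} * {ffun V -> R})%type.
Definition cset (c : tcluster) : {set V} := c.1.1.1.
Definition croot (c : tcluster) : V := c.1.1.2.
Definition cpar (c : tcluster) (v : V) : V := c.1.2 v.
Definition cdist (c : tcluster) (v : V) : R := c.2 v.

(** [cdist] is a potential that bounds the length of the tree path to the root. With weights at
    least 1 it strictly decreases towards the root, which rules out cycles of [cpar]. *)
Definition tree_cluster (e : rel V) (B : R) (c : tcluster) : Prop :=
  croot c \in cset c /\
  forall v, v \in cset c ->
   (0 <= cdist c v <= B)%R /\
   (v != croot c -> [/\ cpar c v \in cset c, e v (cpar c v)
                     & (w v (cpar c v) + cdist c (cpar c v) <= cdist c v)%R]).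

Definition induced (e : rel V) (Y : {set V}) : rel V :=
  fun u v => [&& e u v, u \in Y & v \in Y].

Section Cover.
Variables (e : rel V) (e_sym : symmetric e) (e_ge1 : heavy_enough e).
Variables (rho : R) (rho_ge0 : (0 <= rho)%R).

Lemma induced_sym Y : symmetric (induced e Y).
Proof. by move=> u v; rewrite /induced e_sym; congr (_ && _); exact: andbC. Qed.

Lemma induced_path_sub (Y Z : {set V}) u p : Y \subset Z ->
  path (induced e Y) u p -> path (induced e Z) u p.
Proof.
by move=> /fintype.subsetP YZ; apply: sub_path => x y /and3P [xy /YZ xZ /YZ yZ]; apply/and3P.
Qed.

Lemma tree_cluster_exists (Y : {set V}) r B : r \in Y ->
  (forall y, y \in Y -> exists p, [/\ path (induced e Y) r p, last r p = y & (len r p <= B)%R]) ->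
  exists c, cset c = Y /\ tree_cluster e B c.
Proof.
move=> rY hY.
have Y1 : heavy_enough (induced e Y) by move=> u v /and3P [/e_ge1].
have [par [D hD]] := shortest_path_tree Y1 r.
exists (Y, r, [ffun v => par v], [ffun v => D v]); split=> //; split=> // v vY.
rewrite /cdist /cpar /croot /cset /= !ffunE.
have [p [rp lp lenp]] := hY _ vY.
have [q [vq lq lenq _]] := walk_rev (induced_sym Y) rp; rewrite lp in vq lq lenq.
have cvr : connect (induced e Y) v r by apply/connectP; exists q.
have [D0 hpar Dmin] := hD v cvr; split.
  by rewrite D0 /= (le_trans (Dmin q _ _)) // lenq.
by move=> /hpar [/and3P [ev _ pY] _ h].
Qed.

Definition ball (v : V) : {set V} :=
  [set u | `[< exists p, [/\ path e v p, last v p = u & (len v p <= rho)%R] >]].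

Lemma ball_center v : v \in ball v.
Proof. by rewrite inE; apply/asboolP; exists [::]. Qed.

(** Each initial part of the walk is itself a walk of length at most [rho], so every vertex met on
    the way is in the ball. *)
Lemma walk_in_ball v p : path e v p -> (len v p <= rho)%R -> path (induced e (ball v)) v p.
Proof.
have aux q p' : path e v (q ++ p') -> (len v (q ++ p') <= rho)%R ->
    path (induced e (ball v)) (last v q) p'.
  elim: p' q => [//|x p' IH] q hp hl.
  have hb : forall q' p'', q ++ x :: p' = q' ++ p'' -> last v q' \in ball v.
    move=> q' p'' eq; rewrite inE; apply/asboolP; exists q'; split=> //.
      by move: hp; rewrite eq cat_path => /andP [].
    move: hp hl; rewrite eq walk_length_cat cat_path => /andP [_ /(walk_length_ge0 e_ge1)]; lra.
  rewrite /= {1}/induced (hb q (x :: p')) //.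
  have := hb (rcons q x) p'; rewrite cat_rcons last_rcons => /(_ erefl) ->.
  move: (hp); rewrite cat_path /= => /and3P [_ -> _] /=.
  by have := IH (rcons q x); rewrite cat_rcons last_rcons; apply.
by move=> h1 h2; exact: (aux [::] p).
Qed.

Lemma ball_walk v u : u \in ball v ->
  exists p, [/\ path (induced e (ball v)) v p, last v p = u & (len v p <= rho)%R].
Proof.
by rewrite inE => /asboolP [p [vp lp hp]]; exists p; split=> //; exact: walk_in_ball.
Qed.

Definition ballU (N : {set V}) : {set V} := \bigcup_(u in N) ball u.

Lemma ballU_sub (N N' : {set V}) : N \subset N' -> ballU N \subset ballU N'.
Proof.
move=> /fintype.subsetP h; apply/bigcupsP => u uN.
exact: (finset.bigcup_sup u (h _ uN)).
Qed.

Lemma ball_sub_ballU u (N : {set V}) : u \in N -> ball u \subset ballU N.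
Proof. by move=> uN; exact: (finset.bigcup_sup u uN). Qed.

Section Grow.
Variables (U : {set V}) (v : V) (vU : v \in U).

(** Each layer takes in the centres in [U] whose ball meets the union of the balls reached so
    far. *)
Fixpoint grow (j : nat) : {set V} :=
  if j is j'.+1 then [set u in U | ~~ [disjoint ball u & ballU (grow j')]] else [set v].

Lemma grow_sub j : grow j \subset U.
Proof.
by case: j => [|j] /=; [rewrite finset.sub1set|apply/fintype.subsetP => u; rewrite inE => /andP []].
Qed.

Lemma grow_incr j : grow j \subset grow j.+1.
Proof.
apply/fintype.subsetP => u uj; rewrite /= inE (fintype.subsetP (grow_sub j)) //=.
apply/pred0Pn; exists u; rewrite /= ball_center /=.
by apply/bigcupP; exists u => //; exact: ball_center.
Qed.

Lemma grow_center j : v \in grow j.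
Proof.
elim: j => [|j IH]; first by rewrite inE.
exact: (fintype.subsetP (grow_incr j)).
Qed.

(** If all [k] layers grew by a factor above [q], the last would have more than [q^k >= #|V|]
    vertices. *)
Lemma grow_stops q k : 0 < k -> #|V| <= q ^ k ->
  exists2 j, j < k & #|grow j.+1| <= q * #|grow j|.
Proof.
move=> k0 nq.
have [/existsP [j hj]|/existsPn h] := boolP [exists j : 'I_k, #|grow j.+1| <= q * #|grow j|].
  by exists j.
have hq j : j <= k -> q ^ j <= #|grow j|.
  elim: j => [|j IH] jk; first by rewrite cards1.
  have := h (Ordinal jk); rewrite -ltnNge /= expnS => /ltnW; apply: leq_trans.
  by rewrite leq_mul2l IH ?orbT // ltnW.
case: k k0 nq h hq => // k' _ nq h hq.
have := h (Ordinal (ltnSn k')); rewrite -ltnNge => h3.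
have h1 := hq k' (leqnSn k').
have h2 : q ^ k'.+1 <= q * #|grow k'| by rewrite expnS leq_mul2l h1 orbT.
by have := leq_trans h3 (max_card _); rewrite ltnNge (leq_trans nq h2).
Qed.

(** A new ball is entered at a point of the old union, then crossed through its centre: [2 rho] more
    per layer. Since growth stops at some [j < k], clusters get radius [(2k-1) rho]. *)
Lemma grow_walk j y : y \in ballU (grow j) ->
  exists p, [/\ path (induced e (ballU (grow j))) v p, last v p = y
              & (len v p <= (2 * j%:R + 1) * rho)%R].
Proof.
elim: j y => [|j IH] y /bigcupP [u uj yu].
  move: uj; rewrite inE => /eqP uv; subst u; have [p [vp lp hp]] := ball_walk yu.
  exists p; rewrite mulr0 add0r mul1r; split=> //.
  by apply: induced_path_sub vp; apply: ball_sub_ballU; rewrite /= inE.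
have := uj; rewrite /= inE => /andP [uU /pred0Pn [z /andP [/= zu zj]]].
have [p1 [vp1 l1 h1]] := IH _ zj.
have [p2 [up2 l2 h2]] := ball_walk zu.
have [p3 [zp3 l3 h3 _]] := walk_rev (induced_sym (ball u)) up2; rewrite l2 in zp3 l3 h3.
have [p4 [up4 l4 h4]] := ball_walk yu.
exists (p1 ++ p3 ++ p4); rewrite !cat_path !last_cat !walk_length_cat l1 l3 l4; split=> //; last first.
  by rewrite h3 -[j.+1]addn1 natrD; nra.
have sub : ball u \subset ballU (grow j.+1) by exact: ball_sub_ballU.
rewrite (induced_path_sub sub zp3) (induced_path_sub sub up4) /= !andbT.
by apply: induced_path_sub vp1; apply: ballU_sub; exact: grow_incr.
Qed.
End Grow.

Variables (k q : nat) (k_gt0 : 0 < k) (nqk : #|V| <= q ^ k).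

Local Notation radius := ((2 * k%:R - 1) * rho)%R.

(** The set removed, [grow U v j.+1], consists of all centres whose ball meets the new cluster, so
    later clusters of the phase are disjoint from it. Only [grow U v j] is counted as covered, by
    the stopping rule at least a fraction [1/q] of what is removed; the rest waits for another
    phase. *)
Lemma cover_phase (U : {set V}) : exists (cs : seq tcluster) (C : {set V}),
  [/\ C \subset U, #|U| <= q * #|C| & size cs <= #|C|] /\
  [/\ forall c : tcluster, c \in cs -> tree_cluster e radius c,
      forall u, u \in C -> exists2 c : tcluster, c \in cs & ball u \subset cset c,
      forall x, count (fun c => x \in cset c) cs <= 1
    & forall (c : tcluster) x, c \in cs -> x \in cset c -> x \in ballU U].
Proof.
have [m] := ubnP #|U|; elim: m U => // m IH U Um.
have [->|[v vU]] := set_0Vmem U.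
  exists [::], finset.set0; rewrite finset.sub0set !cards0; split; split=> // u; by rewrite inE.
have [j jk hj] := grow_stops U v k_gt0 nqk.
have gU := grow_sub vU j.
pose U' := U :\: grow U v j.+1.
have U'm : #|U'| < m.
  have : #|U'| < #|U|; last by lia.
  apply: proper_card; apply/properP; split; first exact: finset.subsetDl.
  by exists v => //; rewrite inE negb_and negbK (grow_center vU).
have [cs [C [[CU hC sC] [hcs hcov hcnt hball]]]] := IH _ U'm.
have [c0 [c0Y hc0]] : exists c, cset c = ballU (grow U v j) /\ tree_cluster e radius c.
  apply: (@tree_cluster_exists _ v).
    by apply/bigcupP; exists v; [exact: grow_center|exact: ball_center].
  move=> y /(grow_walk vU) [p [h1 h2 h3]]; exists p; split=> //; apply: le_trans h3 _.
  rewrite ler_wpM2r // -[(_ - 1)%R](_ : 2 * (k.-1)%:R + 1 = _)%R.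
    by rewrite lerD2r ler_pM2l // ler_nat; case: k jk.
  by rewrite -[k in RHS]prednK // -[k.-1.+1]addn1 natrD; lra.
have disj x : x \in ballU U' -> x \notin ballU (grow U v j).
  move=> /bigcupP [u]; rewrite /U' finset.in_setD => /andP [ug uU] xu; apply/negP => xg.
  move: ug; rewrite /= inE uU /= negbK => /pred0P /(_ x) /=.
  by rewrite xu xg.
have gC : [disjoint grow U v j & C].
  apply/pred0P => u /=; apply/negP => /andP [ug uC].
  have := fintype.subsetP CU u uC; rewrite inE => /andP [/negP []].
  by have := fintype.subsetP (grow_incr vU j) u ug.
have cU : #|grow U v j :|: C| = #|grow U v j| + #|C|.
  by apply/eqP; rewrite (leq_card_setU _ _).2.
have g1 : 0 < #|grow U v j| by apply/card_gt0P; exists v; exact: grow_center.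
exists (c0 :: cs), (grow U v j :|: C); split; split.
- rewrite finset.subUset gU /=; apply: fintype.subset_trans CU _; exact: finset.subsetDl.
- have h1 : #|U| = #|grow U v j.+1| + #|U'|.
    by rewrite -(cardsID (grow U v j.+1) U) (finset.setIidPr (grow_sub vU j.+1)).
  by rewrite h1 cU mulnDr leq_add.
- by rewrite cU /=; lia.
- by move=> c; rewrite inE => /orP [/eqP ->|/hcs].
- move=> u; rewrite inE => /orP [ug|/hcov [c ccs hc]].
    by exists c0; rewrite ?mem_head // c0Y; exact: ball_sub_ballU.
  by exists c => //; rewrite inE ccs orbT.
- move=> x /=; rewrite c0Y; case: (boolP (x \in _)) => [xg|_]; last by rewrite add0n.
  rewrite (eq_in_count (a2 := pred0)) ?count_pred0 // => c ccs; apply/negbTE/negP => xc.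
  by have := disj x (hball _ _ ccs xc); rewrite xg.
- move=> c x; rewrite inE => /orP [/eqP ->|ccs xc].
    by rewrite c0Y; apply: (fintype.subsetP (ballU_sub gU)).
  by apply: (fintype.subsetP (ballU_sub (finset.subsetDl U (grow U v j.+1)))); exact: hball xc.
Qed.

(** Each phase leaves at most a fraction [1 - 1/q] of the centres uncovered and adds at most one
    cluster at every vertex. *)
Lemma cover_phases t (U : {set V}) : exists (cs : seq tcluster) (U' : {set V}),
  [/\ #|U'| * q ^ t <= #|U| * q.-1 ^ t, size cs + #|U'| <= #|U| & U' \subset U] /\
  [/\ forall c : tcluster, c \in cs -> tree_cluster e radius c,
      forall u, u \in U :\: U' -> exists2 c : tcluster, c \in cs & ball u \subset cset c
    & forall x, count (fun c => x \in cset c) cs <= t].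
Proof.
elim: t U => [|t IH] U.
  by exists [::], U; rewrite !expn0 /= add0n finset.setDv; split; split=> // u; rewrite inE.
have [cs [C [[CU hC sC] [hcs hcov hcnt _]]]] := cover_phase U.
have [cs' [U' [[hU' sU' UU'] [hcs' hcov' hcnt']]]] := IH (U :\: C).
have cD : #|U :\: C| + #|C| = #|U|.
  by rewrite addnC -(cardsID C U) (finset.setIidPr CU).
exists (cs ++ cs'), U'; split; split.
- rewrite [q ^ _]expnSr [q.-1 ^ _]expnS !mulnA.
  apply: (@leq_trans (#|U :\: C| * q.-1 ^ t * q)); first by rewrite leq_mul2r hU' orbT.
  rewrite mulnAC leq_mul2r; apply/orP; right.
  by case: (q) hC => [|q'] /=; rewrite ?muln0 // => hC; nia.
- by rewrite size_cat; lia.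
- exact: fintype.subset_trans UU' (finset.subsetDl _ _).
- by move=> c; rewrite mem_cat => /orP [/hcs|/hcs'].
- move=> u; rewrite inE => /andP [uU' uU].
  have [/hcov [c ccs hc]|uC] := boolP (u \in C); first by exists c; rewrite ?mem_cat ?ccs.
  have [|c ccs hc] := hcov' u; first by rewrite !inE uU' uC.
  by exists c; rewrite ?mem_cat ?ccs ?orbT.
- by move=> x; rewrite count_cat -[t.+1]add1n leq_add.
Qed.

Lemma sparse_cover b : #|V| < 2 ^ b -> 0 < q -> exists cs : seq tcluster,
  [/\ forall c : tcluster, c \in cs -> tree_cluster e radius c,
      forall u, exists2 c : tcluster, c \in cs & ball u \subset cset c,
      forall x, count (fun c => x \in cset c) cs <= q * b
    & size cs <= #|V|].
Proof.
move=> nb q0.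
have [cs [U' [[hU' sU' _] [hcs hcov hcnt]]]] := cover_phases (q * b) [set: V]%SET.
(* [(1 - 1/q)^q <= 1/2], from the first two terms of the binomial expansion of [q^q]. So [q * b]
   phases leave at most [#|V| / 2^b < 1] centre. *)
have dbl : 2 * q.-1 ^ q <= q ^ q.
  case: (q) q0 => // p _; rewrite [p.+1.-1]/=.
  have h j : p ^ j.+1 + j.+1 * p ^ j <= p.+1 ^ j.+1.
    elim: j => [|j IH]; first by rewrite !expn1 expn0 muln1 addn1.
    have := leq_mul (leqnn p.+1) IH; rewrite -expnS; apply: leq_trans.
    rewrite !expnS; nia.
  by apply: leq_trans (h p); rewrite mul2n -addnn leq_add2l expnS leq_mul2r leqnSn orbT.
have U'0 : U' = finset.set0.
  apply/eqP; rewrite -cards_eq0 -leqn0 -ltnS.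
  have qq : 0 < q ^ (q * b) by rewrite expn_gt0 q0.
  have h2 : 2 ^ b * q.-1 ^ (q * b) <= q ^ (q * b) by rewrite !expnM -expnMn; case: (b) => // b'; rewrite leq_exp2r.
  rewrite cardsT in hU'.
  have h3 := leq_mul (leqnn (2 ^ b)) hU'.
  have h4 : #|V| * (2 ^ b * q.-1 ^ (q * b)) <= #|V| * q ^ (q * b) by rewrite leq_mul2l h2 orbT.
  have : (2 ^ b * #|U'|) * q ^ (q * b) <= #|V| * q ^ (q * b) by lia.
  rewrite leq_pmul2r // => h5.
  by rewrite -(ltn_pmul2l (_ : 0 < 2 ^ b)) ?expn_gt0 // muln1; lia.
exists cs; split=> //.
  by move=> u; apply: hcov; rewrite U'0 !inE.
by move: sU'; rewrite U'0 cards0 addn0 cardsT.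
Qed.

End Cover.
End Walks.

(** * Interval labels and routing in rooted trees *)

Fixpoint lex (s t : seq nat) : bool :=
  match s, t with
  | [::], _ => true
  | _ :: _, [::] => false
  | a :: s', b :: t' => (a < b) || (a == b) && lex s' t'
  end.

Lemma lex_refl s : lex s s.
Proof. by elim: s => //= a s ->; rewrite eqxx orbT. Qed.

Lemma lex_total s t : lex s t || lex t s.
Proof. by elim: s t => [|a s IH] [|b t] //=; case: ltngtP => //= _; exact: IH. Qed.

Lemma lex_anti s t : lex s t -> lex t s -> s = t.
Proof.
by elim: s t => [|a s IH] [|b t] //=; case: ltngtP => //= <- h1 h2; rewrite (IH t).
Qed.

Lemma lex_trans s t u : lex s t -> lex t u -> lex s u.
Proof.
elim: s t u => [|a s IH] [|b t] [|c u] //=.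
move=> /orP [ab|/andP [/eqP -> h1]] /orP [bc|/andP [/eqP <- h2]].
- by rewrite (ltn_trans ab bc).
- by rewrite ab.
- by rewrite bc.
- by rewrite eqxx (IH t u) // orbT.
Qed.

Lemma prefix_lex s t : prefix s t -> lex s t.
Proof. by elim: s t => [|a s IH] [|b t] //= /andP [/eqP -> /IH ->]; rewrite eqxx orbT. Qed.

(** Convexity of the extensions of [k] in the lexicographic order is what makes a subtree an
    interval of preorder numbers. *)
Lemma prefix_lex_convex k s t u :
  prefix k s -> prefix k u -> lex s t -> lex t u -> prefix k t.
Proof.
elim: k s t u => [|x k IH] [|a s] [|b t] [|c u] //=.
move=> /andP [/eqP <- h1] /andP [/eqP <- h2] /orP [xb|/andP [/eqP <- h3]].
  by case: ltngtP xb.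
by rewrite ltnn eqxx /=; apply: IH h1 h2 h3.
Qed.

Definition rooted_tree (V : finType) (Y : {set V}) (r : V) (par : V -> V) (dep : V -> nat) : Prop :=
  [/\ r \in Y, forall v, v \in Y -> v != r -> par v \in Y,
      dep r = 0 & forall v, v \in Y -> v != r -> dep v = (dep (par v)).+1].

Section Tree.
Variables (V : finType) (Y : {set V}) (r : V) (par : V -> V) (dep : V -> nat).
Hypothesis tree : rooted_tree Y r par dep.

Let rY : r \in Y. Proof. by case: tree. Qed.
Let parY v : v \in Y -> v != r -> par v \in Y. Proof. by case: tree => _ h _ _; exact: h. Qed.
Let dep_r : dep r = 0. Proof. by case: tree. Qed.
Let dep_par v : v \in Y -> v != r -> dep v = (dep (par v)).+1.
Proof. by case: tree => _ _ _ h; exact: h. Qed.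

Lemma tree_ind (P : V -> Prop) : P r ->
  (forall v, v \in Y -> v != r -> P (par v) -> P v) -> forall v, v \in Y -> P v.
Proof.
move=> h0 hS v; have [m] := ubnP (dep v); elim: m v => // m IH v hm vY.
have [->//|vr] := eqVneq v r; apply: hS => //; apply: IH; last exact: parY.
by move: hm; rewrite (dep_par vY vr).
Qed.

Definition rpath (v : V) : seq V := traject par v (dep v).+1.

Lemma rpath_root : rpath r = [:: r].
Proof. by rewrite /rpath dep_r. Qed.

Lemma rpath_cons v : v \in Y -> v != r -> rpath v = v :: rpath (par v).
Proof. by move=> vY vr; rewrite /rpath (dep_par vY vr). Qed.

Lemma rpath_self v : v \in rpath v.
Proof. by rewrite /rpath /= mem_head. Qed.

Lemma rpathY v c : v \in Y -> c \in rpath v -> c \in Y.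
Proof.
move=> vY; elim/tree_ind: v / vY => [|v vY vr IH]; first by rewrite rpath_root inE => /eqP ->.
by rewrite rpath_cons // inE => /orP [/eqP ->|/IH].
Qed.

Lemma rpath_has_root v : v \in Y -> r \in rpath v.
Proof.
move=> vY; elim/tree_ind: v / vY => [|v vY vr IH]; first exact: rpath_self.
by rewrite rpath_cons // inE IH orbT.
Qed.

Lemma rpath_trans v c d : v \in Y -> c \in rpath v -> d \in rpath c -> d \in rpath v.
Proof.
move=> vY; elim/tree_ind: v / vY => [|v vY vr IH]; first by rewrite rpath_root inE => /eqP ->; rewrite rpath_root.
rewrite {1}rpath_cons // inE => /orP [/eqP -> //|/IH h /h dv].
by rewrite rpath_cons // inE dv orbT.
Qed.

Lemma rpath_dep v c : v \in Y -> c \in rpath v -> dep c <= dep v /\ (dep c = dep v -> c = v).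
Proof.
move=> vY; elim/tree_ind: v / vY => [|v vY vr IH]; first by rewrite rpath_root inE => /eqP ->.
rewrite rpath_cons // inE (dep_par vY vr) => /orP [/eqP ->|/IH [h1 _]].
  by rewrite (dep_par vY vr).
by split; [exact: leqW|move=> h2; rewrite h2 ltnn in h1].
Qed.

Lemma rpath_uniq_dep v c d : v \in Y -> c \in rpath v -> d \in rpath v -> dep c = dep d -> c = d.
Proof.
move=> vY; elim/tree_ind: v / vY => [|v vY vr IH].
  by rewrite rpath_root !inE => /eqP -> /eqP ->.
have h x : x \in rpath (par v) -> dep x < dep v.
  by move=> /(rpath_dep (parY vY vr)) [h _]; rewrite (dep_par vY vr).
rewrite rpath_cons // !inE => /orP [/eqP ->|cv] /orP [/eqP ->|dv] // e; last exact: IH.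
- by have := h _ dv; rewrite -e ltnn.
- by have := h _ cv; rewrite e ltnn.
Qed.

Definition sub (c : V) : {set V} := [set v in Y | c \in rpath v].

Lemma in_sub v c : (v \in sub c) = (v \in Y) && (c \in rpath v).
Proof. by rewrite finset.in_set. Qed.

Lemma sub_self v : v \in Y -> v \in sub v.
Proof. by move=> vY; rewrite in_sub vY rpath_self. Qed.

Lemma sub_par v c : v \in Y -> v != r -> c != v -> (v \in sub c) = (par v \in sub c).
Proof.
by move=> vY vr cv; rewrite !in_sub vY (parY vY vr) rpath_cons // inE (negbTE cv).
Qed.

Lemma par_notin_sub v : v \in Y -> v != r -> par v \notin sub v.
Proof.
move=> vY vr; rewrite in_sub (parY vY vr) /=; apply/negP.
by move=> /(rpath_dep (parY vY vr)) [h _]; move: h; rewrite (dep_par vY vr) ltnn.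
Qed.

Lemma sub_par_subset v : v \in Y -> v != r -> sub v \subset sub (par v).
Proof.
move=> vY vr; apply/fintype.subsetP => x; rewrite !in_sub => /andP [xY vx]; rewrite xY /=.
by apply: rpath_trans vx _ => //; rewrite rpath_cons // inE rpath_self orbT.
Qed.

(** Read from the root down, the path to [v] is a word: descendants are extensions, and the
    lexicographic order of the words is a preorder traversal with children ordered by
    [enum_rank]. *)
Definition key (v : V) : seq nat := rev [seq (enum_rank x : nat) | x <- rpath v].

Lemma prefix_key c v : c \in Y -> v \in Y -> prefix (key c) (key v) = (c \in rpath v).
Proof.
move=> cY vY; apply/idP/idP.
  rewrite /key prefix_rev => h.
  have [s hs] := suffixP h.
  have : (enum_rank c : nat) \in [seq (enum_rank x : nat) | x <- rpath v].
    by rewrite hs mem_cat (map_f (fun x => enum_rank x : nat)) ?orbT // rpath_self.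
  by case/mapP => x xv /val_inj /enum_rank_inj ->.
move=> h; elim/tree_ind: v / vY h => [|v vY vr IH]; first by rewrite rpath_root inE => /eqP ->; rewrite prefix_refl.
rewrite {1}rpath_cons // inE => /orP [/eqP ->|/IH h]; first exact: prefix_refl.
rewrite {2}/key rpath_cons // /= rev_cons -cats1.
by apply: prefix_trans h _; exact: prefix_prefix.
Qed.

Lemma key_inj : {in Y &, injective key}.
Proof.
move=> u v uY vY e; have h1 : u \in rpath v by rewrite -prefix_key // e prefix_refl.
have h2 : v \in rpath u by rewrite -prefix_key // e prefix_refl.
have [d1 d1e] := rpath_dep vY h1; have [d2 _] := rpath_dep uY h2.
by apply: d1e; apply/eqP; rewrite eqn_leq d1.
Qed.

Definition before (v : V) : {set V} := [set u in Y | ~~ lex (key v) (key u)].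
Definition pre (v : V) : nat := #|before v|.
Definition out (v : V) : nat := pre v + #|sub v|.

Lemma pre_lt v : v \in Y -> pre v < #|V|.
Proof.
move=> vY; apply: leq_trans (max_card (mem Y)); apply: proper_card; apply/properP; split.
  by apply/fintype.subsetP => u; rewrite inE => /andP [].
by exists v => //; rewrite inE lex_refl andbF.
Qed.

Lemma before_lt u v : u \in Y -> ~~ lex (key v) (key u) -> pre u < pre v.
Proof.
move=> uY h; apply: proper_card; apply/properP; split.
  apply/fintype.subsetP => x; rewrite !inE => /andP [-> hx] /=; apply: contra hx => hx.
  have := lex_total (key v) (key u); rewrite (negbTE h) /= => huv; exact: lex_trans huv hx.
by exists u; rewrite inE ?uY ?lex_refl.
Qed.

Lemma pre_inj : {in Y &, injective pre}.
Proof.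
move=> u v uY vY e; apply: key_inj => //; apply: lex_anti; apply/negPn/negP => /before_lt h.
  by have := h vY; rewrite e ltnn.
by have := h uY; rewrite e ltnn.
Qed.

Lemma in_before v u : (u \in before v) = (u \in Y) && ~~ lex (key v) (key u).
Proof. by rewrite finset.in_set. Qed.

(** A vertex outside the subtree but after [c] comes after the whole subtree by convexity, hence has
    both [before c] and [sub c] before it. *)
Lemma sub_interval c v : c \in Y -> v \in Y -> (v \in sub c) = (pre c <= pre v < out c).
Proof.
move=> cY vY; rewrite in_sub vY /= -prefix_key //; apply/idP/idP => [hp|].
  have hcv := prefix_lex hp; apply/andP; split.
    apply: subset_leq_card; apply/fintype.subsetP => x; rewrite !in_before => /andP [-> hx] /=.
    by apply: contra hx => hx; apply: lex_trans hcv hx.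
  rewrite /out /pre; apply: (@leq_trans #|before c :|: sub c|); last first.
    exact: (leq_of_leqif (leq_card_setU _ _)).
  apply: proper_card; apply/properP; split; last first.
    exists v; first by rewrite finset.in_setU in_sub vY -prefix_key // hp orbT.
    by rewrite in_before lex_refl andbF.
  apply/fintype.subsetP => x; rewrite finset.in_setU !in_before in_sub => /andP [xY hx]; rewrite xY /=.
  have [hcx|//] := boolP (lex (key c) (key x)).
  have := lex_total (key v) (key x); rewrite (negbTE hx) /= => hxv.
  by rewrite -prefix_key // (prefix_lex_convex (prefix_refl _) hp hcx hxv).
apply: contraTT => hp; rewrite negb_and -ltnNge -leqNgt.
have [hcv|hcv] := boolP (lex (key c) (key v)); last by rewrite before_lt.
apply/orP; right; rewrite /out /pre.
have <- : #|before c :|: sub c| = #|before c| + #|sub c|.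
  apply/eqP; rewrite (leq_card_setU _ _).2; apply/pred0P => x /=; apply/negP.
  rewrite in_before in_sub => /andP [/andP [xY hx] /andP [_]]; rewrite -prefix_key // => /prefix_lex h.
  by rewrite h in hx.
apply: subset_leq_card; apply/fintype.subsetP => x.
rewrite finset.in_setU !in_before in_sub => /orP [] /andP [xY hx]; rewrite xY /=.
  by apply: contra hx; apply: lex_trans hcv.
by apply: contra hp => hvx; rewrite -prefix_key // in hx; exact: prefix_lex_convex (prefix_refl _) hx hcv hvx.
Qed.

Lemma out_le v : v \in Y -> out v <= #|V|.
Proof.
move=> vY; rewrite /out /pre.
have <- : #|before v :|: sub v| = #|before v| + #|sub v|.
  apply/eqP; rewrite (leq_card_setU _ _).2; apply/pred0P => x /=; apply/negP.
  rewrite in_before in_sub => /andP [/andP [xY hx] /andP [_]]; rewrite -prefix_key // => /prefix_lex h.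
  by rewrite h in hx.
exact: max_card.
Qed.

Lemma edge_child_inj c d : c \in Y -> c != r -> d \in Y -> d != r ->
  [set c; par c] = [set d; par d] -> c = d.
Proof.
move=> cY cr dY dr e.
have : c \in [set d; par d] by rewrite -e set21.
have : d \in [set c; par c] by rewrite e set21.
rewrite !inE => /orP [/eqP //|/eqP h1] /orP [/eqP //|/eqP h2].
by have := dep_par cY cr; rewrite -h1 (dep_par dY dr) -h2; lia.
Qed.

(* The subtree interval below a tree edge; empty for a non-tree edge. *)
Definition edge_interval (e : {set V}) : nat * nat :=
  if [pick c | [&& c \in Y, c != r & e == [set c; par c]]] is Some c
  then (pre c, out c) else (0, 0).

Lemma edge_interval_child c : c \in Y -> c != r ->
  edge_interval [set c; par c] = (pre c, out c).
Proof.
move=> cY cr; rewrite /edge_interval; case: pickP => [d /and3P [dY dr /eqP e]|/(_ c)].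
  by rewrite (edge_child_inj cY cr dY dr e).
by rewrite cY cr eqxx.
Qed.

Variant edge_interval_spec (e : {set V}) : nat * nat -> Prop :=
| TreeEdge c of c \in Y & c != r & e = [set c; par c] : edge_interval_spec e (pre c, out c)
| NonTreeEdge : edge_interval_spec e (0, 0).

Lemma edge_intervalP e : edge_interval_spec e (edge_interval e).
Proof.
by rewrite /edge_interval; case: pickP => [c /and3P [cY cr /eqP h]|_]; constructor.
Qed.

Definition inside (i : nat * nat) (j : nat) : bool := i.1 <= j < i.2.

(** Lying in the same component of [T - F], expressed by positions and intervals only, so that it
    can be tested from labels. Non-tree edges have an empty interval and separate nothing. *)
Definition same_side (F : {set {set V}}) (j j' : nat) : Prop :=
  forall e, e \in F -> inside (edge_interval e) j = inside (edge_interval e) j'.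

Lemma same_side_par (F : {set {set V}}) v : v \in Y -> v != r -> [set v; par v] \notin F ->
  same_side F (pre v) (pre (par v)).
Proof.
move=> vY vr vF e eF; case: edge_intervalP => [c cY cr ec|]; last by rewrite /inside.
rewrite /inside /= -!sub_interval //; last exact: parY.
by rewrite sub_par //; apply: contraNneq vF => <-; rewrite -ec.
Qed.

Lemma same_side_edge (F : {set {set V}}) v w : v \in Y -> v != r -> w \in Y ->
  same_side F (pre (par v)) (pre w) -> w \in sub v -> [set v; par v] \notin F.
Proof.
move=> vY vr wY h wv; apply/negP => /h; rewrite edge_interval_child // /inside /=.
rewrite -!sub_interval //; last exact: parY.
by rewrite wv (negbTE (par_notin_sub vY vr)).
Qed.

Lemma same_side_edge_up (F : {set {set V}}) v w : v \in Y -> v != r -> w \in Y ->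
  same_side F (pre v) (pre w) -> w \notin sub v -> [set v; par v] \notin F.
Proof.
move=> vY vr wY h wv; apply/negP => /h; rewrite edge_interval_child // /inside /=.
by rewrite -!sub_interval // (negbTE wv) sub_self.
Qed.

(** The representative is found by climbing until the root or a forbidden tree edge stops the climb,
    so it is the root or the lower end of a forbidden tree edge. *)
Lemma few_sides (F : {set {set V}}) : exists (top : V -> V) (tops : {set V}),
  [/\ #|tops| <= #|F|.+1, forall v, v \in Y -> top v \in tops,
      forall v, v \in Y -> top v \in Y
    & forall v, v \in Y -> same_side F (pre v) (pre (top v))].
Proof.
pose C := [set c in Y | (c != r) && ([set c; par c] \in F)].
have hC : #|C| <= #|F|.
  rewrite -(card_in_imset (f := fun c => [set c; par c]) (D := C)).
    apply: subset_leq_card; apply/fintype.subsetP => e /imsetP [c].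
    by rewrite !inE => /and3P [_ _ h ->].
  by move=> c d; rewrite !inE => /and3P [cY cr _] /and3P [dY dr _]; exact: edge_child_inj.
have h v : exists x, v \in Y -> [/\ x \in r |: C, x \in Y & same_side F (pre v) (pre x)].
  have [vY|] := boolP (v \in Y); last by exists r.
  elim/tree_ind: v / vY => [|v vY vr [x hx]]; first by exists r; rewrite !inE eqxx.
  have [vF|vF] := boolP ([set v; par v] \in F).
    by exists v => _; split=> //; rewrite !inE vY vr vF orbT.
  exists x => _; have [h1 h2 h3] := hx isT.
  by split=> // e eF; rewrite (same_side_par vY vr vF eF) h3.
have [top ht] := choice h; exists top, (r |: C); split.
- by rewrite (leq_trans (leq_of_leqif (leq_card_setU _ _))) // cards1 add1n ltnS.
- by move=> v /ht [].
- by move=> v /ht [].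
- by move=> v /ht [].
Qed.

(** * Heavy-light decomposition and next hops *)

Definition child (u c : V) : bool := [&& c \in Y, c != r & par c == u].

Definition heavy (u : V) : V :=
  odflt u [pick c | child u c && [forall d, child u d ==> (#|sub d| <= #|sub c|)]].

Lemma heavyP u c : child u c -> child u (heavy u) /\ #|sub c| <= #|sub (heavy u)|.
Proof.
move=> uc; rewrite /heavy; case: pickP => [h /andP [uh /forallP /(_ c)]|/= no].
  by rewrite uc.
have [h uh hmax] := arg_maxnP (fun d => #|sub d|) uc.
by have := no h; rewrite uh /= => /negP []; apply/forallP => d; apply/implyP => /hmax.
Qed.

Definition light (c : V) : bool := (c != r) && (c != heavy (par c)).

(** The heavy sibling has a disjoint subtree at least as large. Each light edge on a root path thus
    at least doubles the subtree, which bounds their number by a logarithm. *)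
Lemma light_sub c : c \in Y -> light c -> 2 * #|sub c| <= #|sub (par c)|.
Proof.
move=> cY /andP [cr ch].
have cc : child (par c) c by rewrite /child cY cr eqxx.
have [/and3P [hY hr /eqP hp] hle] := heavyP cc; set h := heavy (par c) in hY hr hp hle ch *.
have hs : sub h \subset sub (par c) by rewrite -hp; exact: sub_par_subset.
have cs := sub_par_subset cY cr.
have dis : [disjoint sub c & sub h].
  apply/pred0P => x /=; apply/negP; rewrite !in_sub => /andP [/andP [xY cx] /andP [_ hx]].
  case/eqP: ch; apply: (rpath_uniq_dep xY cx hx).
  by rewrite (dep_par cY cr) (dep_par hY hr) hp.
have : #|sub c :|: sub h| = #|sub c| + #|sub h|.
  by apply/eqP; rewrite (leq_card_setU _ _).2.
have : #|sub c :|: sub h| <= #|sub (par c)| by apply: subset_leq_card; rewrite finset.subUset cs hs.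
by move=> h1 h2; rewrite mul2n -addnn (leq_trans _ h1) // h2 leq_add2l.
Qed.

Variable port : V -> seq V.

Definition lights (v : V) : seq (nat * nat) :=
  [seq (pre (par c), index c (port (par c))) | c <- rpath v & light c].

Lemma size_lights_sub v : v \in Y -> 2 ^ size (lights v) * #|sub v| <= #|V|.
Proof.
move=> vY; elim/tree_ind: v / vY => [|v vY vr IH].
  rewrite /lights rpath_root /= /light eqxx /= mul1n; exact: max_card.
rewrite /lights rpath_cons //=; case: ifP => hl /=; apply: leq_trans IH.
  by rewrite expnSr -mulnA leq_mul2l light_sub ?orbT.
by rewrite leq_mul2l subset_leq_card ?orbT // sub_par_subset.
Qed.

Lemma size_lights v b : v \in Y -> #|V| < 2 ^ b -> size (lights v) <= b.
Proof.
move=> vY hb; have h := size_lights_sub vY.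
have s0 : 0 < #|sub v| by apply/card_gt0P; exists v; exact: sub_self.
rewrite -(leq_exp2l (m := 2)) // ltnW // (leq_ltn_trans _ hb) //.
by apply: leq_trans h; rewrite leq_pmulr.
Qed.

Lemma mem_lights v x : v \in Y -> x \in lights v ->
  exists c, [/\ c \in rpath v, c \in Y, c != r & x = (pre (par c), index c (port (par c)))].
Proof.
move=> vY /mapP [c]; rewrite mem_filter => /andP [/andP [cr _] cv] ->.
by exists c; split=> //; exact: rpathY cv.
Qed.

Definition parent_port (u : V) : nat := index (par u) (port u).
Definition heavy_port (u : V) : nat := index (heavy u) (port u).

(** A target outside the own interval is reached through the parent. Otherwise the target's list of
    light edges is searched for the own number; if it is missing, the next edge down is heavy, which
    is why [ports.2] is the default of [head]. *)
Definition hop (prec : nat * nat) (ports : nat * nat) (target : nat * seq (nat * nat)) : nat :=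
  if inside prec target.1
  then head ports.2 [seq x.2 | x <- target.2 & x.1 == prec.1]
  else ports.1.

Definition vhop (u w : V) : nat :=
  hop (pre u, out u) (parent_port u, heavy_port u) (pre w, lights w).

Lemma vhop_up u w : u \in Y -> w \in Y -> w \notin sub u -> vhop u w = index (par u) (port u).
Proof. by move=> uY wY; rewrite sub_interval // /vhop /hop /inside /= => /negbTE ->. Qed.

(** Only one child of [u] lies on the root path of [w], so an entry of [lights w] carrying the
    number of [u] can only concern that child. *)
Lemma vhop_down u w : u \in Y -> w \in Y -> w \in sub u -> w != u ->
  exists c, [/\ child u c, w \in sub c & vhop u w = index c (port u)].
Proof.
move=> uY wY wu nwu.
have [c [uc cw]] : exists c, child u c /\ c \in rpath w.
  move: wu nwu; rewrite in_sub => /andP [_].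
  elim/tree_ind: w / wY => [|w wY wr IH]; first by rewrite rpath_root inE eq_sym => ->.
  rewrite rpath_cons // inE => /orP [/eqP ->|upw]; first by rewrite eqxx.
  have [pu|pu] := eqVneq (par w) u; first by exists w; rewrite /child wY wr pu eqxx mem_head.
  by have [c [h1 h2]] := IH upw pu; exists c; rewrite inE h2 orbT.
have /and3P [cY cr /eqP cu] := uc.
exists c; rewrite in_sub wY cw; split=> //.
have only d : d \in rpath w -> light d -> pre (par d) = pre u -> d = c.
  move=> dw /andP [dr _] hd; have dY := rpathY wY dw.
  have e : par d = u by apply: pre_inj hd => //; exact: parY.
  by apply: rpath_uniq_dep dw cw _ => //; rewrite (dep_par dY dr) (dep_par cY cr) e cu.
rewrite /vhop /hop {1}/inside /= -sub_interval // wu.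
have [lc|nlc] := boolP (light c).
  have : (pre u, index c (port u)) \in [seq x <- lights w | x.1 == pre u].
    rewrite mem_filter eqxx /=; apply/mapP; exists c; first by rewrite mem_filter lc.
    by rewrite cu.
  case hs : [seq _ <- _ | _] => [|x s] //= _.
  have : x \in [seq x <- lights w | x.1 == pre u] by rewrite hs mem_head.
  rewrite mem_filter => /andP [/eqP hx /mapP [d]]; rewrite mem_filter => /andP [ld dw] e.
  by have dc := only d dw ld; rewrite e /= in hx *; rewrite (dc hx) cu.
case hs : [seq _ <- _ | _] => [|x s] /=.
  by move: nlc; rewrite /light cr cu /= negbK => /eqP {1}->.
have : x \in [seq x <- lights w | x.1 == pre u] by rewrite hs mem_head.
rewrite mem_filter => /andP [/eqP hx /mapP [d]]; rewrite mem_filter => /andP [ld dw] e.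
by have dc := only d dw ld; rewrite e /= in hx; rewrite -(dc hx) ld in nlc.
Qed.

End Tree.

Lemma onth_index (T : eqType) (s : seq T) x : x \in s -> onth s (index x s) = Some x.
Proof.
elim: s => //= y s IH; rewrite inE; have [->//|yx] := eqVneq y x.
by move=> /IH.
Qed.

(** * Forwarding along the tree of one cluster *)

Section ClusterRouting.
Variables (R : realType) (V : finType) (G : wgraph R V).
Local Notation len := (walk_length G).

Definition depth_fun (c : tcluster R V) (d : V -> nat) : Prop :=
  d (croot c) = 0 /\
  forall v, v \in cset c -> v != croot c -> d v = (d (cpar c v)).+1.

Definition cdep (c : tcluster R V) : V -> nat := choose_or (fun=> 0) (depth_fun c).

Variables (e : rel V) (e_ge1 : heavy_enough G e) (B : R) (c : tcluster R V).
Hypothesis ctree : tree_cluster G e B c.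
Local Notation Y := (cset c).
Local Notation r := (croot c).
Local Notation par := (cpar c).

Lemma croot_in : r \in Y.
Proof. by case: ctree. Qed.

Lemma cpar_in v : v \in Y -> v != r -> par v \in Y.
Proof. by case: ctree => _ h vY vr; have [_ /(_ vr) []] := h v vY. Qed.

Lemma cpar_edge v : v \in Y -> v != r -> e v (par v).
Proof. by case: ctree => _ h vY vr; have [_ /(_ vr) []] := h v vY. Qed.

Lemma cdist_par v : v \in Y -> v != r ->
  (weight G [set v; par v] + cdist c (par v) <= cdist c v)%R.
Proof. by case: ctree => _ h vY vr; have [_ /(_ vr) []] := h v vY. Qed.

Lemma cdist_bounds v : v \in Y -> (0 <= cdist c v <= B)%R.
Proof. by case: ctree => _ h vY; have [] := h v vY. Qed.

(** [cdist] stays nonnegative and drops by at least 1 at every step to the parent, so iterating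
    [par] reaches the root; the least number of steps is a depth function. *)
Lemma cdepP : depth_fun c (cdep c).
Proof.
apply: choose_orP.
have reach v : v \in Y -> exists i, iter i par v == r.
  move=> vY; have [m] : exists m : nat, (cdist c v < m%:R)%R.
    by exists (Num.bound (cdist c v)); apply: archi_boundP; case/andP: (cdist_bounds vY).
  elim: m v vY => [|m IH] v vY hm; first by have /andP [h _] := cdist_bounds vY; rewrite ltNge h in hm.
  have [->|vr] := eqVneq v r; first by exists 0.
  have h1 := cdist_par vY vr; have h2 := e_ge1 (cpar_edge vY vr).
  have [|i hi] := IH (par v) (cpar_in vY vr); first by move: hm; rewrite -natr1; lra.
  by exists i.+1; rewrite iterSr.
pose d v := if pselect (exists i, iter i par v == r) is left h then ex_minn h else 0.
exists d; split.
  rewrite /d; case: pselect => // h; case: ex_minnP => m _ /(_ 0) /=; rewrite eqxx leqn0.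
  by move=> /(_ isT) /eqP.
move=> v vY vr; rewrite /d; case: pselect => [h|/(_ (reach v vY)) //].
case: pselect => [h'|/(_ (reach _ (cpar_in vY vr))) //].
case: ex_minnP => m hm mmin; case: ex_minnP => m' hm' mmin'.
apply/eqP; rewrite eqn_leq mmin ?iterSr //=.
case: m hm mmin => [|m] hm _; first by rewrite (eqP (hm : v == r)) eqxx in vr.
by rewrite ltnS mmin' //; rewrite iterSr in hm.
Qed.

Definition cpre (v : V) : nat := pre Y par (cdep c) v.
Definition cout (v : V) : nat := out Y par (cdep c) v.
Definition cinterval (a : {set V}) : nat * nat := edge_interval Y r par (cdep c) a.
Definition csame_side (F : {set {set V}}) : nat -> nat -> Prop := same_side Y r par (cdep c) F.

Variables (port : V -> seq V) (e_port : forall u v, e u v -> v \in port u) (e_sym : symmetric e).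

Definition clights (v : V) : seq (nat * nat) := lights Y r par (cdep c) port v.
Definition cports (u : V) : nat * nat :=
  (parent_port par port u, heavy_port Y r par (cdep c) port u).

(** One step towards [w] as computed from the tables. The condition [x != w] matters because
    forwarding switches to the next waypoint on the first arrival at [w]. *)
Definition hop_rel (F : {set {set V}}) (w : V) : rel V := fun x y =>
  [&& e x y, [set x; y] \notin F, x \in Y, y \in Y, x != w
    & onth (port x) (hop (cpre x, cout x) (cports x) (cpre w, clights w)) == Some y].

Lemma cluster_rooted : rooted_tree Y r par (cdep c).
Proof.
by have [h1 h2] := cdepP; split=> //; [exact: croot_in|exact: cpar_in].
Qed.
Let T := cluster_rooted.

(** A forbidden edge between [u] and its descendant [w] would have exactly one of them in its
    interval. The lengths telescope along [cdist]. *)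
Lemma segment_down F u w : u \in Y -> w \in Y -> w \in sub Y par (cdep c) u ->
  csame_side F (cpre u) (cpre w) ->
  exists p, [/\ path (hop_rel F w) u p, last u p = w & (len u p <= cdist c w - cdist c u)%R].
Proof.
have [m] := ubnP (cdep c w - cdep c u); elim: m u => // m IH u hm uY wY wu ss.
have [->|nwu] := eqVneq w u; first by exists [::]; rewrite subrr.
have [x [/and3P [xY xr /eqP xu] wx hx]] :=
  vhop_down T port uY wY wu nwu.
have xF : [set x; u] \notin F.
  rewrite -xu; apply: (same_side_edge T xY xr wY) wx.
  by rewrite xu.
have exu : e x u by rewrite -xu; exact: cpar_edge.
have ssx : csame_side F (cpre x) (cpre w).
  move=> a aF; rewrite (same_side_par T xY xr _ aF) ?xu //; exact: ss.
have [h1 _] := rpath_dep T wY (proj2 (andP (etrans (esym (in_sub _ _ _ _ _)) wx))).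
have hdx : cdep c x = (cdep c (par x)).+1 by have [_ _ _] := T; apply.
rewrite xu in hdx.
have [|p [xp lp lenp]] := IH x _ xY wY wx ssx.
  by move: hm h1 hdx; lia.
exists (x :: p); split=> //=.
  rewrite xp andbT /hop_rel e_sym exu finset.setUC xF uY xY eq_sym nwu /=.
  have -> : hop (cpre u, cout u) (cports u) (cpre w, clights w) = index x (port u) by exact: hx.
  by rewrite onth_index // e_port // e_sym.
by have := cdist_par xY xr; rewrite xu finset.setUC; lra.
Qed.

(** Climb until [w] lies below, then descend; the potential at the turning point is nonnegative, so
    the two ends pay for everything. *)
Lemma segment F u w : u \in Y -> w \in Y -> csame_side F (cpre u) (cpre w) ->
  exists p, [/\ path (hop_rel F w) u p, last u p = w & (len u p <= cdist c u + cdist c w)%R].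
Proof.
move=> uY wY; elim/(tree_ind T): u / uY => [|u uY ur IH] ss.
  have wr : w \in sub Y par (cdep c) r by rewrite in_sub wY (rpath_has_root T).
  have [p [h1 h2 h3]] := segment_down croot_in wY wr ss; exists p; split=> //.
  by have := cdist_bounds croot_in; lra.
have [wu|wu] := boolP (w \in sub Y par (cdep c) u).
  have [p [h1 h2 h3]] := segment_down uY wY wu ss; exists p; split=> //.
  by have := cdist_bounds uY; lra.
have uF := same_side_edge_up T uY ur wY ss wu.
have [|p [h1 h2 h3]] := IH.
  by move=> a aF; rewrite -(same_side_par T uY ur uF aF); exact: ss.
exists (par u :: p); split=> //=; last by have := cdist_par uY ur; lra.
have eu := cpar_edge uY ur.
rewrite h1 andbT /hop_rel eu uF uY (cpar_in uY ur) /=; apply/andP; split.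
  by apply: contraNneq wu => <-; exact: sub_self.
have -> : hop (cpre u, cout u) (cports u) (cpre w, clights w) = index (par u) (port u).
  exact: (vhop_up T).
by rewrite onth_index // e_port.
Qed.

End ClusterRouting.

(** * Boruvka rounds on sampled cuts *)

Section Boruvka.
Variables (V : finType) (I : Type) (num : I -> nat) (epos : I -> nat * nat).
Variables (Y : {set V}) (pos : V -> nat) (H : {set {set V}}) (eu ev : {set V} -> V).
Variables (info : {set V} -> I) (same : nat -> nat -> Prop).
Variables (F : finFieldType) (La X K : nat).

Hypothesis pos_lt : forall v, v \in Y -> pos v < #|V|.
Hypothesis ends_in : forall e, e \in H -> eu e \in Y /\ ev e \in Y.
Hypothesis epos_info : forall e, e \in H -> epos (info e) = (pos (eu e), pos (ev e)).
Hypothesis num_inj : injective num.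
Hypothesis info_inj : {in H &, injective info}.
Hypothesis num_lt : forall e, e \in H -> num (info e) < X.
Hypothesis same_sym : forall j j', same j j' -> same j' j.

Definition coins : finType := (F * {ffun {set V} -> 'I_(2 ^ La)})%type.
Definition round : finType := {ffun 'I_K -> coins}.

Definition link (st : I -> Prop) (j j' : nat) : Prop :=
  same j j' \/ exists2 x, st x & epos x = (j, j') \/ epos x = (j', j).

Definition reach (st : I -> Prop) : nat -> nat -> Prop :=
  Relation_Operators.clos_refl_trans nat (link st).

Definition edge_cut (A : nat -> Prop) : {set {set V}} :=
  [set e in H | `[< A (pos (eu e)) >] != `[< A (pos (ev e)) >] ].

Definition fingerprint (z : coins) (l : nat) (D : {set {set V}}) : F :=
  (\sum_(e in sample z.2 l D) z.1 ^+ num (info e))%R.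

(** The right level and repetition are unknown to the searcher, so all are tried, for every class
    and every candidate name; false matches therefore have to be excluded for all of them at
    once. *)
Definition found (st : I -> Prop) (y : round) (x : I) : Prop :=
  num x < X /\ exists (i : 'I_#|V|) (j : 'I_K) (l : 'I_La.+1),
    ((y j).1 ^+ num x)%R = fingerprint (y j) l (edge_cut (reach st i)).

Definition boruvka_step (st : I -> Prop) (y : round) : I -> Prop :=
  fun x => st x \/ found st y x.

Definition wrong (D : {set {set V}}) (l : nat) (z : coins) : bool :=
  [exists x : 'I_X, (z.1 ^+ x == fingerprint z l D)%R
    && ~~ [exists e, (sample z.2 l D == [set e]) && (num (info e) == x)]].

Definition level (D : {set {set V}}) : nat := (trunc_log 2 #|D|).+2.

(** A false match anywhere would break soundness; a nonempty cut isolated in no repetition at its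
    proper level would break progress. *)
Definition bad_cut (D : {set {set V}}) (y : round) : bool :=
  [exists j, [exists l : 'I_La.+1, wrong D l (y j)]]
  || (D != finset.set0) && [forall j, #|sample (y j).2 (level D) D| != 1].

Definition bad_round (st : I -> Prop) (y : round) : bool :=
  [exists i : 'I_#|V|, bad_cut (edge_cut (reach st i)) y].

Lemma cut_sub A : edge_cut A \subset H.
Proof. by apply/fintype.subsetP => e; rewrite inE => /andP []. Qed.

Lemma sample_sub g l (D : {set {set V}}) : sample (La := La) g l D \subset D.
Proof. by apply/fintype.subsetP => e; rewrite inE => /andP []. Qed.

Lemma reach_refl st j : reach st j j.
Proof. exact: Relation_Operators.rt_refl. Qed.

Lemma reach_sym st j j' : reach st j j' -> reach st j' j.
Proof.
elim=> [x y h|x|x y z _ h1 _ h2]; last 2 first.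
- exact: Relation_Operators.rt_refl.
- exact: Relation_Operators.rt_trans h2 h1.
apply: Relation_Operators.rt_step; case: h => [h|[w h1 h2]]; first by left; exact: same_sym.
by right; exists w => //; case: h2; [right|left].
Qed.

Lemma reach_trans st j1 j2 j3 : reach st j1 j2 -> reach st j2 j3 -> reach st j1 j3.
Proof. exact: Relation_Operators.rt_trans. Qed.

Lemma reach_mono (st st' : I -> Prop) j j' : (forall x, st x -> st' x) ->
  reach st j j' -> reach st' j j'.
Proof.
move=> h; elim=> [x y hxy|x|x y z _ h1 _ h2].
- apply: Relation_Operators.rt_step; case: hxy => [?|[w /h h1 h2]]; first by left.
  by right; exists w.
- exact: reach_refl.
- exact: reach_trans h1 h2.
Qed.

Definition sound (st : I -> Prop) : Prop := forall x, st x -> exists2 e, e \in H & x = info e.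

Definition class (st : I -> Prop) (v : V) : {set V} :=
  [set u in Y | `[< reach st (pos v) (pos u) >] ].

(** The Boruvka invariant concerns only unfinished classes: one with an empty cut is a full
    component and may stay small. *)
Definition grown (i : nat) (st : I -> Prop) : Prop :=
  forall v, v \in Y -> edge_cut (reach st (pos v)) != finset.set0 -> 2 ^ i <= #|class st v|.

Lemma cut_ext (A A' : nat -> Prop) : (forall j, A j <-> A' j) -> edge_cut A = edge_cut A'.
Proof.
move=> h; have hb j : `[< A j >] = `[< A' j >] by apply/asboolP/asboolP => /h.
by apply/setP => e; rewrite !inE !hb.
Qed.

Lemma fingerprint1 z l (D : {set {set V}}) e : sample z.2 l D = [set e] ->
  fingerprint z l D = (z.1 ^+ num (info e))%R.
Proof. by move=> h; rewrite /fingerprint h big_set1. Qed.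

Section Step.
Variables (st : I -> Prop) (y : round) (i : nat).
Hypotheses (hlev : forall D : {set {set V}}, D \subset H -> level D <= La).
Hypotheses (st_sound : sound st) (st_grown : grown i st) (not_bad : ~~ bad_round st y).

Lemma step_sound : sound (boruvka_step st y).
Proof.
move=> x [/st_sound //|[xX [k [j [l hf]]]]].
move/existsPn: not_bad => /(_ k); rewrite negb_or => /andP [/existsPn /(_ j) /existsPn /(_ l)].
move=> /existsPn /(_ (Ordinal xX)) /= + _; rewrite hf eqxx /= negbK => /existsP [e /andP [/eqP hs /eqP he]].
exists e; last exact: num_inj.
apply: (fintype.subsetP (cut_sub (reach st k))).
by apply: (fintype.subsetP (sample_sub (y j).2 l _)); rewrite hs inE.
Qed.

(** Soundness makes every found edge an edge of [H], and with an empty cut none of these leaves the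
    class. *)
Lemma step_closed v : v \in Y -> edge_cut (reach st (pos v)) = finset.set0 ->
  forall j, reach (boruvka_step st y) (pos v) j <-> reach st (pos v) j.
Proof.
move=> vY h0 j; split; last by apply: reach_mono => x; left.
have closed u w : link (boruvka_step st y) u w -> reach st (pos v) u -> reach st (pos v) w.
  case=> [hs|[x /step_sound [e eH ->] hx]] hu.
    by apply: reach_trans hu _; apply: Relation_Operators.rt_step; left.
  have : e \notin edge_cut (reach st (pos v)) by rewrite h0 inE.
  rewrite inE eH /= negbK => /eqP eqb.
  have [h1 h2] := asbool_eq_equiv eqb.
  by move: hx; rewrite epos_info // => -[] [e1 e2]; move: hu; rewrite -e1 -e2.
have hr u w : reach (boruvka_step st y) u w -> reach st (pos v) u -> reach st (pos v) w.
  elim=> [a b|//|a b c _ h1 _ h2 ha]; first exact: closed.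
  exact: h2 (h1 ha).
by move=> /hr; apply; exact: reach_refl.
Qed.

(** An isolated edge leaving the class of [v] also lies in the cut of the class at its other end.
    Both classes are unfinished and disjoint, so the invariant gives [2^i] vertices in each, and the
    edge merges them. *)
Lemma step_grown : grown i.+1 (boruvka_step st y).
Proof.
move=> v vY hcut.
have hst : edge_cut (reach st (pos v)) != finset.set0.
  by apply: contra hcut => /eqP h; rewrite (cut_ext (step_closed vY h)) h.
move/existsPn: (not_bad) => /(_ (Ordinal (pos_lt vY))); rewrite /bad_cut negb_or /= hst /=.
set D := edge_cut _ in hst *; move=> /andP [_ /forallPn [j]]; rewrite negbK => /cards1P [e he].
have eD : e \in D by apply: (fintype.subsetP (sample_sub (y j).2 (level D) D)); rewrite he inE.
have eH : e \in H by exact: (fintype.subsetP (cut_sub _)) eD.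
have lD : level D < La.+1 by rewrite ltnS; apply: hlev; exact: cut_sub.
have fe : boruvka_step st y (info e).
  right; split; first exact: num_lt.
  by exists (Ordinal (pos_lt vY)), j, (Ordinal lD); rewrite (fingerprint1 he).
have [uY wY] := ends_in eH.
have [u [w [[uY' wY' hu hw lnk] hends]]] : exists u w, [/\ u \in Y, w \in Y, reach st (pos v) (pos u),
    ~ reach st (pos v) (pos w) & reach (boruvka_step st y) (pos u) (pos w)]
    /\ (eu e = u /\ ev e = w \/ eu e = w /\ ev e = u).
  have hl : reach (boruvka_step st y) (pos (eu e)) (pos (ev e)).
    apply: Relation_Operators.rt_step; right; exists (info e) => //.
    by left; rewrite epos_info.
  move: eD; rewrite inE eH /=; case: (asboolP (reach st _ (pos (eu e)))) => h1;
    case: (asboolP (reach st _ (pos (ev e)))) => h2 // _.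
    by exists (eu e), (ev e); split=> //; left.
  by exists (ev e), (eu e); split; [split=> //; exact: reach_sym|right].
have hwv j' : reach st (pos w) j' -> ~ reach st (pos v) j'.
  by move=> h1 h2; apply: hw; apply: reach_trans h2 (reach_sym h1).
have cw : edge_cut (reach st (pos w)) != finset.set0.
  apply/set0Pn; exists e; rewrite inE eH /=.
  have h1 : `[< reach st (pos w) (pos u) >] = false by apply/asboolP => /hwv.
  have h2 : `[< reach st (pos w) (pos w) >] = true by apply/asboolP; exact: reach_refl.
  by case: hends => -[-> ->]; rewrite h1 h2.
have g1 := st_grown vY hst; have g2 := st_grown wY' cw.
have dis : [disjoint class st v & class st w].
  apply/pred0P => x /=; apply/negP; rewrite !inE => /andP [/andP [_ /asboolP h1] /andP [_ /asboolP h2]].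
  exact: hwv h2 h1.
have card : #|class st v :|: class st w| = #|class st v| + #|class st w|.
  by apply/eqP; rewrite (leq_card_setU _ _).2.
apply: (@leq_trans #|class st v :|: class st w|); first by rewrite card expnS mul2n -addnn leq_add.
have mono j1 j2 : reach st j1 j2 -> reach (boruvka_step st y) j1 j2.
  by apply: reach_mono => x; left.
apply: subset_leq_card; apply/fintype.subsetP => x; rewrite !inE.
move=> /orP [] /andP [-> /asboolP h] /=; apply/asboolP; first exact: mono.
by apply: reach_trans (mono _ _ hu) _; apply: reach_trans lnk (mono _ _ h).
Qed.
End Step.

Lemma boruvka_complete L (ys : seq round) (st0 := fun _ : I => False) :
  (forall D : {set {set V}}, D \subset H -> level D <= La) ->
  size ys = L -> #|V| < 2 ^ L -> ~~ ever_bad boruvka_step bad_round st0 ys ->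
  let st := foldl boruvka_step st0 ys in
  sound st /\ forall e, e \in H -> reach st (pos (eu e)) (pos (ev e)).
Proof.
move=> hlev sz VL hb st.
have [s g] : sound st /\ grown L st.
  have : sound st0 by [].
  have : grown 0 st0.
    move=> v vY _; rewrite expn0; apply/card_gt0P; exists v; rewrite inE vY; apply/asboolP.
    exact: reach_refl.
  rewrite -[L]add0n -sz /st; move: 0 st0 hb {sz st}.
  elim: ys => [|y ys IH] i st0 /=; first by rewrite addn0.
  rewrite negb_or => /andP [nb /IH h] hg hs; rewrite -addSnnS; apply: h.
    exact: step_grown.
  exact: step_sound nb.
split=> // e eH; have [uY vY] := ends_in eH; apply: contrapT => nr.
have : 2 ^ L <= #|class st (eu e)|.
  apply: g => //; apply/set0Pn; exists e; rewrite inE eH /=.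
  rewrite (introT (asboolP _) (reach_refl st _)).
  by case: asboolP.
by move=> /leq_trans /(_ (max_card _)); rewrite leqNgt VL.
Qed.

(** The sample is fixed first, so that only the field element remains random. *)
Lemma card_wrong (D : {set {set V}}) l M1 : D \subset H -> X * X * M1 <= #|F| ->
  #|[set z | wrong D l z]| * M1 <= #|coins|.
Proof.
move=> /fintype.subsetP DH hM; apply: (card_pair_le (P := fun a g => wrong D l (a, g))) => g.
apply: leq_trans hM; rewrite leq_mul2r; apply/orP; right.
have sH e : e \in sample g l D -> e \in H by move=> /(fintype.subsetP (sample_sub _ _ _)) /DH.
apply: (@card_collision F _ (fun e => num (info e)) X (sample g l D)).
  by move=> e /sH /num_lt.
by move=> e e' /sH h /sH h' /num_inj; exact: info_inj.
Qed.

(** False matches and failed isolation each get half of the budget [1 / (#|V| M)] of a single cut; a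
    union bound over the at most [#|V|] classes of the fixed state [st] finishes. *)
Lemma card_bad_round st M M1 K' :
  (forall D : {set {set V}}, D \subset H -> level D <= La) ->
  K = 6 * K' -> X * X * M1 <= #|F| ->
  2 * #|V| * La.+1 * K * M <= M1 -> 2 * #|V| * M <= 2 ^ K' ->
  #|[set y | bad_round st y]| * M <= #|round|.
Proof.
move=> hlev hK hX hM1 hM.
have [M0|M0] := posnP M; first by rewrite M0 muln0.
have [V0|V0] := posnP #|V|.
  rewrite (_ : [set y | _] = finset.set0) ?cards0 //; apply/setP => y; rewrite !inE.
  by apply/negbTE/existsPn => i; case: i => m; rewrite V0.
have cR : #|round| = #|coins| ^ K by rewrite card_ffun card_ord.
pose A (D : {set {set V}}) := [set y : round | [exists j, [exists l : 'I_La.+1, wrong D l (y j)]]].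
pose B (D : {set {set V}}) := [set y : round | (D != finset.set0) && [forall j, #|sample (y j).2 (level D) D| != 1]].
have hA (D : {set {set V}}) : D \subset H -> #|A D| * (2 * #|V| * M) <= #|round|.
  move=> DH.
  have hl (l : 'I_La.+1) : #|[set y : round | [exists j, wrong D l (y j)]]| * M1 <= K * #|coins| ^ K.
    exact: card_ffun_exists (card_wrong l DH hX).
  have := cards_bigcup_le hl; rewrite card_ord.
  have -> : \bigcup_(l : 'I_La.+1) [set y : round | [exists j, wrong D l (y j)]] = A D.
    apply/setP => y; rewrite inE; apply/bigcupP/existsP.
      by move=> [l _]; rewrite inE => /existsP [j h]; exists j; apply/existsP; exists l.
    by move=> [j /existsP [l h]]; exists l => //; rewrite inE; apply/existsP; exists j.
  rewrite -cR => h.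
  have [K0|K0] := posnP K.
    rewrite (_ : A D = finset.set0) ?cards0 //; apply/setP => y; rewrite !inE.
    by apply/negbTE/existsPn => j; have := ltn_ord j; rewrite [X in _ < X]K0.
  rewrite -(leq_pmul2l (m := La.+1 * K)) ?muln_gt0 //.
  apply: leq_trans (_ : #|A D| * M1 <= _); last by move: h; rewrite mulnA.
  have := leq_mul (leqnn #|A D|) hM1; lia.
have hB (D : {set {set V}}) : D \subset H -> #|B D| * (2 * #|V| * M) <= #|round|.
  move=> DH; have [D0|D0] := eqVneq D finset.set0.
    rewrite (_ : B D = finset.set0) ?cards0 //; apply/setP => y; rewrite !inE.
    by rewrite D0 eqxx.
  apply: (@leq_trans (#|B D| * 2 ^ K')); first by rewrite leq_mul2l hM orbT.
  have -> : B D = [set y : round | [forall j, #|sample (y j).2 (level D) D| != 1]].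
    by apply/setP => y; rewrite !inE D0.
  rewrite (card_ffun_forall K (fun z : coins => #|sample z.2 (level D) D| != 1)) cR.
  set c := #|_|.
  have hc : c * 8 <= 7 * #|coins|.
    have := card_isolated D0 (hlev D DH); set c' := #|_| => h.
    have -> : c = #|F| * c'.
      rewrite /c /c' -cardsT -cardsX; apply: eq_card => -[a g]; rewrite !inE //.
    by rewrite /coins card_prod mulnCA -mulnA leq_mul2l h orbT.
  (* [(7/8)^6 < 1/2], by rounding up: [49/64 <= 10/13], its square is at most 3/5, and their product
     is [6/13]. Hence six repetitions halve the failure probability. *)
  have h7 : c ^ 6 * 2 <= #|coins| ^ 6.
    move: (#|coins|) hc => m hc; rewrite !expnS !expn0 !muln1.
    have := leq_mul hc hc; set c2 := c * c; set m2 := m * m => h2.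
    have {h2} h2 : c2 * 13 <= m2 * 10 by rewrite /c2 /m2; lia.
    have h4 : (c2 * c2) * 5 <= (m2 * m2) * 3 by have := leq_mul h2 h2; lia.
    have := leq_mul h2 h4; rewrite /c2 /m2; lia.
  rewrite hK !expnM -expnMn; case: (K') => // k; by rewrite leq_exp2r.
have hAB (D : {set {set V}}) : D \subset H -> #|[set y : round | bad_cut D y]| * (#|V| * M) <= #|round|.
  move=> DH; have := hA D DH; have := hB D DH.
  have : #|[set y : round | bad_cut D y]| <= #|A D| + #|B D|.
    apply: leq_trans (leq_of_leqif (leq_card_setU _ _)).
    by apply: subset_leq_card; apply/fintype.subsetP => y; rewrite !inE.
  set a := #|A D|; set b := #|B D|; set d := #|[set y : round | bad_cut D y]| => h1 h2 h3.
  have := leq_mul h1 (leqnn (#|V| * M)); lia.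
have hi (i : 'I_#|V|) : #|[set y : round | bad_cut (edge_cut (reach st i)) y]| * (#|V| * M) <= #|round|.
  exact: hAB (cut_sub _).
have := cards_bigcup_le hi; rewrite card_ord.
have -> : \bigcup_(i : 'I_#|V|) [set y : round | bad_cut (edge_cut (reach st i)) y] = [set y | bad_round st y].
  apply/setP => y; rewrite inE; apply/bigcupP/existsP.
    by move=> [i _]; rewrite inE; exists i.
  by move=> [i h]; exists i => //; rewrite inE.
by rewrite mulnCA leq_pmul2l.
Qed.

End Boruvka.

(** * Cut sums from prefix sums *)

Section CutSums.
Variables (V : finType) (Y : {set V}) (pos : V -> nat) (E : {set {set V}}) (eu ev : {set V} -> V).
Variables (F : finFieldType) (char2 : 2%N \in [pchar F]%R) (val : {set V} -> F).
Hypothesis ends_in : forall e, e \in E -> [/\ eu e \in Y, ev e \in Y, eu e != ev e & e = [set eu e; ev e]].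
Local Open Scope ring_scope.

Definition vertex_sum (v : V) : F := \sum_(e in E | v \in e) val e.
Definition prefix_sum (m : nat) : F := \sum_(v in Y | (pos v < m)%N) vertex_sum v.

Lemma weighted_vertex_sum (f : V -> F) :
  \sum_(v in Y) f v * vertex_sum v = \sum_(e in E) (f (eu e) + f (ev e)) * val e.
Proof.
rewrite /vertex_sum (eq_bigr (fun v => \sum_(e in E) if v \in e then f v * val e else 0)); last first.
  by move=> v _; rewrite big_distrr /= big_mkcondr.
rewrite exchange_big /=; apply: eq_bigr => e eE; have [uY vY uv he] := ends_in eE.
have ue : eu e \in e by move: (set21 (eu e) (ev e)); rewrite -he.
have ve : ev e \in e by move: (set22 (eu e) (ev e)); rewrite -he.
rewrite (bigD1 (eu e)) //= ue (bigD1 (ev e)) /=; last by rewrite vY eq_sym.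
rewrite ve big1 ?addr0 ?mulrDl // => x /andP [/andP [_ h1] h2].
have : x \notin [set eu e; ev e] by rewrite !inE (negbTE h1) (negbTE h2).
by rewrite -he => /negbTE ->.
Qed.

Lemma bool_char2 (a b : bool) (x : F) : (if a != b then x else 0) = ((a : nat)%:R + (b : nat)%:R) * x.
Proof.
by case: a b => -[] /=; rewrite ?addr0 ?add0r ?mul1r ?mul0r // addrr_pchar2 // mul0r.
Qed.

(** Summation by parts: vertex [v] receives the coefficient [A (pos v) + A (n-1)]. At an edge the
    constant [A (n-1)] occurs twice and cancels, leaving the cut. [P] needs to be right only where
    [A] jumps. *)
Lemma cut_prefix (A : pred nat) n (P : nat -> F) :
  (forall v, v \in Y -> (pos v < n)%N) ->
  (forall m, A m.-1 != A m -> P m = prefix_sum m) ->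
  \sum_(1 <= m < n) (if A m.-1 != A m then P m else 0) =
  \sum_(e in E) (if A (pos (eu e)) != A (pos (ev e)) then val e else 0).
Proof.
move=> pos_n hP; pose f (m : nat) : F := (A m : nat)%:R.
transitivity (\sum_(1 <= m < n) \sum_(v in Y) if (pos v < m)%N then (f m.-1 + f m) * vertex_sum v else 0).
  apply: eq_bigr => m _; rewrite -big_mkcondr -big_distrr /=.
  rewrite -/(prefix_sum m) -bool_char2.
  by case: ifP => // /hP ->.
rewrite exchange_big /=.
transitivity (\sum_(v in Y) (f (pos v) + f n.-1) * vertex_sum v).
  apply: eq_bigr => v vY; have vn := pos_n v vY.
  rewrite (eq_bigr (fun m => (if (pos v < m)%N then f m.-1 + f m else 0) * vertex_sum v)); last first.
    by move=> m _; case: ifP => _; rewrite ?mul0r.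
  rewrite -big_distrl /=; congr (_ * _).
  rewrite (big_cat_nat (n := (pos v).+1)) //= [X in X + _]big_nat_cond big1 ?add0r; last first.
    by move=> m /andP [/andP [_ h] _]; rewrite ltnNge -ltnS h.
  rewrite big_add1 big_nat (eq_bigr (fun m => f m.+1 - f m)); last first.
    by move=> m /andP [h _]; rewrite ltnS h /= addrC (oppr_pchar2 char2).
  rewrite -big_nat telescope_sumr ?(oppr_pchar2 char2) 1?addrC //.
  by case: (n) vn.
rewrite weighted_vertex_sum; apply: eq_bigr => e _; rewrite bool_char2; congr (_ * _).
by rewrite addrACA (addrr_pchar2 char2) addr0.
Qed.

End CutSums.

(** * Short chains of found edges *)

Section Chains.
Variables (I : Type) (epos : I -> nat * nat) (swap : I -> I) (same : nat -> nat -> Prop).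
Hypothesis epos_swap : forall x, epos (swap x) = ((epos x).2, (epos x).1).
Hypothesis swapK : involutive swap.
Hypothesis same_refl : forall j, same j j.
Hypothesis same_sym : forall j j', same j j' -> same j' j.
Hypothesis same_trans : forall j1 j2 j3, same j1 j2 -> same j2 j3 -> same j1 j3.
Variable st : I -> Prop.

Fixpoint chain (j : nat) (es : seq I) (j' : nat) : Prop :=
  if es is x :: es' then [/\ st x \/ st (swap x), same j (epos x).1 & chain (epos x).2 es' j']
  else same j j'.

Lemma chain_start j1 j2 es j' : same j1 j2 -> chain j2 es j' -> chain j1 es j'.
Proof.
by case: es => [|x es] /= h; [exact: same_trans|case=> h1 h2 h3; split=> //; exact: same_trans h2].
Qed.

Lemma chain_cat j1 es j2 es' j3 : chain j1 es j2 -> chain j2 es' j3 -> chain j1 (es ++ es') j3.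
Proof.
elim: es j1 => [|x es IH] j1 /=; first exact: chain_start.
by move=> [h1 h2 h3] h; split=> //; exact: IH h.
Qed.

Lemma reach_chain j j' : reach epos same st j j' -> exists es, chain j es j'.
Proof.
elim=> [a b [h|[x sx hx]]|a|a b c _ [es1 h1] _ [es2 h2]]; last 2 first.
- by exists [::]; exact: same_refl.
- by exists (es1 ++ es2); exact: chain_cat h1 h2.
- by exists [::].
case: hx => hx.
  by exists [:: x]; rewrite /= hx; split=> //; left.
exists [:: swap x]; rewrite /= epos_swap hx; split=> //; right.
by rewrite swapK.
Qed.

(** Replacing each component by its representative turns the chain into a path in a graph on [tops];
    a simple path there has fewer edges than [tops] has elements. *)
Lemma chain_short (V : finType) (Y tops : {set V}) (pos : V -> nat) (top : V -> V) m s t es :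
  #|tops| <= m.+1 -> (forall v, v \in Y -> top v \in tops) ->
  (forall v, v \in Y -> same (pos v) (pos (top v))) ->
  (forall x, st x -> exists u v, [/\ u \in Y, v \in Y & epos x = (pos u, pos v)]) ->
  s \in Y -> t \in Y -> chain (pos s) es (pos t) ->
  exists2 es', chain (pos s) es' (pos t) & size es' <= m.
Proof.
move=> htops topT topS hst sY tY hc.
have hst2 x : st x \/ st (swap x) -> exists u v, [/\ u \in Y, v \in Y & epos x = (pos u, pos v)].
  case=> /hst [u [v [uY vY h]]]; first by exists u, v.
  by exists v, u; split=> //; move: h; rewrite epos_swap; case: (epos x) => a b [-> ->].
pose rt : rel V := fun a b => `[< (b \in tops) /\ exists x,
  [/\ st x \/ st (swap x), same (pos a) (epos x).1 & same (epos x).2 (pos b)] >].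
have [p [sp lp]] : exists p, path rt (top s) p /\ same (pos (last (top s) p)) (pos t).
  elim: es s sY hc => [|x es IH] s sY /=.
    by move=> h; exists [::]; split=> //=; apply: same_trans h; apply: same_sym; exact: topS.
  move=> [h1 h2 h3]; have [u [v [uY vY hx]]] := hst2 x h1.
  rewrite hx /= in h2 h3; have [p [hp lp]] := IH v vY h3.
  exists (top v :: p); rewrite /= hp andbT; split=> //; apply/asboolP; split; first exact: topT.
  exists x; rewrite hx /=; split=> //; last exact: topS.
  by apply: same_trans h2; apply: same_sym; exact: topS.
case/shortenP: sp lp => p' hp' Up' _ lp.
have szp : size p' <= m.
  have : size (top s :: p') <= #|tops|.
    rewrite cardE; apply: uniq_leq_size => // x; rewrite mem_enum inE => /orP [/eqP ->|xp].
      exact: topT.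
    have : all (mem tops) p'.
      elim: p' (top s) hp' {Up' lp xp} => //= y p' IH a /andP [/asboolP [-> _]]; exact: IH.
    by move=> /allP; exact.
  by move=> /leq_trans /(_ htops).
have [es' hes' szes] : exists2 es', chain (pos (top s)) es' (pos t) & size es' = size p'.
  elim: p' (top s) hp' lp {Up' szp} => [|y p' IH] a /=; first by exists [::].
  move=> /andP [/asboolP [_ [x [h1 h2 h3]]] hp] lp; have [es' h4 h5] := IH y hp lp.
  by exists (x :: es'); rewrite /= ?h5 //; split=> //; exact: chain_start h4.
by exists es'; [exact: chain_start (topS _ sY) hes'|rewrite szes].
Qed.

End Chains.

(** * The routing algorithm *)

Definition lg (n : nat) : nat := (trunc_log 2 n).+1.

Lemma lg_gt n : n < 2 ^ lg n.
Proof. exact: trunc_log_ltn. Qed.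

(** Here [b] is [lg n]. A cluster has fewer than [2^(2b)] edges, whence [levels]; [wp_bits] adds two
    numbers of [2b+1] bits to the code of at most [b] light ports; [slack] is the logarithm of the
    failure budget for false matches, and [field_bits] adds the two factors [X] of the root count.
    In [half_reps] and [slack], the term [(c+5) b] is the target exponent of one round. *)
Definition levels (b : nat) : nat := (2 * b).+1.
Definition wp_bits (b : nat) : nat := 4 * b * b + 7 * b + 3.
Definition num_bits (b : nat) : nat := (2 * wp_bits b).+1.
Definition half_reps (c b : nat) : nat := (c + 6) * b + 1.
Definition reps (c b : nat) : nat := 6 * half_reps c b.
Definition slack (c b : nat) : nat := 1 + b + (levels b).+1 + reps c b + (c + 5) * b.
Definition field_bits (c b : nat) : nat := num_bits b + num_bits b + slack c b.

Definition gf (m : nat) : finFieldType := s2val (PrimePowerField (isT : prime 2) (ltn0Sn m)).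

Lemma card_gf m : #|gf m| = 2 ^ m.+1.
Proof. by rewrite /gf; case: PrimePowerField. Qed.

Lemma gf_char2 m : 2%N \in [pchar (gf m)]%R.
Proof. by rewrite /gf; case: PrimePowerField. Qed.

Definition field_nat (F : finFieldType) (x : F) : nat := enum_rank x.
Definition nat_field (F : finFieldType) (m : nat) : F := nth 0%R (enum F) m.

Lemma field_natK (F : finFieldType) : cancel (@field_nat F) (@nat_field F).
Proof. by move=> x; rewrite /nat_field /field_nat nth_enum_rank. Qed.

(* A waypoint: preorder number and light ports of a vertex, and the port to take there. *)
Definition waypoint : Type := (nat * seq (nat * nat) * nat)%type.
Definition einfo : Type := (waypoint * waypoint)%type.
Definition epos (x : einfo) : nat * nat := (x.1.1.1, x.2.1.1).
Definition eswap (x : einfo) : einfo := (x.2, x.1).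
Definition info_num (x : einfo) : nat := bits_nat (enc x).

Lemma info_num_inj : injective info_num.
Proof. by move=> x y h; apply: (@enc_inj einfo _); exact: bits_nat_inj h. Qed.

(* End positions, number, interval, and per round and repetition the sample value
   followed by the prefix sums at the two ends of the interval, one pair per level. *)
Definition edata : Type :=
  ((nat * nat) * nat * (nat * nat) * seq (seq (nat * seq (nat * nat))))%type.
Definition d_pos (d : edata) : nat * nat := d.1.1.1.
Definition d_num (d : edata) : nat := d.1.1.2.
Definition d_int (d : edata) : nat * nat := d.1.2.
Definition d_rep (d : edata) (rd j : nat) : nat * seq (nat * nat) :=
  nth (0, [::]) (nth [::] d.2 rd) j.

(** Per cluster: the subtree interval, the parent and heavy ports, the light ports. A vertex label
    holds [n], an identifier, the random field elements of all rounds (the source must form their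
    powers), and one indexed entry per cluster containing the vertex. *)
Definition vdata : Type := ((nat * nat) * (nat * nat) * seq (nat * nat))%type.
Definition vlab : Type := (nat * nat * seq (seq nat) * seq (nat * vdata))%type.
Definition elab : Type := seq (nat * edata).
Definition header : Type := (nat * seq waypoint)%type.

Definition l_n (x : vlab) : nat := x.1.1.1.
Definition l_id (x : vlab) : nat := x.1.1.2.
Definition l_seeds (x : vlab) : seq (seq nat) := x.1.2.

Definition vdata0 : vdata := ((0, 0), (0, 0), [::]).
Definition vlab0 : vlab := (0, 0, [::], [::]).

Section Algorithm.
Variable c : nat.
Local Open Scope ring_scope.

Definition field_of (n : nat) : finFieldType := gf (field_bits c (lg n)).

Definition a_same (fl : seq edata) (j j' : nat) : Prop :=
  forall d, d \in fl -> inside (d_int d) j = inside (d_int d) j'.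

(** The first sum is the fingerprint of the cut in the whole cluster; the second adds the sampled
    forbidden edges across the cut again, which deletes them in characteristic 2. *)
Definition a_cut_value (n : nat) (seeds : seq (seq nat)) (fl : seq edata) (rd j l : nat)
    (P : nat -> field_of n) (A : pred nat) : field_of n :=
  \sum_(1 <= m < n) (if A m.-1 != A m then P m else 0) +
  \sum_(d <- fl) (if ((d_rep d rd j).1 < 2 ^ (levels (lg n) - l))%N && (A (d_pos d).1 != A (d_pos d).2)
                  then nat_field (field_of n) (nth 0%N (nth [::] seeds rd) j) ^+ d_num d else 0).

(** [P] stands for the prefix sums, known only at the interval ends of forbidden edges. Any
    extension will do, as the classes change at no other position. *)
Definition a_consistent (n : nat) (fl : seq edata) (rd j l : nat) (P : nat -> field_of n) : Prop :=
  forall d, d \in fl -> let q := nth (0, 0)%N (d_rep d rd j).2 l in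
    P (d_int d).1 = nat_field (field_of n) q.1 /\ P (d_int d).2 = nat_field (field_of n) q.2.

Definition a_found (n : nat) (seeds : seq (seq nat)) (fl : seq edata) (st : einfo -> Prop)
    (rd : nat) (x : einfo) : Prop :=
  (info_num x < 2 ^ num_bits (lg n))%N /\
  exists i j l, [/\ (i < n)%N, (j < reps c (lg n))%N, (l < (levels (lg n)).+1)%N &
    exists2 P, a_consistent fl rd j l P &
      nat_field (field_of n) (nth 0%N (nth [::] seeds rd) j) ^+ info_num x =
      a_cut_value seeds fl rd j l P (fun m => `[< reach epos (a_same fl) st i m >])].

Definition a_state (n : nat) (seeds : seq (seq nat)) (fl : seq edata) : einfo -> Prop :=
  foldl (fun st rd x => st x \/ a_found n seeds fl st rd x) (fun=> False) (iota 0 (lg n)).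

Definition select (Fl : seq elab) (i : nat) : seq edata :=
  [seq x.2 | x <- flatten Fl & x.1 == i].

(** Each edge of the chain contributes the waypoint at its near end together with the port that
    crosses it; the port 0 at [t] is a dummy. *)
Definition valid_header (Fl : seq elab) (tl sl : vlab) (h : header) : Prop :=
  exists sd td es, [/\ (h.1, sd) \in sl.2, (h.1, td) \in tl.2, (size es <= size Fl)%N,
    chain epos eswap (a_same (select Fl h.1)) (a_state (l_n sl) (l_seeds sl) (select Fl h.1))
      sd.1.1.1 es td.1.1.1
    & h.2 = rcons [seq x.1 | x <- es] (td.1.1.1, td.2, 0%N)].

Definition best_header (Fl : seq elab) (tl sl : vlab) (h : header) : Prop :=
  valid_header Fl tl sl h /\ forall h', valid_header Fl tl sl h' -> (h.1 <= h'.1)%N.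

Definition header_bound (n q : nat) : nat :=
  (8 * lg n).+1 + (q * (wp_bits (lg n)).+1).+1.

(** The empty header, which is no code of a header, means delivery on the spot. The final size test
    makes the header bound independent of the quality of the coins. *)
Definition route_init (Fl : seq bits) (t s : bits) : bits :=
  let sl := dec _ vlab0 s in
  let tl := dec _ vlab0 t in
  if l_id sl == l_id tl then [::] else
  let h := enc (choose_or (0%N, [::]) (best_header [seq dec _ [::] x | x <- Fl] tl sl)) in
  if (size h <= header_bound (l_n sl) (size Fl).+1)%N then h else [::].

Definition lookup (i : nat) (s : seq (nat * vdata)) : vdata :=
  (head (0%N, vdata0) [seq x <- s | x.1 == i]).2.

(** A header is either kept or loses its first waypoint. The size comparison holds for every genuine
    code; it is tested so that headers cannot grow on arbitrary input either. *)
Definition route_step (h t s : bits) : option (nat * bits) :=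
  if h is [::] then None else
  let hd : header := dec _ (0%N, [::]) h in
  let vd := lookup hd.1 (dec _ vlab0 s : vlab).2 in
  if hd.2 is w :: ws then
    if w.1.1 == vd.1.1.1 then
      if ws is [::] then None else
      if (size (enc (hd.1, ws)) <= size h)%N then Some (w.2, enc (hd.1, ws)) else None
    else Some (hop vd.1.1 vd.1.2 w.1, h)
  else None.

Definition algorithm : routing_algorithm := RoutingAlgorithm route_init route_step.

End Algorithm.

(** * Labels of one cluster *)

Lemma nth_map_enum_ord (T : Type) (d : T) K (f : 'I_K -> T) j (hj : j < K) :
  nth d [seq f i | i <- enum 'I_K] j = f (Ordinal hj).
Proof.
rewrite (nth_map (Ordinal hj)) ?size_enum_ord //; congr f.
by apply: val_inj; rewrite /= nth_enum_ord.
Qed.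

Lemma foldl_map (T1 T2 S : Type) (f : T1 -> T2) (g : S -> T2 -> S) z s :
  foldl g z [seq f x | x <- s] = foldl (fun y x => g y (f x)) z s.
Proof. by elim: s z => //=. Qed.

Lemma slack_mul n b l k m : n <= 2 ^ b -> 2 * n * l * k * 2 ^ m <= 2 ^ (1 + b + l + k + m).
Proof.
move=> nb; rewrite !expnD expn1.
have two x : x <= 2 ^ x by apply: ltnW; exact: ltn_expl.
exact: leq_mul (leq_mul (leq_mul (leq_mul (leqnn 2) nb) (two l)) (two k)) (leqnn _).
Qed.

Section Cluster.
Variables (R : realType) (V : finType) (G : wgraph R V) (port : V -> seq V) (v0 : V) (c : nat).
Local Notation n := #|V|.
Local Notation La := (levels (lg n)).
Local Notation K := (reps c (lg n)).
Local Notation FF := (field_of c n).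
Local Notation roundT := (round V FF La K).

Definition eu (a : {set V}) : V := odflt v0 [pick x in a].
Definition ev (a : {set V}) : V := odflt v0 [pick x in a :\ eu a].

Lemma ends_pair x y : x != y -> [/\ eu [set x; y] != ev [set x; y]
  & [set x; y] = [set eu [set x; y]; ev [set x; y]]].
Proof.
move=> xy; set a := [set x; y].
have ca : #|a| = 2 by rewrite cards2 xy.
have ua : eu a \in a.
  by rewrite /eu; case: pickP => //= h; have := h x; rewrite set21.
have va : ev a \in a :\ eu a.
  rewrite /ev; case: pickP => //= h.
  have : #|a :\ eu a| = 0 by apply/eqP; rewrite cards_eq0; apply/eqP/setP => z; rewrite h inE.
  by move: ca; rewrite (cardsD1 (eu a)) ua; lia.
move: va; rewrite in_setD1 => /andP [vu va].
split; first by rewrite eq_sym.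
by apply/esym/eqP; rewrite eqEcard finset.subUset !finset.sub1set ua va ca cards2 eq_sym vu.
Qed.

Variables (e : rel V) (B : R) (cl : tcluster R V).
Local Notation Y := (cset cl).

(** Non-tree edges belong here too: they are what reconnects the pieces of the broken tree. *)
Definition cedges : {set {set V}} :=
  locked [set a | [exists u, exists v, [&& e u v, u \in Y, v \in Y & a == [set u; v]]]].

Definition wp_of (v : V) (x : nat) : waypoint := (cpre cl v, clights cl port v, x).

Definition info (a : {set V}) : einfo :=
  (wp_of (eu a) (index (ev a) (port (eu a))), wp_of (ev a) (index (eu a) (port (ev a)))).

Definition sval (z : coins V FF La) (l : nat) (a : {set V}) : FF :=
  (if sampled z.2 l a then z.1 ^+ info_num (info a) else 0)%R.

Definition psum (z : coins V FF La) (l : nat) : nat -> FF :=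
  prefix_sum Y (cpre cl) cedges (sval z l).

Definition edge_data (w : seq roundT) (a : {set V}) : edata :=
  ((cpre cl (eu a), cpre cl (ev a)), info_num (info a), cinterval cl a,
   [seq [seq ((y j).2 a : nat,
      [seq (field_nat (psum (y j) l (cinterval cl a).1), field_nat (psum (y j) l (cinterval cl a).2))
        | l <- iota 0 La.+1])
      | j <- enum 'I_K] | y : roundT <- w]).

Definition vertex_data (v : V) : vdata := ((cpre cl v, cout cl v), cports cl port v, clights cl port v).

Definition seeds_of (w : seq roundT) : seq (seq nat) :=
  [seq [seq field_nat (y j).1 | j <- enum 'I_K] | y : roundT <- w].

Hypotheses (e_sym : symmetric e) (e_irr : irreflexive e) (e_ge1 : heavy_enough G e).
Hypotheses (e_port : forall u v, e u v -> v \in port u) (port_size : forall u, size (port u) <= n).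
Hypothesis ctree : tree_cluster G e B cl.

Lemma cedgesP a : a \in cedges ->
  [/\ eu a \in Y, ev a \in Y, eu a != ev a, a = [set eu a; ev a] & e (eu a) (ev a)].
Proof.
rewrite /cedges -lock inE => /existsP [x /existsP [y /and4P [exy xY yY /eqP ha]]].
have xy : x != y by apply: contraTneq exy => ->; rewrite e_irr.
have [h1 h2] := ends_pair xy; rewrite -ha in h1 h2.
have : x \in [set eu a; ev a] by rewrite -h2 ha set21.
have : y \in [set eu a; ev a] by rewrite -h2 ha set22.
rewrite !inE => /orP [] /eqP hy /orP [] /eqP hx; rewrite hx hy in xY yY exy xy.
- by rewrite eqxx in xy.
- by split=> //; rewrite e_sym.
- by split.
- by rewrite eqxx in xy.
Qed.

Lemma mem_cedges u v : e u v -> u \in Y -> v \in Y -> [set u; v] \in cedges.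
Proof.
move=> h1 h2 h3; rewrite /cedges -lock inE; apply/existsP; exists u; apply/existsP; exists v.
by rewrite h1 h2 h3 eqxx.
Qed.

Lemma ends_cedges a : a \in cedges -> [/\ eu a \in Y, ev a \in Y, eu a != ev a & a = [set eu a; ev a]].
Proof. by move=> /cedgesP []. Qed.

Let T := cluster_rooted e_ge1 ctree.

Lemma cpre_lt v : v \in Y -> cpre cl v < n.
Proof. exact: pre_lt. Qed.

Lemma cpre_inj : {in Y &, injective (cpre cl)}.
Proof. exact: (pre_inj T). Qed.

Lemma info_inj : {in cedges &, injective info}.
Proof.
move=> a a' /cedgesP [h1 h2 _ h3 _] /cedgesP [h1' h2' _ h3' _] h.
have := congr1 (fun x => (epos x).1) h; have := congr1 (fun x => (epos x).2) h.
rewrite /epos /= => /(cpre_inj h2 h2') hv /(cpre_inj h1 h1') hu.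
by rewrite h3 h3' hu hv.
Qed.

Lemma port_lt u v : index v (port u) < 2 ^ lg n.
Proof. by apply: leq_ltn_trans (index_size _ _) _; apply: leq_ltn_trans (port_size u) (lg_gt n). Qed.

Lemma size_enc_lights v : v \in Y -> size (enc (clights cl port v)) <= (lg n * (4 * lg n + 3)).+1.
Proof.
move=> vY; apply: leq_trans (size_enc_seq_le (m := 4 * lg n + 2) _) _; last first.
  by rewrite ltnS leq_mul // ?(size_lights T) ?lg_gt //; lia.
move=> x /(mem_lights T vY) [d [_ dY dr ->]]; rewrite size_enc_pair.
have h1 : pre Y (cpar cl) (cdep cl) (cpar cl d) < 2 ^ lg n.
  by apply: ltn_trans (lg_gt n); apply: pre_lt; exact: (cpar_in ctree).
have := size_enc_nat h1; have := size_enc_nat (port_lt (cpar cl d) d).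
set s1 := size _; set s2 := size _; lia.
Qed.

Lemma size_enc_wp v x : v \in Y -> x < 2 ^ lg n -> size (enc (wp_of v x)) <= wp_bits (lg n).
Proof.
move=> vY hx; rewrite !size_enc_pair /=.
have h1 := size_enc_nat (ltn_trans (cpre_lt vY) (lg_gt n)).
have h2 := size_enc_nat hx; have h3 := size_enc_lights vY.
move: h1 h2 h3; rewrite /wp_bits /=; set s1 := size _; set s2 := size _; set s3 := size _; lia.
Qed.

Lemma info_num_lt a : a \in cedges -> info_num (info a) < 2 ^ num_bits (lg n).
Proof.
move=> /cedgesP [uY vY _ _ _]; apply: leq_trans (bits_nat_lt _) _; rewrite leq_exp2l //.
rewrite ltnS size_enc_pair /info /= mul2n -addnn leq_add // size_enc_wp //; exact: port_lt.
Qed.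

Section Query.
Variables (Fs : seq {set V}) (Fs_uniq : uniq Fs) (w : seq roundT) (w_size : size w = lg n).
Local Notation FE := [set a in Fs | a \in cedges].
Local Notation H := (cedges :\: FE).
Local Notation fl := [seq edge_data w a | a <- Fs & a \in cedges].

Lemma a_same_eq : a_same fl = csame_side cl FE.
Proof.
apply/funext => j; apply/funext => j'; apply/propext; split=> h.
  move=> a; rewrite !inE => /andP [aF aE].
  by apply: (h (edge_data w a)); rewrite map_f // mem_filter aE aF.
move=> d /mapP [a]; rewrite mem_filter => /andP [aE aF] ->; apply: (h a).
by rewrite !inE aE aF.
Qed.

Local Notation cutH := (edge_cut (cpre cl) H eu ev).
Local Notation mreach := (reach epos (csame_side cl FE)).

Lemma d_repE a rd (y0 : roundT) j (hj : j < K) : rd < size w ->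
  d_rep (edge_data w a) rd j = ((nth y0 w rd (Ordinal hj)).2 a : nat,
      [seq (field_nat (psum (nth y0 w rd (Ordinal hj)) l (cinterval cl a).1),
            field_nat (psum (nth y0 w rd (Ordinal hj)) l (cinterval cl a).2)) | l <- iota 0 La.+1]).
Proof.
move=> hrd; rewrite /d_rep /edge_data /=.
by rewrite (nth_map y0) //  (nth_map_enum_ord _ _ hj).
Qed.

Lemma d_repE1 a rd (y0 : roundT) j (hj : j < K) : rd < size w ->
  (d_rep (edge_data w a) rd j).1 = (nth y0 w rd (Ordinal hj)).2 a.
Proof. by move=> hrd; rewrite (d_repE a y0 hj hrd). Qed.

Lemma d_repE2 a rd (y0 : roundT) j (hj : j < K) l : rd < size w -> l < La.+1 ->
  nth (0, 0) (d_rep (edge_data w a) rd j).2 l =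
  (field_nat (psum (nth y0 w rd (Ordinal hj)) l (cinterval cl a).1),
   field_nat (psum (nth y0 w rd (Ordinal hj)) l (cinterval cl a).2)).
Proof.
move=> hrd hl; rewrite (congr1 snd (d_repE a y0 hj hrd)) (nth_map 0) ?size_iota //.
by rewrite nth_iota // add0n.
Qed.

Lemma seedE rd (y0 : roundT) j (hj : j < K) : rd < size w ->
  nat_field FF (nth 0 (nth [::] (seeds_of w) rd) j) = (nth y0 w rd (Ordinal hj)).1.
Proof.
by move=> hrd; rewrite /seeds_of (nth_map y0) // (nth_map_enum_ord _ _ hj) field_natK.
Qed.

(** A class of the current state is a union of components of [T - F], so the labels pin [P] at each
    of its jumps, and summation by parts yields the cut; what remains after deleting [FE] is the
    fingerprint in [H]. *)
Lemma a_cut_valueE st i rd (y0 : roundT) j (hj : j < K) l (P : nat -> FF) :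
  rd < size w -> l < La.+1 -> a_consistent fl rd j l P ->
  a_cut_value (seeds_of w) fl rd j l P (fun m => `[< mreach st i m >]) =
  fingerprint info_num info (nth y0 w rd (Ordinal hj)) l (cutH (mreach st i)).
Proof.
move=> hrd hl hP; set z := nth y0 w rd (Ordinal hj); set A := fun m => `[< mreach st i m >].
pose cutv a : FF := (if A (cpre cl (eu a)) != A (cpre cl (ev a)) then sval z l a else 0)%R.
(* If no interval of a forbidden edge started or ended at [m], then [m.-1] and [m] would be on the
   same side and hence in the same class. *)
have brk m : A m.-1 != A m -> P m = psum z l m.
  move=> hA.
  have [a aFE hin] : exists2 a, a \in FE & inside (cinterval cl a) m.-1 != inside (cinterval cl a) m.
    apply: contrapT => no; case/eqP: hA; apply: asbool_equiv_eq.
    have hs : csame_side cl FE m.-1 m.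
      move=> a aFE; apply: contrapT => h; apply: no; exists a => //; exact/eqP.
    split=> h; apply: reach_trans h _; apply: Relation_Operators.rt_step; left => //.
    by move=> a /hs ->.
  have [aF aE] : a \in Fs /\ a \in cedges by move: aFE; rewrite !inE => /andP.
  have [] := hP (edge_data w a); first by rewrite map_f // mem_filter aE aF.
  rewrite (d_repE2 a y0 hj hrd hl) -/z !field_natK => p1 p2.
  have [hm|hm] : m = (cinterval cl a).1 \/ m = (cinterval cl a).2.
    move: hin; rewrite /inside; case: (cinterval cl a) => x1 x2 /=.
    by case: (m) => [|k] /=; rewrite ?eqxx //; lia.
  - by rewrite hm.
  - by rewrite hm.
rewrite /a_cut_value (cut_prefix (gf_char2 _) ends_cedges cpre_lt brk).
have -> : (\sum_(d <- fl) (if ((d_rep d rd j).1 < 2 ^ (La - l))%N && (A (d_pos d).1 != A (d_pos d).2)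
    then nat_field FF (nth 0%N (nth [::] (seeds_of w) rd) j) ^+ d_num d else 0)
    = \sum_(a in FE) cutv a)%R.
  rewrite big_map (seedE y0 hj hrd) -/z big_filter.
  rewrite (big_mkcond (fun a => a \in FE)) /=.
  rewrite [RHS](bigID (mem Fs)) /= [X in (_ + X)%R]big1 ?addr0; last first.
    by move=> a /negbTE aF; rewrite !inE aF.
  rewrite -big_uniq //= big_mkcond /=; apply: eq_big_seq => a aF; rewrite !inE aF /=.
  case: ifP => // aE; rewrite (d_repE1 a y0 hj hrd) -/z /cutv /sval /sampled /=.
  by rewrite andbC; case: (_ != _); case: (_ < _).
(* The forbidden edges across the cut now occur twice. *)
rewrite (bigID (mem FE)) /= addrAC.
rewrite (eq_bigl (mem FE)); last by move=> a; rewrite !inE; case: (a \in Fs) => //=; rewrite ?andbT ?andbb ?andbF.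
rewrite (addrr_pchar2 (gf_char2 _)) add0r /fingerprint -/z.
rewrite [RHS]big_mkcond [LHS]big_mkcond /=; apply: eq_bigr => a _.
rewrite !inE /sval /A; case: (a \in cedges); rewrite ?andbF //= !andbT.
by case: (a \in Fs) => //=; case: (_ != _) => //=; case: (sampled _ _ _).
Qed.

Lemma a_found_eq st rd (y0 : roundT) : rd < size w ->
  a_found c n (seeds_of w) fl st rd =
  found info_num epos (cpre cl) H eu ev info (csame_side cl FE) (2 ^ num_bits (lg n)) st (nth y0 w rd).
Proof.
move=> hrd; apply/funext => x; apply/propext; rewrite /a_found a_same_eq; split.
  move=> [hx [i [j [l [hi hj hl [P hP heq]]]]]]; split=> //.
  exists (Ordinal hi), (Ordinal hj), (Ordinal hl) => /=.
  by rewrite -(a_cut_valueE st i y0 hj hrd hl hP) -(seedE y0 hj hrd) heq.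
move=> [hx [i [[j hj] [[l hl] heq]]]]; split=> //.
exists i, j, l; split=> //; set z := nth y0 w rd (Ordinal hj) in heq.
have hP : a_consistent fl rd j l (psum z l).
  move=> d /mapP [a]; rewrite mem_filter => /andP [aE aF] ->.
  by split; rewrite (d_repE2 a y0 hj hrd hl) -/z /= field_natK.
by exists (psum z l) => //; rewrite (a_cut_valueE st i y0 hj hrd hl hP) (seedE y0 hj hrd).
Qed.

Definition cstep := boruvka_step info_num epos (cpre cl) H eu ev info (csame_side cl FE)
  (2 ^ num_bits (lg n)) (F := FF) (La := La) (K := K).
Definition cbad := bad_round info_num epos (cpre cl) H eu ev info (csame_side cl FE)
  (2 ^ num_bits (lg n)) (F := FF) (La := La) (K := K).

Lemma a_state_eq : a_state c n (seeds_of w) fl = foldl cstep (fun=> False) w.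
Proof.
case hw : w => [|y0 w']; first by move: w_size; rewrite hw.
rewrite -hw /a_state; have -> : iota 0 (lg n) = iota 0 (size w) by rewrite w_size.
rewrite -[w in RHS](mkseq_nth y0 w) /mkseq foldl_map.
have : all (fun rd => rd < size w) (iota 0 (size w)) by apply/allP => rd; rewrite mem_iota.
elim: (iota 0 (size w)) (fun _ : einfo => False) => //= rd s IH st /andP [hrd /IH ->].
by congr foldl; rewrite (a_found_eq st y0 hrd).
Qed.


Lemma card_cedges : #|cedges| < 2 ^ (2 * lg n).
Proof using e_sym e_irr v0.
have h : #|cedges| <= n * n.
  rewrite -card_prod -(card_in_imset (f := fun a => (eu a, ev a)) (D := cedges)) ?max_card //.
  by move=> a a' /cedgesP [_ _ _ h _] /cedgesP [_ _ _ h' _] [hu hv]; rewrite h h' hu hv.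
by apply: leq_ltn_trans h _; rewrite mul2n -addnn expnD ltn_mul // lg_gt.
Qed.

Lemma level_le (D : {set {set V}}) : D \subset H -> level D <= La.
Proof using e_sym e_irr v0.
move=> DH; have hD : #|D| < 2 ^ (2 * lg n).
  apply: leq_ltn_trans card_cedges; apply: subset_leq_card.
  exact: fintype.subset_trans DH (finset.subsetDl _ _).
rewrite /level /levels ltnS; have [->|D0] := posnP #|D|.
  by rewrite trunc_log0.
have /andP [h _] := trunc_log_bounds (isT : 1 < 2) D0.
by have := leq_ltn_trans h hD; rewrite ltn_exp2l.
Qed.

Lemma card_cluster_bad :
  #|[set w' : (lg n).-tuple roundT | ever_bad cstep cbad (fun=> False) w']| * 2 ^ ((c + 5) * lg n)
    <= lg n * #|roundT| ^ lg n.
Proof using e_sym e_irr e_ge1 port_size ctree.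
apply: card_ever_bad => st.
have nb : n <= 2 ^ lg n by apply: ltnW; exact: lg_gt.
have HE a : a \in H -> a \in cedges by rewrite inE => /andP [].
apply: (@card_bad_round _ _ _ _ _ _ _ _ _ _ _ _ _ _ info_num_inj _ _ _ _ (2 ^ slack c (lg n)) (half_reps c (lg n))).
- by move=> a a' /HE aE /HE; exact: info_inj.
- by move=> a /HE; exact: info_num_lt.
- exact: level_le.
- by [].
- by rewrite -!expnD card_gf leq_exp2l.
- exact: slack_mul nb.
- rewrite /half_reps (_ : (c + 6) * lg n + 1 = 1 + lg n + (c + 5) * lg n) ?expnD; last first.
    by rewrite -[6]/(1 + 5) addnCA mulnDl mul1n addnC addnA.
  exact: leq_mul (leq_mul (leqnn 2) nb) (leqnn _).
Qed.

Lemma csame_refl F j : csame_side cl F j j. Proof. by []. Qed.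
Lemma csame_sym F j j' : csame_side cl F j j' -> csame_side cl F j' j.
Proof. by move=> h a aF; rewrite h. Qed.
Lemma csame_trans F j1 j2 j3 : csame_side cl F j1 j2 -> csame_side cl F j2 j3 -> csame_side cl F j1 j3.
Proof. by move=> h1 h2 a aF; rewrite h1 // h2. Qed.

Local Notation st := (a_state c n (seeds_of w) fl).
Hypothesis w_good : ~~ ever_bad cstep cbad (fun=> False) w.

Lemma good_state : (forall x, st x -> exists2 a, a \in H & x = info a) /\
  forall a, a \in H -> mreach st (cpre cl (eu a)) (cpre cl (ev a)).
Proof.
rewrite a_state_eq.
have HE a : a \in H -> a \in cedges by rewrite inE => /andP [].
apply: (@boruvka_complete _ _ _ _ Y _ _ _ _ _ _ _ _ _ _ cpre_lt _ _ info_num_inj _ _ (lg n)) => //.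
- by move=> a /HE /cedgesP [].
- by move=> a /HE; exact: info_num_lt.
- exact: csame_sym.
- exact: level_le.
- exact: lg_gt.
Qed.

Lemma eswapK : involutive eswap. Proof. by case. Qed.
Lemma epos_eswap x : epos (eswap x) = ((epos x).2, (epos x).1). Proof. by []. Qed.

Definition avoid : rel V := fun u v => e u v && ([set u; v] \notin Fs).

(** Every edge of the walk survives and lies in the cluster, so completeness of the Boruvka rounds
    links its ends; few representatives then allow a chain of at most [size Fs] edges. *)
Lemma chain_exists s t p : s \in Y -> path (induced avoid Y) s p -> last s p = t ->
  t \in Y /\ exists2 es, chain epos eswap (a_same fl) st (cpre cl s) es (cpre cl t) & size es <= size Fs.
Proof.
move=> sY hp lp; have [snd cpl] := good_state.
have [tY hr] : t \in Y /\ mreach st (cpre cl s) (cpre cl t).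
  elim: p s sY hp lp => [|v p IH] s sY /=; first by move=> _ <-; split=> //; exact: reach_refl.
  move=> /andP [/and3P [/andP [esv nF] _ vY] hp] lp; have [tY hr] := IH v vY hp lp.
  split=> //; apply: reach_trans hr.
  have aE := mem_cedges esv sY vY.
  have aH : [set s; v] \in H by rewrite !inE (negbTE nF).
  have [h1 h2 h3 h4 _] := cedgesP aE; have hr1 := cpl _ aH.
  have hr2 : mreach st (cpre cl (ev [set s; v])) (cpre cl (eu [set s; v])).
    by apply: reach_sym hr1; exact: csame_sym.
  have sv : s != v by apply: contraTneq esv => ->; rewrite e_irr.
  have : s \in [set eu [set s; v]; ev [set s; v]] by rewrite -h4 set21.
  have : v \in [set eu [set s; v]; ev [set s; v]] by rewrite -h4 set22.
  rewrite !inE => /orP [] /eqP hv /orP [] /eqP hs.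
  - by rewrite -hv in hs; rewrite hs eqxx in sv.
  - by move: hr2; rewrite -hs -hv.
  - by move: hr1; rewrite -hs -hv.
  - by rewrite -hv in hs; rewrite hs eqxx in sv.
split=> //; rewrite a_same_eq.
have [es hes] := reach_chain epos_eswap eswapK (csame_refl (F := FE)) (@csame_trans FE) hr.
have [top [tops [ht hT hTY hTs]]] := few_sides T FE.
have hFE : #|tops| <= (size Fs).+1.
  apply: leq_trans ht _; rewrite ltnS; apply: leq_trans (card_size Fs).
  by apply: subset_leq_card; apply/fintype.subsetP => a; rewrite inE => /andP [].
apply: (chain_short epos_eswap (@csame_sym FE) (@csame_trans FE) hFE hT hTs _ sY tY hes).
move=> x /snd [a aH ->]; have /cedgesP [h1 h2 _ _ _] : a \in cedges by move: aH; rewrite inE => /andP [].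
by exists (eu a), (ev a).
Qed.

Lemma chain_wp_size es j j' x : chain epos eswap (a_same fl) st j es j' -> x \in es ->
  size (enc x.1) <= wp_bits (lg n).
Proof.
have [snd _] := good_state; elim: es j => // y es IH j /= [hy _ hc].
rewrite inE => /orP [/eqP ->|xes]; last exact: IH hc xes.
have HE a : a \in H -> a \in cedges by rewrite inE => /andP [].
case: hy => /snd [a /HE /cedgesP [uY vY _ _ _] hy].
  by rewrite hy; apply: size_enc_wp => //; exact: port_lt.
have -> : y = eswap (info a) by rewrite -hy eswapK.
by apply: size_enc_wp => //; exact: port_lt.
Qed.

(** * Simulation of the forwarding by waypoints *)

Section Hops.
Variables (tb : V -> bits) (tl : bits) (i : nat).
Hypothesis tbP : forall x, x \in Y -> lookup i (dec _ vlab0 (tb x) : vlab).2 = vertex_data x.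

Inductive hops : bits -> V -> seq V -> bits -> V -> Prop :=
| hops0 h u : hops h u [::] h u
| hopsS h u k h1 v p h2 x : route_step h tl (tb u) = Some (k, h1) -> onth (port u) k = Some v ->
    hops h1 v p h2 x -> hops h u (v :: p) h2 x.

Lemma hops_cat h u p h1 v q h2 x : hops h u p h1 v -> hops h1 v q h2 x -> hops h u (p ++ q) h2 x.
Proof. by elim=> // *; apply: hopsS; eauto. Qed.

Lemma enc_header_cons (h : header) : exists a s, enc h = a :: s.
Proof.
have : 0 < size (enc h) by rewrite size_enc_pair addn_gt0; case: (h.2) => *; rewrite orbT.
by case: (enc h) => // a s; exists a, s.
Qed.

Lemma route_stepE (wp : waypoint) ws x : x \in Y ->
  route_step (enc ((i, wp :: ws) : header)) tl (tb x) =
  if wp.1.1 == cpre cl x then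
    if ws is [::] then None else Some (wp.2, enc ((i, ws) : header))
  else Some (hop (cpre cl x, cout cl x) (cports cl port x) wp.1, enc ((i, wp :: ws) : header)).
Proof using tbP.
move=> xY; set h : header := (i, wp :: ws); have [a [s hs]] := enc_header_cons h.
have hsz : size (enc ((i, ws) : header)) <= size (enc h).
  by rewrite !size_enc_pair leq_add2l /= size_cat; exact: leqW (leq_addl _ _).
rewrite /route_step {1}hs; rewrite -/(route_step _ _ _) encK /= tbP //=.
by case: ifP => // _; case: ws h hs hsz => // w' ws h hs ->.
Qed.

Lemma segment_hops wp ws u v p : wp.1 = (cpre cl v, clights cl port v) -> v \in Y ->
  path (hop_rel e cl port FE v) u p -> last u p = v ->
  hops (enc ((i, wp :: ws) : header)) u p (enc ((i, wp :: ws) : header)) v.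
Proof.
move=> hwp vY; elim: p u => [|x p IH] u /=; first by move=> _ ->; exact: hops0.
move=> /andP [/and5P [_ _ uY xY /andP [uv /eqP ho]] hp] lp.
apply: hopsS (IH _ hp lp); last by rewrite -hwp in ho; exact: ho.
rewrite route_stepE // hwp /=; case: eqP => // /(cpre_inj vY uY) huv.
by rewrite huv eqxx in uv.
Qed.

Variable rho : R.
Hypothesis e_rho : forall u v, e u v -> (weight G [set u; v] <= rho)%R.

Lemma segment_avoid v u p : path (hop_rel e cl port FE v) u p -> path avoid u p.
Proof.
apply: sub_path => x y /and5P [exy nF xY yY _].
by rewrite /avoid exy /=; move: nF; rewrite inE mem_cedges // andbT.
Qed.

(** One tree segment, at most [2 B] long, before each crossing edge and one after the last; every
    crossing edge weighs at most [rho]. *)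
Lemma chain_hops es s t (last_wp := wp_of t 0) : s \in Y -> t \in Y ->
  chain epos eswap (a_same fl) st (cpre cl s) es (cpre cl t) ->
  exists p, [/\ hops (enc ((i, rcons [seq x.1 | x <- es] last_wp) : header)) s p
                     (enc ((i, [:: last_wp]) : header)) t,
     path avoid s p, last s p = t
   & (walk_length G s p <= (size es).+1%:R * (2 * B) + (size es)%:R * rho)%R].
Proof.
rewrite a_same_eq => sY tY; have [snd _] := good_state.
have seg u v wp ws : u \in Y -> v \in Y -> csame_side cl FE (cpre cl u) (cpre cl v) ->
    wp.1 = (cpre cl v, clights cl port v) ->
    exists p, [/\ hops (enc ((i, wp :: ws) : header)) u p (enc ((i, wp :: ws) : header)) v,
      path avoid u p, last u p = v & (walk_length G u p <= 2 * B)%R].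
  move=> uY vY ss hwp; have [p [hp lp lenp]] := segment e_ge1 ctree e_port e_sym uY vY ss.
  exists p; split=> //; [exact: segment_hops|exact: segment_avoid hp|].
  have := cdist_bounds ctree uY; have := cdist_bounds ctree vY; lra.
elim: es s sY => [|x es IH] s sY /=.
  move=> ss; have [p [h1 h2 h3 h4]] := seg s t last_wp [::] sY tY ss erefl.
  by exists p; split=> //; rewrite mul1r mul0r addr0.
move=> [hx ss hc].
have [u1 [v1 [[uY vY euv nF] [hx1 hx2]]]] : exists u1 v1,
    [/\ u1 \in Y, v1 \in Y, e u1 v1 & [set u1; v1] \notin Fs] /\
    (x.1 = wp_of u1 (index v1 (port u1)) /\ (epos x).2 = cpre cl v1).
  have ends a : a \in H -> [/\ eu a \in Y, ev a \in Y, e (eu a) (ev a) & [set eu a; ev a] \notin Fs].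
    rewrite !inE => /andP [nF aE]; have [h1 h2 h3 h4 h5] := cedgesP aE.
    by rewrite aE andbT in nF; rewrite -h4.
  case: hx => /snd [a aH hx]; have [h1 h2 h3 h4] := ends a aH.
    by exists (eu a), (ev a); rewrite hx.
  have -> : x = eswap (info a) by rewrite -hx eswapK.
  by exists (ev a), (eu a); rewrite e_sym finset.setUC.
rewrite /epos /= in hx2; rewrite hx1 /= in ss; rewrite hx2 in hc.
have [p1 [h1 h2 h3 h4]] := seg s u1 x.1 (rcons [seq x.1 | x <- es] last_wp) sY uY ss (congr1 fst hx1).
have [p2 [g1 g2 g3 g4]] := IH v1 vY hc.
exists (p1 ++ v1 :: p2); rewrite last_cat cat_path walk_length_cat h3 /=; split=> //.
- apply: hops_cat h1 _; apply: hopsS g1.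
    rewrite route_stepE // hx1 /= eqxx; by case: (es).
  by apply: onth_index; exact: e_port.
- by rewrite h2 g2 /avoid euv nF.
have hr := e_rho euv; rewrite -!natr1; nra.
Qed.

End Hops.
End Query.
End Cluster.

(** * The scheme for a list of clusters *)

Lemma filter_iota_eq N i (P : pred nat) : i < N ->
  [seq j <- iota 0 N | P j & j == i] = if P i then [:: i] else [::].
Proof.
move=> iN; rewrite (eq_filter (a2 := predI P (pred1 i))) //.
by rewrite filter_predI filter_pred1_uniq ?iota_uniq ?mem_iota.
Qed.

Lemma path_and (T : Type) (e1 e2 : rel T) x p :
  path e1 x p -> path e2 x p -> path (fun u v => e1 u v && e2 u v) x p.
Proof. by elim: p x => //= y p IH x /andP [-> /IH h] /andP [-> /h]. Qed.

Section Scheme.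
Variables (R : realType) (V : finType) (G : wgraph R V) (port : V -> seq V) (v0 : V) (c k : nat).
Local Notation n := #|V|.
Local Notation b := (lg n).
Local Notation FF := (field_of c n).
Local Notation roundT := (round V FF (levels b) (reps c b)).

(** Discarding heavier edges is harmless for walks of length at most [2^i], and it bounds the edges
    that join two tree segments. *)
Definition scale_rel (i : nat) : rel V :=
  fun u v => adj G u v && (weight G [set u; v] <= 2 ^+ i)%R.

Variable CL : seq (nat * tcluster R V).
Local Notation clu i := (nth (0, ([set v0], v0, [ffun v => v], [ffun=> 0%R])) CL i).
Local Notation rel_ i := (scale_rel (clu i).1).
Local Notation E_ i := (cedges (rel_ i) (clu i).2).

Definition vlab_of (w : seq roundT) (u : V) : vlab :=
  (n, enum_rank u : nat, seeds_of w,
   [seq (i, vertex_data port (clu i).2 u) | i <- iota 0 (size CL) & u \in cset (clu i).2]).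

Definition elab_of (w : seq roundT) (a : {set V}) : elab :=
  [seq (i, edge_data port v0 (rel_ i) (clu i).2 w a) | i <- iota 0 (size CL) & a \in E_ i].

Definition scheme (w : seq roundT) : routing_data V :=
  RoutingData (fun u => enc (vlab_of w u)) (fun a => enc (elab_of w a)) (fun u => enc (vlab_of w u)).

Lemma lookup_vlab w u i : i < size CL -> u \in cset (clu i).2 ->
  lookup i (vlab_of w u).2 = vertex_data port (clu i).2 u.
Proof.
move=> iC uY; rewrite /lookup /vlab_of /= filter_map -filter_predI.
rewrite (eq_filter (a2 := fun j => (u \in cset (clu j).2) && (j == i))); last by move=> j /=; rewrite andbC.
by rewrite filter_iota_eq // uY.
Qed.

Lemma mem_vlab w u i d : (i, d) \in (vlab_of w u).2 ->
  [/\ i < size CL, u \in cset (clu i).2 & d = vertex_data port (clu i).2 u].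
Proof.
by move=> /mapP [j]; rewrite mem_filter mem_iota add0n => /and3P [uY _ jC] [-> ->].
Qed.

Lemma mem_vlabI w u i : i < size CL -> u \in cset (clu i).2 ->
  (i, vertex_data port (clu i).2 u) \in (vlab_of w u).2.
Proof. by move=> iC uY; apply/mapP; exists i; rewrite // mem_filter uY mem_iota. Qed.

Lemma select_elab w (Fs : seq {set V}) i : i < size CL ->
  select [seq elab_of w a | a <- Fs] i =
  [seq edge_data port v0 (rel_ i) (clu i).2 w a | a <- Fs & a \in E_ i].
Proof.
move=> iC; rewrite /select; elim: Fs => //= a Fs IH; rewrite filter_cat map_cat IH.
rewrite /elab_of filter_map -filter_predI.
rewrite (eq_filter (a2 := fun j => (a \in E_ j) && (j == i))); last by move=> j /=; rewrite andbC.
by rewrite filter_iota_eq //; case: ifP.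
Qed.

Definition bad_at (Fs : seq {set V}) (i : nat) (w : seq roundT) : bool :=
  ever_bad (cstep port v0 (c := c) (rel_ i) (clu i).2 Fs) (cbad port v0 (c := c) (rel_ i) (clu i).2 Fs)
    (fun=> False) w.

Definition good_coins (Fs : seq {set V}) (w : seq roundT) : Prop :=
  forall i, i < size CL -> ~~ bad_at Fs i w.

Hypothesis w_ge1 : forall u v, adj G u v -> (1 <= weight G [set u; v])%R.
Hypothesis portP : port_numbering G port.
Hypothesis CL_tree : forall x, x \in CL ->
  tree_cluster G (scale_rel x.1) ((2 * k%:R - 1) * 2 ^+ x.1)%R x.2.
Hypothesis CL_size : size CL <= 2 ^ (4 * b).

Lemma scale_rel_sym i : symmetric (scale_rel i).
Proof. by move=> u v; rewrite /scale_rel adj_sym finset.setUC. Qed.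

Lemma scale_rel_irr i : irreflexive (scale_rel i).
Proof. by move=> u; rewrite /scale_rel adj_irr. Qed.

Lemma scale_rel_ge1 i : heavy_enough G (scale_rel i).
Proof. by move=> u v /andP [/w_ge1]. Qed.

Lemma scale_rel_port i u v : scale_rel i u v -> v \in port u.
Proof. by move=> /andP [uv _]; have [_ ->] := portP u. Qed.

Lemma port_size u : size (port u) <= n.
Proof. by have [/card_uniqP <- _] := portP u; exact: max_card. Qed.

Lemma clu_tree i : i < size CL ->
  tree_cluster G (rel_ i) ((2 * k%:R - 1) * 2 ^+ (clu i).1)%R (clu i).2.
Proof. by move=> iC; apply: CL_tree; exact: mem_nth. Qed.

(** The union over at most [2^(4b)] clusters and [b <= 2^b] rounds uses up the [5 b] in the exponent
    [(c+5) b]. *)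
Lemma card_bad_coins (Fs : seq {set V}) :
  #|[set w : b.-tuple roundT | [exists i : 'I_(size CL), bad_at Fs i w]]| * 2 ^ (c * b)
    <= #|{: b.-tuple roundT}|.
Proof.
have h (i : 'I_(size CL)) :
    #|[set w : b.-tuple roundT | bad_at Fs i w]| * 2 ^ ((c + 5) * b) <= b * #|roundT| ^ b.
  exact: (card_cluster_bad v0 c (scale_rel_sym _) (scale_rel_irr _) (@scale_rel_ge1 _) port_size
           (clu_tree (ltn_ord i)) Fs).
have := cards_bigcup_le h; rewrite card_ord card_tuple.
have -> : \bigcup_(i : 'I_(size CL)) [set w : b.-tuple roundT | bad_at Fs i w] =
    [set w : b.-tuple roundT | [exists i : 'I_(size CL), bad_at Fs i w]].
  apply/setP => w; rewrite inE; apply/bigcupP/existsP.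
    by move=> [i _]; rewrite inE; exists i.
  by move=> [i hi]; exists i => //; rewrite inE.
set x := #|_|; rewrite (_ : (c + 5) * b = c * b + 5 * b); last by rewrite mulnDl.
have hb : b <= 2 ^ b by apply: ltnW; exact: ltn_expl.
have h5 : size CL * b <= 2 ^ (5 * b).
  by apply: leq_trans (leq_mul CL_size hb) _; rewrite -expnD leq_exp2l //; lia.
rewrite expnD mulnA mulnA => hx.
have p5 : 0 < 2 ^ (5 * b) by rewrite expn_gt0.
rewrite -(leq_pmul2r p5); apply: leq_trans hx _.
by rewrite mulnC leq_mul2l h5 orbT.
Qed.

Lemma route_step_size h t s i h' : route_step h t s = Some (i, h') -> size h' <= size h.
Proof.
rewrite /route_step; case: h => // a h; set H := _ :: _.
case: (dec _ _ H : header) => i0 [|wp ws] //=; case: ifP => _; last by case=> _ <-.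
by case: ws => // w1 ws; case: ifP => // hs [_ <-].
Qed.

Lemma message_size (A := algorithm c) S s t Fs p u h : message_at A port S s t Fs p u h ->
  size h <= size (initial_header A S s t Fs).
Proof.
elim=> // {}p {}u h0 i h' v _ IH hs _; exact: leq_trans (route_step_size hs) IH.
Qed.

Section Delivery.
Variables (w : seq roundT) (w_size : size w = b) (s t : V).
Variables (F : {set {set V}}) (Fs : seq {set V}).
Hypothesis FFs : perm_eq Fs (enum F).
Local Notation Sw := (scheme w).
Local Notation A := (algorithm c).

Lemma initial_header_size : size (initial_header A Sw s t Fs) <= header_bound n (size Fs).+1.
Proof.
rewrite /initial_header /= /route_init /= !encK; case: ifP => // _.
by rewrite size_map; case: ifP.
Qed.

Lemma Fs_uniq : uniq Fs. Proof. by rewrite (perm_uniq FFs) enum_uniq. Qed.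
Lemma Fs_size : size Fs = #|F|. Proof. by rewrite (perm_size FFs) cardE. Qed.
Lemma mem_Fs a : (a \in Fs) = (a \in F). Proof. by rewrite (perm_mem FFs) mem_enum. Qed.

Lemma hops_message p0 u0 h0 u h p h' v : message_at A port Sw s t Fs p0 u0 h0 ->
  u = u0 -> h = h0 ->
  hops port (fun u => enc (vlab_of w u)) (enc (vlab_of w t)) h u p h' v ->
  message_at A port Sw s t Fs (p0 ++ p) v h'.
Proof.
move=> hm eu eh hh; elim: hh p0 u0 h0 hm eu eh => [h1 u1|h1 u1 j h2 u2 q h3 u3 h4 h5 _ IH] p0 u0 h0 hm eu eh.
  by rewrite cats0 eu eh.
rewrite -cat_rcons; apply: IH (erefl _) (erefl _).
by rewrite -eu -eh in hm; exact: message_hop hm h4 h5.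
Qed.

Hypotheses (good : good_coins Fs w) (k_gt0 : 0 < k).

(** Cluster [j] only guarantees that the search succeeds. The header chosen may belong to an earlier
    cluster [i], whose coins are good as well, so its chain consists of genuine edges and
    delivers. *)
Lemma cluster_delivers j p : s != t -> j < size CL -> s \in cset (clu j).2 ->
  path (induced (avoid (rel_ j) Fs) (cset (clu j).2)) s p -> last s p = t ->
  exists p' i, [/\ i <= j, i < size CL, delivered_along A port Sw s t Fs p',
     path (adj_minus G F) s p'
   & (walk_length G s p' <= (#|F|%:R + 1) * (4 * k%:R - 1) * 2 ^+ (clu i).1)%R].
Proof.
move=> st jC sY hp lp.
set Fl := [seq elab_of w a | a <- Fs]; set sl := vlab_of w s; set tl := vlab_of w t.
have sizeFl : size Fl = size Fs by rewrite size_map.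
have ex : exists h, valid_header c Fl tl sl h /\ h.1 = j.
  have [tY [es hes ses]] := chain_exists (scale_rel_sym _) (scale_rel_irr _)
     (@scale_rel_ge1 _) port_size (clu_tree jC) Fs_uniq w_size (good jC) sY hp lp.
  exists (j, rcons [seq x.1 | x <- es] (cpre (clu j).2 t, clights (clu j).2 port t, 0)); split=> //.
  exists (vertex_data port (clu j).2 s), (vertex_data port (clu j).2 t), es.
  by rewrite sizeFl select_elab //; split=> //; exact: mem_vlabI.
have exb : exists h, best_header c Fl tl sl h.
  have ex' : exists m, `[< exists h, valid_header c Fl tl sl h /\ h.1 = m >].
    by exists j; apply/asboolP.
  case: (ex_minnP ex') => m /asboolP [h [h1 h2]] hm; exists h; split=> // h' h1'.
  by rewrite h2; apply: hm; apply/asboolP; exists h'.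
have := choose_orP ((0, [::]) : header) exb.
set hd := choose_or _ _ => -[hv hmin].
have hdj : hd.1 <= j by have [h' [h1 <-]] := ex; exact: hmin.
have [sd [td [es [h1 h2 h3 h4 h5]]]] := hv.
have [iC sY' sdE] := mem_vlab h1; have [_ tY' tdE] := mem_vlab h2.
rewrite select_elab // sdE tdE /= in h4.
set i := hd.1 in h1 h2 h4 iC sY' tY' sdE tdE hdj.
have tbP x : x \in cset (clu i).2 ->
    lookup i (dec _ vlab0 (enc (vlab_of w x)) : vlab).2 = vertex_data port (clu i).2 x.
  by move=> xY; rewrite encK lookup_vlab.
have e_rho u v : rel_ i u v -> (weight G [set u; v] <= 2 ^+ (clu i).1)%R by move=> /andP [].
have rho0 : (0 <= 2 ^+ (clu i).1 :> R)%R by exact: exprn_ge0.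
have [q [q1 q2 q3 q4]] := chain_hops (scale_rel_sym _) (scale_rel_irr _)
     (@scale_rel_ge1 _) (@scale_rel_port _) port_size (clu_tree iC) Fs_uniq w_size (good iC)
     (enc tl) tbP e_rho sY' tY' h4.
have hdE : hd = (i, rcons [seq x.1 | x <- es] (wp_of port (clu i).2 t 0)).
  by rewrite [hd]surjective_pairing h5 tdE.
have sth : initial_header A Sw s t Fs = enc hd.
  rewrite /initial_header /= /route_init /= !encK.
  have -> : [seq dec _ [::] x | x <- [seq enc (elab_of w e) | e <- Fs]] = Fl.
    by rewrite -map_comp; apply: eq_map => a /=; rewrite encK.
  rewrite -/sl -/tl -/hd size_map ifF; last first.
    by apply/negbTE; apply: contra st => /eqP /val_inj /enum_rank_inj ->.
  (* The size test is passed: the chain has at most [size Fs] edges, so there are at most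
     [(size Fs).+1] waypoints. *)
  rewrite ifT // size_enc_pair leq_add //.
    by apply: leq_trans (size_enc_nat (l := 4 * b) _) _; [exact: leq_trans iC CL_size|rewrite -mul2n mulnA].
  apply: leq_trans (size_enc_seq_le (m := wp_bits b) _) _; last first.
    by rewrite hdE size_rcons size_map ltnS leq_mul2r ltnS -sizeFl h3 orbT.
  move=> x; rewrite hdE /= mem_rcons inE => /orP [/eqP ->|/mapP [y yes ->]].
    by apply: (size_enc_wp (@scale_rel_ge1 _) port_size (clu_tree iC)) => //; rewrite expn_gt0.
  exact: (chain_wp_size (scale_rel_sym _) (scale_rel_irr _)
     (@scale_rel_ge1 _) port_size (clu_tree iC) Fs_uniq w_size (good iC) h4 yes).
exists q, i; split=> //.
- exists (enc ((i, [:: wp_of port (clu i).2 t 0]) : header)); split.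
    rewrite -[q]cat0s; apply: hops_message (message_start _ _ _ _ _ _) (erefl _) (esym sth) _.
    by rewrite hdE.
  rewrite [alg_step _ _ _ _](route_stepE _ tbP) //= eqxx //.
- by apply: sub_path q2 => x y /andP [/andP [h6 _]]; rewrite mem_Fs /adj_minus /= h6 => ->.
apply: le_trans q4 _; rewrite -Fs_size; have : ((size es)%:R <= (size Fs)%:R :> R)%R by rewrite ler_nat -sizeFl.
have k1 : (1 <= k%:R :> R)%R by rewrite ler1n.
rewrite -natr1 -/i; move: rho0 k1; move: ((size es)%:R)%R ((size Fs)%:R)%R (2 ^+ _)%R (k%:R)%R => x y z K z0 K1 xy.
(* The bound is [(x+1) (4K-2) z + x z] with at most [y] crossing edges, where [z] is the scale; this
   is at most [(y+1) (4K-1) z]. *)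
rewrite -subr_ge0 (_ : _ - _ = (y - x) * ((4 * K - 1) * z) + z)%R; last by ring.
by rewrite addr_ge0 // !mulr_ge0 //; lra.
Qed.

End Delivery.
End Scheme.

(** * Clusters for all relevant scales *)

Section Scales.
Variable R : realType.

Definition iexp (x : R) : nat :=
  choose_or 0 (fun i => (x <= 2 ^+ i)%R /\ forall j, (x <= 2 ^+ j)%R -> i <= j).

Lemma iexpP (x : R) : (x <= 2 ^+ iexp x)%R /\ forall j, (x <= 2 ^+ j)%R -> iexp x <= j.
Proof.
apply: (choose_orP 0 (P := fun i => (x <= 2 ^+ i)%R /\ forall j, (x <= 2 ^+ j)%R -> i <= j)).
have ex : exists i, (x <= 2 ^+ i)%R.
  exists (Num.bound x); have [x0|x0] := ltP x 0%R; first by rewrite (le_trans (ltW x0)) // exprn_ge0.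
  apply: le_trans (ltW (archi_boundP x0)) _.
  by rewrite -natrX ler_nat ltnW // ltn_expl.
by case: (ex_minnP ex) => i h1 h2; exists i.
Qed.
End Scales.

Section ClusterList.
Variables (R : realType) (V : finType) (G : wgraph R V) (W : R).
Local Notation n := #|V|.
Local Notation b := (lg n).
Hypothesis wW : weights_in G W.

Lemma mem_edges u v : adj G u v -> [set u; v] \in edges G.
Proof.
by move=> h; rewrite inE; apply/existsP; exists u; apply/existsP; exists v; rewrite h eqxx.
Qed.

Lemma adj_ge1 u v : adj G u v -> (1 <= weight G [set u; v])%R.
Proof. by move=> /mem_edges /wW /andP []. Qed.

Lemma card_edges : #|edges G| <= 2 ^ (2 * b).
Proof.
have h : #|edges G| <= n * n.
  rewrite -card_prod; apply: leq_trans (leq_imset_card (fun p : V * V => [set p.1; p.2]) predT).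
  apply: subset_leq_card; apply/fintype.subsetP => a; rewrite inE => /existsP [u /existsP [v /andP [_ /eqP ->]]].
  by apply/imsetP; exists (u, v).
by apply: leq_trans h _; rewrite mul2n -addnn expnD leq_mul // ltnW // lg_gt.
Qed.

(** Two counts are needed: through [iexp W] the number of scales enters label sizes with a factor
    [log W]; through the edges it is at most [2^(3b)] whatever [W] is, which keeps [W] out of the
    header. *)
Definition candidates : seq nat :=
  [seq iexp (weight G a) + j | a <- enum (edges G), j <- iota 0 b.+1].

Definition scales : seq nat := [seq i <- iota 0 (iexp W + b).+1 | i \in candidates].

Lemma mem_scales a i : a \in edges G -> iexp (weight G a) <= i <= iexp (weight G a) + b -> i \in scales.
Proof.
move=> aE /andP [h1 h2]; rewrite mem_filter mem_iota; apply/andP; split.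
  apply/allpairsP; exists (a, i - iexp (weight G a)).
  by rewrite [(_, _).1]/= [(_, _).2]/= mem_enum mem_iota subnKC //; split=> //; lia.
have : iexp (weight G a) <= iexp W.
  by apply: (iexpP _).2; apply: le_trans (iexpP W).1; have /andP [] := wW aE.
lia.
Qed.

Lemma size_scales : size scales <= (iexp W + b).+1.
Proof. by rewrite size_filter (leq_trans (count_size _ _)) // size_iota. Qed.

Lemma size_scales2 : size scales <= 2 ^ (3 * b).
Proof.
have h : size scales <= size candidates.
  apply: uniq_leq_size; first by rewrite filter_uniq ?iota_uniq.
  by move=> i; rewrite mem_filter => /andP [].
apply: leq_trans h _; rewrite size_allpairs size_iota -cardE.
have hb : b.+1 <= 2 ^ b by rewrite ltn_expl.
by apply: leq_trans (leq_mul card_edges hb) _; rewrite -expnD leq_exp2l //; lia.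
Qed.

Lemma sorted_scales : sorted leq scales.
Proof. by apply: sorted_filter; [exact: leq_trans|exact: iota_sorted]. Qed.

Lemma cluster_list_exists (k q : nat) : 0 < k -> 0 < q -> n <= q ^ k -> exists CL : seq (nat * tcluster R V),
  [/\ forall x, x \in CL -> tree_cluster G (scale_rel G x.1) ((2 * k%:R - 1) * 2 ^+ x.1)%R x.2,
      sorted leq [seq x.1 | x <- CL], size CL <= 2 ^ (4 * b),
      forall u, count (fun x => u \in cset x.2) CL <= (iexp W + b).+1 * (q * b)
    & forall i s, i \in scales -> exists2 c, (i, c) \in CL
        & ball G (scale_rel G i) (2 ^+ i)%R s \subset cset c].
Proof.
move=> k_gt0 q_gt0 nqk; have /choice [cov hcov] : forall i, exists cs : seq (tcluster R V),
  [/\ forall c : tcluster R V, c \in cs -> tree_cluster G (scale_rel G i) ((2 * k%:R - 1) * 2 ^+ i)%R c,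
      forall u, exists2 c : tcluster R V, c \in cs & ball G (scale_rel G i) (2 ^+ i)%R u \subset cset c,
      forall x, count (fun c => x \in cset c) cs <= q * b
    & size cs <= n].
  move=> i; apply: sparse_cover => //; last exact: lg_gt.
  - by move=> u v; rewrite /scale_rel adj_sym finset.setUC.
  - by move=> u v /andP [/adj_ge1].
pose cl s := flatten [seq [seq (i, c) | c <- cov i] | i <- s].
have mem_cl s i c : (i, c) \in cl s = (i \in s) && (c \in cov i).
  apply/flatten_mapP/andP => [[j js /mapP [c' hc [-> ->]]]|[h1 h2]] //.
  by exists i => //; apply/mapP; exists c.
have size_cl s : size (cl s) <= size s * n.
  elim: s => //= i s IH; rewrite size_cat size_map mulSn leq_add //.
  by have [_ _ _] := hcov i.
have count_cl s u : count (fun x => u \in cset x.2) (cl s) <= size s * (q * b).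
  elim: s => //= i s IH; rewrite count_cat count_map mulSn leq_add //.
  by have [_ _ h _] := hcov i; exact: h.
exists (cl scales); split.
- by case=> i c; rewrite mem_cl => /andP [_ hc]; have [h _ _ _] := hcov i; exact: h.
- move: sorted_scales; rewrite !(sorted_pairwise leq_trans); elim: scales => //= i s IH /andP [hi /IH h].
  rewrite map_cat pairwise_cat h andbT -map_comp; apply/andP; split.
    apply/allrelP => x y /mapP [c _ ->] /mapP [[j c']]; rewrite mem_cl => /andP [js _] -> /=.
    by move/allP: hi; exact.
  rewrite (eq_map (g := fun=> i)) //; elim: (cov i) => //= c cs ->; rewrite andbT.
  by apply/allP => x /mapP [c' _ ->].
- apply: leq_trans (size_cl _) _; apply: leq_trans (leq_mul size_scales2 (ltnW (lg_gt n))) _.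
  by rewrite -expnD leq_exp2l //; lia.
- by move=> u; apply: leq_trans (count_cl _ _) _; rewrite leq_mul2r size_scales orbT.
- move=> i s hi; have [_ h _ _] := hcov i; have [c hc hb] := h s.
  by exists c => //; rewrite mem_cl hi.
Qed.

(** * Distances *)

Variable F : {set {set V}}.
Local Notation len := (walk_length G).
Local Notation aF := (adj_minus G F).

Lemma adj_minus_ge1 : heavy_enough G aF.
Proof. by move=> u v /andP [/adj_ge1]. Qed.

Lemma dist_le s t p : path aF s p -> last s p = t -> (dist_minus G F s t <= len s p)%R.
Proof.
move=> hp lp; apply: ge_inf; last by exists p.
by exists 0%R => _ [p' [h1 _ ->]]; exact: walk_length_ge0 adj_minus_ge1 _ _ h1.
Qed.

Lemma dist_ge s t (x : R) : connect aF s t ->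
  (forall p, path aF s p -> last s p = t -> (x <= len s p)%R) -> (x <= dist_minus G F s t)%R.
Proof.
move=> /connectP [p0 hp0 lp0] h; apply: lb_le_inf; first by exists (len s p0), p0.
by move=> _ [p [h1 h2 ->]]; exact: h.
Qed.

Lemma walk_length_le (e : rel V) s p (x : R) : (forall u v, e u v -> (weight G [set u; v] <= x)%R) ->
  path e s p -> (len s p <= (size p)%:R * x)%R.
Proof.
move=> h; elim: p s => [|v p IH] s /=; first by rewrite mul0r.
by move=> /andP [/h hs /IH hp]; rewrite -natr1 mulrDl mul1r addrC lerD.
Qed.

Lemma walk_edge_le (e : rel V) s p (x : R) : heavy_enough G e -> path e s p -> (len s p <= x)%R ->
  path (fun u v => e u v && (weight G [set u; v] <= x)%R) s p.
Proof.
move=> h; elim: p s => //= v p IH s /andP [sv hp] hx; rewrite sv /=.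
have h1 := walk_length_ge0 h hp; have h2 := h _ _ sv.
by rewrite IH ?andbT //; lra.
Qed.

(** The scale is the least power of two above the distance, so at most twice the distance. It is
    relevant: otherwise all edges of a short simple walk would be lighter than it by more than a
    factor [n], and the walk shorter than the distance. *)
Lemma scale_for_query s t : s != t -> connect aF s t ->
  exists i p, [/\ i \in scales, path aF s p, last s p = t, (len s p <= 2 ^+ i)%R
    & (2 ^+ i <= 2 * dist_minus G F s t)%R].
Proof.
move=> st cst; set d := dist_minus G F s t.
have d1 : (1 <= d)%R.
  apply: dist_ge cst _ => -[|v p] /=; first by move=> _ h; rewrite h eqxx in st.
  move=> /andP [sv hp] _; have := adj_minus_ge1 sv; have := walk_length_ge0 adj_minus_ge1 hp; lra.
have ex : exists i, (d < 2 ^+ i)%R.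
  exists (iexp d).+1; apply: le_lt_trans (iexpP d).1 _; rewrite exprS ltr_pMl ?exprn_gt0 //; lra.
case: (ex_minnP ex) => -[|i] hi imin; first by move: hi; rewrite expr0; lra.
have di : (2 ^+ i <= d)%R.
  by rewrite leNgt; apply/negP => /imin; rewrite ltnn.
(* The distance is an infimum; the strict inequality with the scale yields an actual walk below
   it. *)
have [p0 [h1 h2 h3]] : exists p, [/\ path aF s p, last s p = t & (len s p < 2 ^+ i.+1)%R].
  apply: contrapT => no; have := hi; rewrite ltNge => /negP; apply; apply: dist_ge cst _ => p hp lp.
  by rewrite leNgt; apply/negP => hl; apply: no; exists p.
have [p [hp lp Up len_p]] := walk_shorten adj_minus_ge1 h1; rewrite h2 in lp.
have len_p' : (len s p <= 2 ^+ i.+1)%R by exact: le_trans len_p (ltW h3).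
exists i.+1, p; split=> //; last by rewrite exprS; lra.
have hw := walk_edge_le adj_minus_ge1 hp len_p'.
apply: contrapT => /negP nsc.
(* An edge of weight at most [2^i.+1] would make the scale relevant unless its exponent plus [b] is
   at most [i]. *)
have hsmall u v : aF u v && (weight G [set u; v] <= 2 ^+ i.+1)%R -> (weight G [set u; v] * 2 ^+ b <= 2 ^+ i)%R.
  move=> /andP [/andP [uv _] hle]; set x := weight G _ in hle *.
  have [x1 x2] := iexpP x; have h4 := x2 _ hle.
  have h5 : iexp x + b < i.+1.
    rewrite ltnNge; apply/negP => h5; case/negP: nsc; apply: (mem_scales (mem_edges uv)).
    by rewrite h4.
  apply: le_trans (_ : 2 ^+ iexp x * 2 ^+ b <= _)%R; first by rewrite ler_pM2r // exprn_gt0.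
  by rewrite -exprD ler_eXn2l // ltr1n.
have hx u v : aF u v && (weight G [set u; v] <= 2 ^+ i.+1)%R -> (weight G [set u; v] <= 2 ^+ i / 2 ^+ b)%R.
  by move=> /hsmall; rewrite ler_pdivlMr // exprn_gt0.
have hl := walk_length_le hx hw.
have sp : size p < n by move/card_uniqP: Up => /= <-; exact: max_card.
have sb : ((size p)%:R < 2 ^+ b :> R)%R by rewrite -natrX ltr_nat (ltn_trans sp) // lg_gt.
have dl := dist_le hp lp.
have pos1 : (0 < 2 ^+ i :> R)%R by rewrite exprn_gt0.
have pos2 : (0 < 2 ^+ b :> R)%R by rewrite exprn_gt0.
have : (2 ^+ i * 2 ^+ b <= (size p)%:R * 2 ^+ i :> R)%R.
  rewrite -ler_pdivlMr // -mulrA; apply: le_trans hl; exact: le_trans di dl.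
rewrite mulrC ler_pM2r //; lra.
Qed.

End ClusterList.

(** * Label sizes *)

Definition polyb (f : nat -> nat) : Prop :=
  exists ka D, forall b, 0 < b -> f b <= ka * b ^ D.

Lemma polyb_const m : polyb (fun=> m).
Proof. by exists m, 0 => b _; rewrite expn0 muln1. Qed.

Lemma polyb_id : polyb (fun b => b).
Proof. by exists 1, 1 => b _; rewrite expn1 mul1n. Qed.

Lemma polyb_add f g : polyb f -> polyb g -> polyb (fun b => f b + g b).
Proof.
move=> [k1 [D1 h1]] [k2 [D2 h2]]; exists (k1 + k2), (D1 + D2) => b b0.
rewrite mulnDl leq_add //.
  by apply: leq_trans (h1 b b0) _; rewrite leq_mul2l leq_pexp2l ?leq_addr ?orbT.
by apply: leq_trans (h2 b b0) _; rewrite leq_mul2l leq_pexp2l ?leq_addl ?orbT.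
Qed.

Lemma polyb_mul f g : polyb f -> polyb g -> polyb (fun b => f b * g b).
Proof.
move=> [k1 [D1 h1]] [k2 [D2 h2]]; exists (k1 * k2), (D1 + D2) => b b0.
by rewrite expnD mulnACA leq_mul ?h1 ?h2.
Qed.

Lemma polyb_S f : polyb f -> polyb (fun b => (f b).+1).
Proof.
move=> h; have [k [D hk]] := polyb_add h (polyb_const 1).
by exists k, D => b b0; rewrite -addn1; exact: hk.
Qed.

Lemma polyb_double f : polyb f -> polyb (fun b => (f b).*2).
Proof.
move=> h; have [k [D hk]] := polyb_mul (polyb_const 2) h.
by exists k, D => b b0; rewrite -mul2n; exact: hk.
Qed.

Definition nat_size (b : nat) : nat := b.*2.+1.
Definition felt_size (c b : nat) : nat := (field_bits c b).+1.*2.+1.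
Definition seeds_size (c b : nat) : nat := (b * (reps c b * (felt_size c b).+1).+2).+1.
Definition lights_size (b : nat) : nat := (b * (4 * b + 3)).+1.
Definition ventry_size (b : nat) : nat := (8 * b).+1 + (4 * nat_size b + lights_size b).
Definition rep_size (c b : nat) : nat :=
  (levels b).*2.+1 + ((levels b).+1 * (2 * felt_size c b).+1).+1.
Definition eentry_size (c b : nat) : nat :=
  (8 * b).+1 + (4 * nat_size b + (num_bits b).*2.+1 + (b * (reps c b * (rep_size c b).+1).+2).+1).
(** The sum of the bounds for vertex labels, edge labels and headers, so that one constant and one
    exponent serve all of them. *)
Definition total_size (c b : nat) : nat :=
  (2 * nat_size b + seeds_size c b).+1 + b * (ventry_size b).+1 + (b * (eentry_size c b).+1).+1
  + ((8 * b).+2 + 2 * (wp_bits b).+1).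

Ltac polyb_auto :=
  repeat first [ apply: polyb_const | apply: polyb_id | apply: polyb_S | apply: polyb_double
               | apply: polyb_add | apply: polyb_mul ].

Lemma polyb_total_size c : polyb (total_size c).
Proof.
have hwp : polyb wp_bits by rewrite /wp_bits; polyb_auto.
have hnum : polyb num_bits by rewrite /num_bits; polyb_auto.
have hlev : polyb levels by rewrite /levels; polyb_auto.
have hreps : polyb (reps c) by rewrite /reps /half_reps; polyb_auto.
have hfld : polyb (felt_size c).
  by rewrite /felt_size /field_bits /slack; polyb_auto; exact: hnum || exact: hlev || exact: hreps.
have hnat : polyb nat_size by rewrite /nat_size; polyb_auto.
have hrep : polyb (rep_size c).
  by rewrite /rep_size; polyb_auto; exact: hlev || exact: hfld.
have hseeds : polyb (seeds_size c).
  by rewrite /seeds_size; polyb_auto; exact: hreps || exact: hfld.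
have hv : polyb ventry_size by rewrite /ventry_size /lights_size; polyb_auto; exact: hnat.
have he : polyb (eentry_size c).
  by rewrite /eentry_size; polyb_auto; exact: hnat || exact: hnum || exact: hreps || exact: hrep.
by rewrite /total_size; polyb_auto;
  exact: hnat || exact: hseeds || exact: hv || exact: he || exact: hwp.
Qed.

Section Sizes.
Variables (R : realType) (V : finType) (G : wgraph R V) (port : V -> seq V) (v0 : V) (c k : nat).
Local Notation n := #|V|.
Local Notation b := (lg n).
Local Notation FF := (field_of c n).
Local Notation roundT := (round V FF (levels b) (reps c b)).
Variable CL : seq (nat * tcluster R V).
Local Notation clu i := (nth (0, ([set v0], v0, [ffun v => v], [ffun=> 0%R])) CL i).
Hypothesis w_ge1 : forall u v, adj G u v -> (1 <= weight G [set u; v])%R.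
Hypothesis portP : port_numbering G port.
Hypothesis CL_tree : forall x, x \in CL ->
  tree_cluster G (scale_rel G x.1) ((2 * k%:R - 1) * 2 ^+ x.1)%R x.2.
Hypothesis CL_size : size CL <= 2 ^ (4 * b).
Variables (Q : nat) (Q_gt0 : 0 < Q).
Hypothesis CL_count : forall u, count (fun x => u \in cset x.2) CL <= Q * b.
Variables (w : seq roundT) (w_size : size w = b).

Lemma size_enc_field (x : FF) : size (enc (field_nat x)) <= felt_size c b.
Proof. by apply: size_enc_nat; rewrite -card_gf; exact: ltn_ord. Qed.

Lemma size_enc_seeds : size (enc (seeds_of w)) <= seeds_size c b.
Proof.
apply: leq_trans (size_enc_seq_le (m := (reps c b * (felt_size c b).+1).+1) _) _; last first.
  by rewrite size_map w_size.
move=> x /mapP [y _ ->]; apply: leq_trans (size_enc_seq_le (m := felt_size c b) _) _; last first.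
  by rewrite size_map size_enum_ord.
by move=> z /mapP [j _ ->]; exact: size_enc_field.
Qed.

Lemma size_enc_index i : i < size CL -> size (enc i) <= (8 * b).+1.
Proof.
move=> iC; apply: leq_trans (size_enc_nat (leq_trans iC CL_size)) _.
by rewrite -mul2n mulnA.
Qed.

Lemma size_enc_vdata i u : i < size CL -> u \in cset (clu i).2 ->
  size (enc (vertex_data port (clu i).2 u)) <= 4 * nat_size b + lights_size b.
Proof.
move=> iC uY; have ctree := clu_tree v0 CL_tree iC.
have e1 := scale_rel_ge1 w_ge1 (i := (clu i).1).
have psz := port_size portP.
rewrite !size_enc_pair /=.
have h1 := size_enc_nat (ltn_trans (cpre_lt uY) (lg_gt n)).
have h2 : size (enc (cout (clu i).2 u)) <= b.*2.+1.
  apply: size_enc_nat; apply: leq_ltn_trans (lg_gt n).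
  exact: (out_le (cluster_rooted e1 ctree)).
have h3 := size_enc_nat (port_lt psz u (cpar (clu i).2 u)).
have h4 := size_enc_nat (port_lt psz u (heavy (cset (clu i).2) (croot (clu i).2) (cpar (clu i).2) (cdep (clu i).2) u)).
have h5 := size_enc_lights e1 psz ctree uY.
move: h1 h2 h3 h4 h5; rewrite /nat_size /lights_size /parent_port /heavy_port /=.
move: (size _) (size _) (size _) (size _) (size _) => *; lia.
Qed.

Lemma size_entries u : size [seq i <- iota 0 (size CL) | u \in cset (clu i).2] <= Q * b.
Proof.
apply: leq_trans (CL_count u); rewrite size_filter.
by rewrite -[X in _ <= count _ X](mkseq_nth (0, ([set v0], v0, [ffun v => v], [ffun=> 0%R])) CL) count_map.
Qed.

Lemma size_enc_vlab u : size (enc (vlab_of port v0 CL w u)) <= Q * total_size c b.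
Proof.
have h : size (enc (vlab_of port v0 CL w u).2) <= (Q * b * (ventry_size b).+1).+1.
  apply: leq_trans (size_enc_seq_le (m := ventry_size b) _) _; last first.
    by rewrite size_map ltnS leq_mul2r size_entries orbT.
  move=> x /mapP [i]; rewrite mem_filter mem_iota add0n => /and3P [uY _ iC] ->.
  by rewrite size_enc_pair leq_add // ?size_enc_index // size_enc_vdata.
have h1 : size (enc n) <= nat_size b by apply: size_enc_nat; exact: lg_gt.
have h2 : size (enc (enum_rank u : nat)) <= nat_size b.
  by apply: size_enc_nat; apply: ltn_trans (lg_gt n); exact: ltn_ord.
have h3 := size_enc_seeds.
rewrite 3!size_enc_pair.
apply: leq_trans (leq_add (leq_add (leq_add h1 h2) h3) h) _; rewrite /total_size.
move: (nat_size b) (seeds_size c b) (ventry_size b) (eentry_size c b) (wp_bits b) => x1 x2 x3 x4 x5.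
have : x1 + x1 + x2 + 1 <= Q * (x1 + x1 + x2 + 1) by rewrite leq_pmull.
lia.
Qed.

Lemma size_enc_edata i a : i < size CL -> a \in cedges (scale_rel G (clu i).1) (clu i).2 ->
  size (enc (edge_data port v0 (scale_rel G (clu i).1) (clu i).2 w a)) <=
  4 * nat_size b + (num_bits b).*2.+1 + (b * (reps c b * (rep_size c b).+1).+2).+1.
Proof.
move=> iC aE; have ctree := clu_tree v0 CL_tree iC.
have e1 := scale_rel_ge1 w_ge1 (i := (clu i).1).
have psz := port_size portP.
have [uY vY _ _ _] := cedgesP v0 (scale_rel_sym G _) (scale_rel_irr G _) aE.
have h1 := size_enc_nat (ltn_trans (cpre_lt uY) (lg_gt n)).
have h2 := size_enc_nat (ltn_trans (cpre_lt vY) (lg_gt n)).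
have h3 := size_enc_nat (info_num_lt v0 (scale_rel_sym G _) (scale_rel_irr G _) e1 psz ctree aE).
have [h4 h5] : size (enc (cinterval (clu i).2 a).1) <= b.*2.+1 /\ size (enc (cinterval (clu i).2 a).2) <= b.*2.+1.
  rewrite /cinterval; case: edge_intervalP => [d dY dr _|]; last by split; apply: size_enc_nat; rewrite expn_gt0.
  split; apply: size_enc_nat; first exact: ltn_trans (cpre_lt dY) (lg_gt n).
  by apply: leq_ltn_trans (lg_gt n); exact: (out_le (cluster_rooted e1 ctree)).
have h6 : size (enc (edge_data port v0 (scale_rel G (clu i).1) (clu i).2 w a).2) <=
    (b * (reps c b * (rep_size c b).+1).+2).+1.
  apply: leq_trans (size_enc_seq_le (m := (reps c b * (rep_size c b).+1).+1) _) _; last first.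
    by rewrite size_map w_size.
  move=> x /mapP [y _ ->]; apply: leq_trans (size_enc_seq_le (m := rep_size c b) _) _; last first.
    by rewrite size_map size_enum_ord.
  move=> z /mapP [j _ ->]; rewrite size_enc_pair leq_add //.
    by apply: size_enc_nat; exact: ltn_ord.
  apply: leq_trans (size_enc_seq_le (m := 2 * felt_size c b) _) _; last by rewrite size_map size_iota.
  move=> x2 /mapP [l _ ->]; rewrite size_enc_pair mul2n -addnn.
  by apply: leq_add; exact: size_enc_field.
rewrite size_enc_pair leq_add // !size_enc_pair /=.
move: h1 h2 h3 h4 h5; rewrite /nat_size /=.
move: (size _) (size _) (size _) (size _) (size _) => *; lia.
Qed.

Lemma size_enc_elab a : size (enc (elab_of G port v0 CL w a)) <= Q * total_size c b.
Proof.
have sub : size [seq i <- iota 0 (size CL) | a \in cedges (scale_rel G (clu i).1) (clu i).2] <= Q * b.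
  apply: leq_trans (size_entries (eu v0 a)); rewrite !size_filter; apply: sub_count => i /=.
  by move=> /(cedgesP v0 (scale_rel_sym G _) (scale_rel_irr G _)) [].
apply: leq_trans (size_enc_seq_le (m := eentry_size c b) _) _; last first.
  rewrite size_map; apply: leq_trans (_ : (Q * b * (eentry_size c b).+1).+1 <= _).
    by rewrite ltnS leq_mul2r sub orbT.
  rewrite /total_size.
  move: (nat_size b) (seeds_size c b) (ventry_size b) (eentry_size c b) (wp_bits b) => x1 x2 x3 x4 x5.
  lia.
move=> x /mapP [i]; rewrite mem_filter mem_iota add0n => /and3P [aE _ iC] ->.
by rewrite size_enc_pair leq_add // ?size_enc_index // size_enc_edata.
Qed.

End Sizes.

Lemma header_bound_le c f q n : 0 < f -> q <= f -> header_bound n q.+1 <= f * total_size c (lg n).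
Proof.
move=> f0 qf; rewrite /header_bound /total_size.
have h : q.+1 * (wp_bits (lg n)).+1 <= 2 * f * (wp_bits (lg n)).+1 by rewrite leq_mul2r; apply/orP; right; lia.
move: (wp_bits _) (nat_size _) (seeds_size _ _) (ventry_size _) (eentry_size _ _) h => x1 x2 x3 x4 x5 h.
have : (8 * lg n).+2 <= f * (8 * lg n).+2 by rewrite leq_pmull.
lia.
Qed.

(** * Real bounds *)

Section RealBounds.
Variable R : realType.
Local Open Scope ring_scope.

(** From [1 - 1/2 <= exp(-1/2)]. *)
Lemma ln2_ge : 2^-1 <= ln 2 :> R.
Proof.
have h : expR (2^-1) <= 2 :> R.
  have := expR_ge1Dx (- 2^-1 : R); rewrite expRN => h.
  have p : 0 < expR (2^-1) :> R by exact: expR_gt0.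
  have : (1 + - 2^-1) * expR (2^-1) <= 1 :> R by rewrite -ler_pdivlMr // div1r.
  lra.
by rewrite -[leLHS]expRK ler_ln ?posrE ?expR_gt0.
Qed.

Lemma exp2_ln (i : nat) (x : R) : 2 ^+ i <= x -> i%:R <= 2 * ln x.
Proof.
move=> h; have p : 0 < 2 ^+ i :> R by exact: exprn_gt0.
have : ln (2 ^+ i) <= ln x by rewrite ler_ln ?posrE // (lt_le_trans p).
have h2 : i%:R * 2^-1 <= i%:R * ln 2 :> R by rewrite ler_wpM2l // ln2_ge.
rewrite lnXn // -[ln 2 *+ i]mulr_natl => h3; have h4 := le_trans h2 h3.
by move: (ln x) h4 => y; lra.
Qed.

Lemma lg_ln (n : nat) : (0 < n)%N -> (lg n)%:R <= 2 * (1 + ln n%:R) :> R.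
Proof.
move=> n0; have /andP [h _] := trunc_log_bounds (isT : (1 < 2)%N) n0.
have : (trunc_log 2 n)%:R <= 2 * ln n%:R :> R by apply: exp2_ln; rewrite -natrX ler_nat.
by rewrite /lg -natr1; lra.
Qed.

Lemma iexp_ln (W : R) : 1 <= W -> (iexp W)%:R <= 1 + 2 * ln W.
Proof.
move=> W1; have [_] := iexpP W; case: (iexp W) => [|i] h.
  by have := ln_ge0 W1; lra.
rewrite -natr1 addrC lerD2l; apply: exp2_ln; apply: ltW; rewrite ltNge.
by apply/negP => /h; rewrite ltnn.
Qed.

(** For the least [q] with [n <= q^k], [q - 1] is below the root, and the root is at least 1. *)
Lemma root_ceil (n k : nat) : (0 < n)%N -> (0 < k)%N ->
  exists q, [/\ (0 < q)%N, (n <= q ^ k)%N & q%:R <= 2 * n%:R `^ k%:R^-1 :> R].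
Proof.
move=> n0 k0.
have ex : exists q, (n <= q ^ k)%N.
  by exists n; case: k k0 => // k _; rewrite expnS leq_pmulr // expn_gt0 n0.
have r1 : 1 <= n%:R `^ k%:R^-1 :> R.
  by rewrite -[leLHS](powRr0 (n%:R : R)) ler_powR // ?ler1n // invr_ge0.
case: (ex_minnP ex) => -[|q] hq qmin; first by move: hq; rewrite exp0n // leqNgt n0.
exists q.+1; split=> //; rewrite -natr1.
suff : q%:R <= n%:R `^ k%:R^-1 :> R by lra.
have -> : q%:R = (q%:R ^+ k) `^ k%:R^-1 :> R.
  by rewrite -powR_mulrn // -powRrM divff ?powRr1 // pnatr_eq0 -lt0n.
apply: ge0_ler_powR; rewrite ?nnegrE ?invr_ge0 ?exprn_ge0 //.
rewrite -natrX ler_nat ltnW // ltnNge; apply/negP => /qmin.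
by rewrite ltnn.
Qed.

(** [n > 1] gives [ln n >= 1/2], which absorbs the additive constants: [iexp W + lg n + 1 <= 4 + 2
    ln (n W) <= 10 ln (n W)]. The other factor 2 of the 20 comes from rounding the root. *)
Lemma soft_O_label (n k q ka D : nat) (W : R) (x : nat) :
  (1 < n)%N -> 1 <= W -> q%:R <= 2 * n%:R `^ k%:R^-1 :> R ->
  (x <= (iexp W + lg n).+1 * q * (ka * lg n ^ D))%N ->
  x%:R <= soft_O (20 * ka%:R * 2 ^+ D) D n (n%:R `^ k%:R^-1 * ln (n%:R * W)).
Proof.
move=> n1 W1 hq hx; have n0 : (0 < n)%N by exact: ltnW.
have hb := lg_ln n0; have hW := iexp_ln W1.
have lnn : 0 <= ln n%:R :> R by rewrite ln_ge0 // ler1n.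
have lnnW : ln (n%:R * W) = ln n%:R + ln W.
  by rewrite lnM // posrE ?ltr0n // (lt_le_trans ltr01).
have ln2n : 2^-1 <= ln n%:R :> R.
  by apply: le_trans ln2_ge _; rewrite ler_ln ?posrE ?ltr0n // ler_nat.
have lnW := ln_ge0 W1.
have h1 : (iexp W + lg n).+1%:R <= 10 * ln (n%:R * W) by rewrite -natr1 natrD lnnW; lra.
have h2 : (lg n)%:R ^+ D <= 2 ^+ D * (1 + ln n%:R) ^+ D :> R.
  by rewrite -exprMn; apply: lerXn2r; rewrite ?nnegrE ?ler0n //; lra.
apply: le_trans (_ : ((iexp W + lg n).+1 * q * (ka * lg n ^ D))%:R <= _); first by rewrite ler_nat.
rewrite /soft_O !natrM natrX.
apply: le_trans (_ : (10 * ln (n%:R * W)) * (2 * n%:R `^ k%:R^-1) * (ka%:R * (2 ^+ D * (1 + ln n%:R) ^+ D)) <= _).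
  apply: ler_pM => //; rewrite ?mulr_ge0 ?exprn_ge0 //.
    by apply: ler_pM.
  by apply: ler_wpM2l.
by rewrite le_eqVlt; apply/orP; left; apply/eqP; ring.
Qed.

Lemma soft_O_header (n ka D f x : nat) : (0 < n)%N -> (x <= f * (ka * lg n ^ D))%N ->
  x%:R <= soft_O (20 * ka%:R * 2 ^+ D) D n (f%:R : R).
Proof.
move=> n0 hx; have hb := lg_ln n0.
have lnn : 0 <= ln n%:R :> R by rewrite ln_ge0 // ler1n.
have h2 : (lg n)%:R ^+ D <= 2 ^+ D * (1 + ln n%:R) ^+ D :> R.
  by rewrite -exprMn; apply: lerXn2r; rewrite ?nnegrE ?ler0n //; lra.
apply: le_trans (_ : (f * (ka * lg n ^ D))%:R <= _); first by rewrite ler_nat.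
rewrite /soft_O !natrM natrX.
apply: le_trans (_ : f%:R * (ka%:R * (2 ^+ D * (1 + ln n%:R) ^+ D)) <= _).
  by rewrite !ler_wpM2l.
have : 0 <= f%:R * (ka%:R * (2 ^+ D * (1 + ln n%:R) ^+ D)) :> R.
  by rewrite !mulr_ge0 ?exprn_ge0 //; lra.
rewrite (_ : _ * _ * f%:R * _ = 20 * (f%:R * (ka%:R * (2 ^+ D * (1 + ln n%:R) ^+ D)))); last by ring.
lra.
Qed.

Lemma soft_O_ge0 (C : R) (D n : nat) (g : R) : 0 <= C -> 0 <= g -> (0 < n)%N -> 0 <= soft_O C D n g.
Proof.
move=> C0 g0 n0; rewrite /soft_O !mulr_ge0 // exprn_ge0 // addr_ge0 // ln_ge0 // ler1n //.
Qed.

Lemma coin_bijection (T : finType) (r : nat) : #|T| = (2 ^ r)%N ->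
  exists phi : r.-tuple bool -> T, bijective phi.
Proof.
move=> hT; have hc : #|{: r.-tuple bool}| = #|T| by rewrite card_tuple card_bool hT.
exists (fun x => enum_val (cast_ord hc (enum_rank x))).
exists (fun y => enum_val (cast_ord (esym hc) (enum_rank y))) => x.
  by rewrite enum_valK cast_ordK enum_rankK.
by rewrite enum_valK cast_ordKV enum_rankK.
Qed.

Lemma coin_prob_ge (T : finType) (r m : nat) (phi : r.-tuple bool -> T) (bad : {set T}) (P : T -> Prop) :
  #|T| = (2 ^ r)%N -> bijective phi -> (#|bad| * 2 ^ m <= #|T|)%N -> (forall y, y \notin bad -> P y) ->
  1 - 2 ^- m <= coin_prob R (fun x => P (phi x)).
Proof.
move=> hT bphi hbad hP; rewrite /coin_prob; set A := [set x | _].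
have hA : (2 ^ r <= #|A| + #|bad|)%N.
  have <- : #|phi @^-1: bad| = #|bad| by apply: on_card_preimset; exact: onW_bij.
  have <- : #|{: r.-tuple bool}| = (2 ^ r)%N by rewrite card_tuple card_bool.
  rewrite -(cardsC A) leq_add2l; apply: subset_leq_card; apply/fintype.subsetP => x.
  rewrite !inE => nx; apply: contraNT nx => nb; apply/asboolP; exact: hP.
have p1 : 0 < 2 ^+ r :> R by exact: exprn_gt0.
have p2 : 0 < 2 ^+ m :> R by exact: exprn_gt0.
rewrite ler_pdivlMr // mulrBl mul1r lerBlDr.
apply: le_trans (_ : #|A|%:R + #|bad|%:R <= _); first by rewrite -natrX -natrD ler_nat.
rewrite lerD2l mulrC ler_pdivlMr // -!natrX -natrM ler_nat -hT //.
Qed.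

End RealBounds.

(** * Assembly of the scheme and its failure probability *)

Local Open Scope ring_scope.

Theorem theorem5p3 (R : realType) (c : nat) :
  exists (A : routing_algorithm) (C : R) (D : nat),
  forall (V : finType) (G : wgraph R V) (W : R) (port : V -> seq V) (k f : nat),
    1 <= W -> weights_in G W -> port_numbering G port ->
    (1 <= k)%N -> (1 <= f)%N ->
    let n := #|V| in
    let small (b : bits) : Prop :=
      (size b)%:R <= soft_O C D n (n%:R `^ k%:R^-1 * ln (n%:R * W)) in
    exists (r : nat) (S : r.-tuple bool -> routing_data V),
      (forall x, [/\ forall u : V, small (table (S x) u),
                     forall u : V, small (vlabel (S x) u)
                   & forall e : {set V}, e \in edges G -> small (elabel (S x) e)])
      /\
      (forall (s t : V) (F : {set {set V}}) (Fs : seq {set V}),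
         F \subset edges G -> (#|F| <= f)%N -> perm_eq Fs (enum F) ->
         (forall x p u h, message_at A port (S x) s t Fs p u h ->
            (size h)%:R <= soft_O C D n (f%:R : R))
         /\
         (connect (adj_minus G F) s t ->
          coin_prob R (fun x => routes_within A G port (S x) s t F Fs
             ((8 * k%:R - 2) * (#|F|%:R + 1) * dist_minus G F s t))
          >= 1 - n%:R ^- c)).
Proof.
have [ka [D hpoly]] := polyb_total_size c.
exists (algorithm c), (20 * ka%:R * 2 ^+ D), D => V G W port k f W1 wW portP k1 f1 n small.
have C0 : 0 <= 20 * ka%:R * 2 ^+ D :> R by rewrite !mulr_ge0 // exprn_ge0.
(* With one vertex and [W = 1] the label bound is 0, so labels must be empty; the probability
   required is then [1 - 1 = 0]. *)
have [n1|n1] := leqP n 1.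
  exists 0%N, (fun=> RoutingData (fun=> [::]) (fun=> [::]) (fun=> [::])).
  have n_eq (u : V) : n = 1%N by apply/eqP; rewrite eqn_leq n1; apply/card_gt0P; exists u.
  have nil_small (u : V) : small [::].
    apply: soft_O_ge0 => //; last by rewrite (n_eq u).
    by rewrite mulr_ge0 ?powR_ge0 // (n_eq u) mul1r ln_ge0.
  split=> [x|s t F Fs _ _ _].
    split=> [u|u|e]; [exact: nil_small u|exact: nil_small u|].
    by rewrite inE => /existsP [u _]; exact: nil_small u.
  split=> [x p u h /message_size|_].
    rewrite /initial_header /= /route_init eqxx leqn0 size_eq0 => /eqP ->.
    by apply: soft_O_ge0 => //; rewrite (n_eq s).
  rewrite (n_eq s) expr1n invr1 subrr /coin_prob; exact: divr_ge0.
have n0 : (0 < n)%N by exact: ltnW.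
have /card_gt0P [v0 _] := n0.
have [q [q0 nqk hq]] := root_ceil R n0 k1.
have [CL [CL_tree CL_sorted CL_size CL_count CL_cover]] := cluster_list_exists wW k1 q0 nqk.
have w1 := adj_ge1 wW.
pose T : finType := {: (lg n).-tuple (round V (field_of c n) (levels (lg n)) (reps c (lg n)))}.
(* A field element and one number below [2^levels] for each vertex set, per repetition and round.
   All cardinalities are powers of two, so fair coins sample the space exactly. *)
pose r := ((((field_bits c (lg n)).+1 + levels (lg n) * #|{set V}|) * reps c (lg n)) * lg n)%N.
have cT : #|T| = (2 ^ r)%N.
  by rewrite /T card_tuple card_ffun card_prod card_ffun card_gf !card_ord -(expnM 2 (levels _)) -expnD
    -!expnM mulnA.
have [phi bphi] := coin_bijection cT.
exists r, (fun x => scheme G port v0 CL (phi x)).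
pose Q := ((iexp W + lg n).+1 * q)%N.
have Q0 : (0 < Q)%N by rewrite muln_gt0.
have CL_countQ u : (count (fun x => u \in cset x.2) CL <= Q * lg n)%N by rewrite -mulnA.
have lg0 : (0 < lg n)%N by [].
have smallP (b : bits) : (size b <= Q * total_size c (lg n))%N -> small b.
  move=> hb; apply: soft_O_label n1 W1 hq _; apply: leq_trans hb _.
  by rewrite leq_mul2l hpoly ?orbT.
split=> [x|s t F Fs FE Ff FFs].
  split=> [u|u|e _]; apply: smallP.
  - exact: (size_enc_vlab v0 w1 portP CL_tree CL_size Q0 CL_countQ (size_tuple _)).
  - exact: (size_enc_vlab v0 w1 portP CL_tree CL_size Q0 CL_countQ (size_tuple _)).
  - exact: (size_enc_elab v0 w1 portP CL_tree CL_size Q0 CL_countQ (size_tuple _)).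
split=> [x p u h /message_size hs|cst].
  apply: soft_O_header n0 _; apply: leq_trans hs _.
  apply: leq_trans (initial_header_size G port v0 CL (phi x) s t Fs) _.
  apply: leq_trans (header_bound_le c n f1 _) _; first by rewrite (Fs_size FFs).
  by rewrite leq_mul2l hpoly ?orbT.
pose bad := [set w : T | [exists i : 'I_(size CL), bad_at G port v0 (c := c) CL Fs i w]].
have hbad : (#|bad| * 2 ^ (c * lg n) <= #|T|)%N := card_bad_coins v0 c w1 portP CL_tree CL_size Fs.
have nb : (n <= 2 ^ lg n)%N by apply: ltnW; exact: lg_gt.
apply: le_trans (_ : 1 - 2 ^- (c * lg n) <= _).
  rewrite lerD2l lerN2 lef_pV2 ?posrE ?exprn_gt0 ?ltr0n // -!natrX ler_nat mulnC expnM.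
  by case: (c) => // c'; rewrite leq_exp2r.
apply: (coin_prob_ge R (P := fun w : T => routes_within (algorithm c) G port
  (scheme G port v0 CL w) s t F Fs ((8 * k%:R - 2) * (#|F|%:R + 1) * dist_minus G F s t))
  cT bphi hbad) => w; rewrite inE => /existsPn nbad.
have good : good_coins G port v0 CL Fs w by move=> i iC; exact: nbad (Ordinal iC).
have d0 : 0 <= dist_minus G F s t.
  by apply: dist_ge cst _ => p hp _; exact: (walk_length_ge0 (adj_minus_ge1 wW (F := F)) hp).
have K1 : 1 <= k%:R :> R by rewrite ler1n.
have F0 : 0 <= #|F|%:R :> R by [].
have [st|st] := eqVneq s t.
  subst t; exists [::]; split=> //; last by rewrite /= !mulr_ge0 //; lra.
  have hnil : initial_header (algorithm c) (scheme G port v0 CL w) s s Fs = [::].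
    by rewrite /initial_header /= /route_init eqxx.
  by exists [::]; split=> //; rewrite -hnil; exact: message_start.
have [i [p [iS hp lp len_p hi]]] := scale_for_query wW st cst.
have [cl clCL hball] := CL_cover i s iS.
have jC : (index (i, cl) CL < size CL)%N by rewrite index_mem.
set dflt := (0%N, ([set v0], v0, [ffun v => v], [ffun=> 0])) : nat * tcluster R V.
have nthj : nth dflt CL (index (i, cl) CL) = (i, cl) by exact: nth_index.
have hpw := walk_edge_le (adj_minus_ge1 wW (F := F)) hp len_p.
have hpe : path (scale_rel G i) s p.
  by apply: sub_path hpw => u v /andP [/andP [h1 _] h2]; rewrite /scale_rel h1.
have sY : s \in cset cl by apply: (fintype.subsetP hball); exact: ball_center.
have hin : path (induced (avoid (scale_rel G i) Fs) (cset cl)) s p.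
  have h1 := walk_in_ball (scale_rel_ge1 w1 (i := i)) hpe len_p.
  apply: sub_path (path_and h1 hp) => u v /andP [/and3P [e1 uB vB] /andP [_ nF]].
  rewrite /induced /avoid e1 (mem_Fs FFs) nF /=.
  by rewrite (fintype.subsetP hball) // (fintype.subsetP hball).
have [||p' [j [hj jC' hdel hpath hlen]]] := cluster_delivers w1 portP CL_tree CL_size
    (size_tuple w) FFs good k1 (p := p) st jC _ _ lp; rewrite -/dflt ?nthj //.
exists p'; split=> //; apply: le_trans hlen _.
(* The list is sorted by scale, so an earlier cluster has no larger scale. *)
have hji : ((nth dflt CL j).1 <= i)%N.
  have := sorted_leq_nth leq_trans leqnn 0%N CL_sorted; move=> /(_ j (index (i, cl) CL)).
  by rewrite !inE !size_map !(nth_map dflt) // nthj; apply.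
have h2j : 2 ^+ (nth dflt CL j).1 <= 2 * dist_minus G F s t.
  by apply: le_trans hi; rewrite ler_eXn2l // ltr1n.
(* A scale of at most twice the distance turns [4k - 1] into [8k - 2]. *)
rewrite -/dflt (_ : _ * dist_minus G F s t = (#|F|%:R + 1) * (4 * k%:R - 1) * (2 * dist_minus G F s t)).
  by rewrite ler_wpM2l // !mulr_ge0 //; lra.
by ring.
Qed.
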